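(* Let $1\le p,q\le\infty$. There is a constant $C>0$, depending only on $p$ and $q$ (the orthonormal system $\{\phi_{\mathbf m}\}$ being fixed), such that the following holds. Let $\lambda:[0,\infty)\to\mathbb{R}$ be a function such that $t\mapsto|\lambda(t)|$ is non-increasing, and let $\Lambda=\{\lambda_{\mathbf k}\}_{\mathbf k\in\mathbb{N}_0^d}$ be the multiplier operator with $\lambda_{\mathbf k}=\lambda(|\mathbf k|)$. Then for all $N,k\in\mathbb{N}$, with $n=\dim\mathcal T_N=\sum_{l=0}^N d_l$, $$e_k(\Lambda U_p,L^q)\ \ge\ C\,2^{-k/n}\left(\prod_{l=0}^N|\lambda(l)|^{d_l}\right)^{1/n}\mathcal V_n,$$ where $$\mathcal V_n=\begin{cases}1, & p<\infty,\ q>1,\\ (\log_2 n)^{-1/2}, & p<\infty,\ q=1,\\ (\log_2 n)^{-1/2}, & p=\infty,\ q>1,\\ (\log_2 n)^{-1}, & p=\infty,\ q=1.\end{cases}$$ In particular, if $k=n$, then $$e_n(\Lambda U_p,L^q)\ge C\,|\lambda(N)|\,\mathcal V_n .$$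
   Context: $\mathbb{N}$ is the set of positive integers, $\mathbb{N}_0=\mathbb{N}\cup\{0\}$, $d\in\mathbb{N}$. For $\mathbf k\in\mathbb{N}_0^d$, $|\mathbf k|=(k_1^2+\cdots+k_d^2)^{1/2}$; $A_l=\{\mathbf k\in\mathbb{N}_0^d:|\mathbf k|\le l\}$ for $l\in\mathbb{N}_0$ and $A_{-1}=\emptyset$. Setting: $(\Omega,\mathcal A,\mu)$ is the product of $d$ probability spaces $(\Omega_j,\mathcal A_j,\mu_j)$, $L^p=L^p(\Omega)$ is the real $L^p$ space and $U_p$ its closed unit ball. $\{\phi_{\mathbf m}\}_{\mathbf m\in\mathbb{N}_0^d}$ is a fixed complete orthonormal set of $L^2(\Omega,\mathcal A,\mu)$ consisting of real-valued functions for which there is a constant $K>0$ with $\|\phi_{\mathbf m}\|_\infty\le K$ for all $\mathbf m$. For $\varphi\in L^1(\Omega)$, $\widehat\varphi(\mathbf m)=\int_\Omega\varphi\,\phi_{\mathbf m}\,d\mu$. Let $\mathcal H_l$ be the linear span of $\{\phi_{\mathbf k}:\mathbf k\in A_l\setminus A_{l-1}\}$, $d_l=\dim\mathcal H_l$, $\mathcal T_N=\bigoplus_{l=0}^N\mathcal H_l$, $\mathcal H=\bigcup_N\mathcal T_N$. Multiplier operators: given a real sequence $\Lambda=\{\lambda_{\mathbf k}\}_{\mathbf k\in\mathbb{N}_0^d}$, define $\Lambda:\mathcal H\to\mathcal H$ by $\Lambda(\sum a_{\mathbf k}\phi_{\mathbf k})=\sum\lambda_{\mathbf k}a_{\mathbf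 k}\phi_{\mathbf k}$. $\Lambda$ is bounded from $L^p$ to $L^q$ if for every $\varphi\in L^p$ there is $f=\Lambda\varphi\in L^q$ with formal Fourier expansion $\sum_{\mathbf k}\lambda_{\mathbf k}\widehat\varphi(\mathbf k)\phi_{\mathbf k}$ and $\sup\{\|\Lambda\varphi\|_q:\varphi\in U_p\}<\infty$; the extension of $\Lambda$ to $L^p$ is again denoted $\Lambda$. Entropy numbers: for a subset $A$ of a Banach space $X$ with closed unit ball $B_X$, $$e_n(A,X)=\inf\Big\{\epsilon>0: A\subset\bigcup_{k=1}^{2^{n-1}}(x_k+\epsilon B_X)\text{ for some }x_1,\dots,x_{2^{n-1}}\in X\Big\}.$$ If $\Lambda$ is not bounded from $L^p$ to $L^q$, $e_n(\Lambda U_p,L^q)$ is read as $+\infty$. *)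

(* Defs.v *)
From HB Require Import structures.
From mathcomp Require Import all_boot all_order all_algebra.
From mathcomp Require Import all_classical all_reals all_analysis.
Set Implicit Arguments.
Unset Strict Implicit.
Unset Printing Implicit Defensive.
Import Order.TTheory GRing.Theory Num.Theory.
Import numFieldNormedType.Exports.
Local Open Scope classical_set_scope.
Local Open Scope ring_scope.

Section product_space.
Context (d : nat) (disp : 'I_d -> measure_display)
  (T : forall j, measurableType (disp j)).

(* [prod_topology T] is [forall j, T j] with its pointed structure. *)
Definition coordinate_sets : set (set (prod_topology T)) :=
  \bigcup_(j in [set: 'I_d])
    preimage_set_system setT (fun x : prod_topology T => x j) measurable.

(* The set of all families (x_j)_j, with the product sigma-algebra. *)
Definition product_space := g_sigma_algebraType coordinate_sets.

(* By Dynkin's pi-lambda theorem this determines mu: it is the product of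
   the nu_j. *)
Definition is_product_measure (R : realType)
    (nu : forall j, probability (T j) R)
    (mu : set product_space -> \bar R) : Prop :=
  forall B : forall j, set (T j), (forall j, measurable (B j)) ->
    mu [set x : product_space | forall j, B j (x j)] =
    (\prod_(j < d) nu j (B j))%E.

End product_space.

Section multi_indices.
Context (R : realType) (d : nat).

Definition multi_index := {ffun 'I_d -> nat}.

Definition euclidean_norm (k : multi_index) : R :=
  Num.sqrt (\sum_(j < d) (k j)%:R ^+ 2).

(* Indexed by int so as to include the case l = -1, where it is empty. *)
Definition index_ball (l : int) : set multi_index :=
  [set k | euclidean_norm k <= l%:~R].

Definition index_shell (l : nat) : set multi_index :=
  index_ball l%:Z `\` index_ball (l%:Z - 1).

End multi_indices.

(* Elements of L^p are represented by functions; subspaces, linear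
   independence and coverings are accordingly taken up to mu-a.e. equality. *)
Section multipliers.
Context (R : realType) (d : nat) (disp : measure_display)
  (Omega : measurableType disp) (mu : probability Omega R).

Definition unit_ball (p : \bar R) : set (Omega -> R) :=
  [set f | f \in Lfun mu p /\ ('N[mu]_p[EFin \o f] <= 1)%E].

Definition is_basis (V : set (Omega -> R)) (n : nat)
    (b : 'I_n -> Omega -> R) : Prop :=
  [/\ forall i, V (b i),
      forall a : 'I_n -> R,
        (fun x => \sum_(i < n) a i * b i x) = cst 0 %[ae mu] ->
        forall i, a i = 0
    & forall f, V f -> exists a : 'I_n -> R,
        f = (fun x => \sum_(i < n) a i * b i x) %[ae mu] ].

(* Meaningful for finite-dimensional V only (junk value 0 otherwise). *)
Definition ae_dim (V : set (Omega -> R)) : nat :=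
  xget 0%N [set n | exists b : 'I_n -> Omega -> R, is_basis V b].

(* e_n(A, L^q), +oo when no eps > 0 is admissible. *)
Definition entropy_number (q : \bar R) (A : set (Omega -> R)) (n : nat) :
    \bar R :=
  ereal_inf [set eps%:E | eps in [set eps : R | 0 < eps /\
    exists c : 'I_(2 ^ n.-1) -> Omega -> R,
      (forall i, c i \in Lfun mu q) /\
      forall f, A f -> exists i, ('N[mu]_q[EFin \o (f \- c i)%R] <= eps%:E)%E]].

Variable phi : multi_index d -> Omega -> R.

Definition fourier (f : Omega -> R) (m : multi_index d) : R :=
  \int[mu]_x (f x * phi m x).

Definition complete_orthonormal : Prop :=
  [/\ forall m, phi m \in Lfun mu 2%:E,
      forall m m', \int[mu]_x (phi m x * phi m' x) = (m == m')%:R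
    & forall f, f \in Lfun mu 2%:E -> (forall m, fourier f m = 0) ->
        f = cst 0 %[ae mu] ].

Definition Hspace (l : nat) : set (Omega -> R) :=
  [set f | exists (s : seq (multi_index d)) (a : multi_index d -> R),
    (forall k, k \in s -> index_shell R l k) /\
    f = (fun x => \sum_(k <- s) a k * phi k x)].

Definition Tspace (N : nat) : set (Omega -> R) :=
  [set f | exists h : 'I_N.+1 -> Omega -> R,
    (forall l : 'I_N.+1, Hspace l (h l)) /\ f = (fun x => \sum_(l < N.+1) h l x)].

Variable lam : multi_index d -> R.

(* g is a value of (Lambda f) in L^q, i.e. g has the formal Fourier expansion
   \sum_k lam_k \hat f(k) phi_k. For f in the span of the phi_k this holds for
   g = \sum_k lam_k \hat f(k) phi_k. *)
Definition multiplier_value (q : \bar R) (f g : Omega -> R) : Prop :=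
  g \in Lfun mu q /\ forall m, fourier g m = lam m * fourier f m.

(* Lambda U_p. If the Fourier coefficients determine the elements of L^q, this
   is the image of U_p under the operator Lambda; if they do not, "Lambda f" is
   ambiguous and all its values are included (so that Lambda is unbounded). *)
Definition multiplier_ball (p q : \bar R) : set (Omega -> R) :=
  [set g | exists2 f, unit_ball p f & multiplier_value q f g].

Definition multiplier_bounded (p q : \bar R) : Prop :=
  (forall f, f \in Lfun mu p -> exists g, multiplier_value q f g) /\
  (ereal_sup [set 'N[mu]_q[EFin \o g] | g in multiplier_ball p q] < +oo)%E.

(* e_n(Lambda U_p, L^q) *)
Definition multiplier_entropy (p q : \bar R) (n : nat) : \bar R :=
  if `[< multiplier_bounded p q >]
  then entropy_number q (multiplier_ball p q) n else +oo%E.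

End multipliers.

Definition log2 (R : realType) (x : R) : R := ln x / ln 2.

(* The factor V_n, for 1 <= p, q <= +oo. *)
Definition Vfactor (R : realType) (p q : \bar R) (n : nat) : R :=
  match p == +oo%E, q == 1%E with
  | false, false => 1
  | false, true => log2 n%:R `^ (- 2^-1)
  | true, false => log2 n%:R `^ (- 2^-1)
  | true, true => (log2 n%:R)^-1
  end.

(* Main.v *)
Require Import Defs.
From HB Require Import structures.
From mathcomp Require Import all_boot all_order all_algebra.
From mathcomp Require Import all_classical all_reals all_analysis.
From mathcomp Require Import measurable_realfun ess_sup_inf.
From mathcomp Require Import perm.
From mathcomp Require Import ring lra.
Set Implicit Arguments.
Unset Strict Implicit.
Unset Printing Implicit Defensive.
Import Order.TTheory GRing.Theory Num.Theory.
Import numFieldNormedType.Exports.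
Local Open Scope classical_set_scope.
Local Open Scope ring_scope.

(** Let [F] be a set of [n] frequencies. To a point [a] of the cube
    [[-1, 1]^n] attach the sum [f_a = n^(-1/2) \sum_(i in F) a_i phi_i]; its
    image under the multiplier operator is
    [n^(-1/2) \sum_(i in F) lam_i a_i phi_i]. If [Lambda U_p] is covered by
    [2^(k-1)] balls of radius [eps] of [L^q], hence of [L^1], and if [f_a] lies
    in a fixed multiple of [U_p] for most [a], then these balls cover the
    images of most of the cube, and comparing volumes gives
    [\prod_(i in F) |lam_i| <= 2^k (C eps)^n], which is the claim for the
    geometric mean of the [|lam_i|].

    The volume of an [L^1] ball is estimated by sampling
    ([integral_expR_l1_le]): replace its indicator by
    [exp (- s ||\sum_i lam_i a_i phi_i - c||_1)] and choose points
    [x_1, ..., x_n] at random with density [det (phi_i (x_j))^2 / n!]. Each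
    [x_j] has the density [n^-1 \sum_i phi_i^2 <= K^2], so the norm
    [||g||_1] is at least [K^-2] times the mean of [|g (x_j)|], and Jensen's
    inequality takes this mean out of the exponential. For fixed points the
    map from [a] to the values of [\sum_i lam_i a_i phi_i] at these points is
    linear, of determinant [\prod_i lam_i * det (phi_i (x_j))]; integrating
    over [a] therefore produces the inverse of this determinant, which one
    factor of the density cancels, and the mean of the remaining factor is at
    most [(n!)^(-1/2)]. As [L^1] is the largest target space, the bound holds
    for all [q] at once, without any logarithm for [q = 1].

    The sums [f_a] are subgaussian because the [phi_i] are bounded: for most
    [a], [exp (th f_a)] and [exp (- th f_a)] have integrals of order
    [exp (2 th^2 K^2)] ([prod_le_covering]). For [p] finite and [th = 1] this
    bounds the [L^p] norm by a constant ([entropy_lower_bound_finite_p]). For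
    [p = oo] and [th] of order [(ln n)^(1/2)], it says that truncating [f_a] at
    a height [tau] of the same order changes it by a function [G] whose square
    has an integral of at most [delta^2 / n], so that the Fourier coefficients
    of [f_a] in [F] can be restored at a bounded cost
    ([exists_bounded_lift]). The coefficients of [G] outside [F] remain. They
    do no harm if [|lam_j| <= A t] outside [F], where [t] is the geometric mean
    of the [|lam_i|] divided by [2^(k/n)]: the image of the perturbation is
    then at most [A t delta] in [L^2], which for [delta] small is absorbed
    ([entropy_lower_bound_infinite_p]). This condition is obtained by adjoining
    to [F], as long as there is one, a frequency with [|lam_j| > e^2 t], which
    never decreases [t / (ln n)^(1/2)]; the process stops because the
    multipliers are bounded ([exists_dominating_index_set]).

    For [lam_k = lambda |k|] and [F] the set of frequencies of norm at most
    [N], monotonicity gives [|lam_k| >= |lambda l|] on the [l]-th shell, so the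
    product over [F] dominates [\prod_l |lambda l|^(d_l)]. *)

(** * Powers of a probability measure *)

Section power_measure.
Context {dT : measure_display} {T : measurableType dT} {R : realType}.
Variable P : probability T R.

(** Adding the new point in front makes an integral over [n.+1] independent points
    an iterated one, the outer integral running over the first point. *)
Definition tcons n (z : T * n.-tuple T) : n.+1.-tuple T := [tuple of z.1 :: z.2].
Arguments tcons : simpl never.

Lemma measurable_tcons n : measurable_fun [set: T * n.-tuple T] (@tcons n).
Proof. by apply: measurable_cons. Qed.

HB.instance Definition _ n :=
  isMeasurableFun.Build _ _ _ _ (@tcons n) (@measurable_tcons n).

Fixpoint power_measure n : probability (n.-tuple T) R :=
  if n is m.+1 then distribution (P \x power_measure m)%E (@tcons m)
  else \d_([tuple]).

Lemma ge0_integral_power_measureS n (f : n.+1.-tuple T -> \bar R) :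
  measurable_fun [set: n.+1.-tuple T] f -> (forall t, (0 <= f t)%E) ->
  (\int[power_measure n.+1]_t f t =
   \int[P]_x \int[power_measure n]_t f (tcons (x, t)))%E.
Proof.
move=> mf f0 /=; rewrite ge0_integral_distribution//.
rewrite fubini_tonelli1//=.
by apply: measurableT_comp => //; exact: measurable_tcons.
Qed.

Lemma integral_power_measure0 (f : 0.-tuple T -> \bar R) :
  measurable_fun [set: 0.-tuple T] f ->
  (\int[power_measure 0]_t f t = f [tuple])%E.
Proof. by move=> mf; rewrite /= integral_dirac// diracT mul1e. Qed.

Lemma tnth_tcons0 n x (t : n.-tuple T) : tnth (tcons (x, t)) ord0 = x.
Proof. by []. Qed.

Lemma tnth_tconsS n x (t : n.-tuple T) i :
  tnth (tcons (x, t)) (lift ord0 i) = tnth t i.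
Proof. by rewrite tnthS. Qed.

Lemma measurable_prod_tnth n (h : 'I_n -> T -> R) :
  (forall i, measurable_fun setT (h i)) ->
  measurable_fun [set: n.-tuple T] (fun t => \prod_(i < n) h i (tnth t i)).
Proof.
move=> mh; apply: measurable_prod => i _ /=.
by apply: measurableT_comp; [exact: mh|exact: measurable_tnth].
Qed.

Lemma ge0_integral_prod_tnth n (h : 'I_n -> T -> R) :
  (forall i, measurable_fun setT (h i)) -> (forall i x, 0 <= h i x) ->
  (\int[power_measure n]_t (\prod_(i < n) h i (tnth t i))%:E =
   \prod_(i < n) \int[P]_x (h i x)%:E)%E.
Proof.
elim: n h => [|n IH] h mh h0.
  rewrite integral_power_measure0 ?big_ord0//.
  by apply/measurable_EFinP; exact: measurable_prod_tnth.
rewrite ge0_integral_power_measureS; last 2 first.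
- by apply/measurable_EFinP; exact: measurable_prod_tnth.
- by move=> t; rewrite lee_fin prodr_ge0.
rewrite big_ord_recl -IH//.
have mn : measurable_fun [set: n.-tuple T]
    (fun t => \prod_(i < n) h (lift ord0 i) (tnth t i)).
  by apply: (measurable_prod_tnth (h := fun i => h (lift ord0 i))) => i; exact: mh.
rewrite -ge0_integralZr//=; last 3 first.
- by apply/measurable_EFinP; exact: mh.
- by move=> x _; rewrite lee_fin.
- by apply: integral_ge0 => t _; rewrite lee_fin prodr_ge0.
apply: eq_integral => x _.
rewrite -ge0_integralZl//=; last 3 first.
- exact/measurable_EFinP.
- by move=> t _; rewrite lee_fin prodr_ge0.
- by rewrite lee_fin.
apply: eq_integral => t _; rewrite big_ord_recl tnth_tcons0 EFinM.
by congr (_ * _%:E)%E; apply: eq_bigr => i _; rewrite tnth_tconsS.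
Qed.

Lemma integrable_prod_tnth n (h : 'I_n -> T -> R) :
  (forall i, P.-integrable setT (EFin \o h i)) ->
  (power_measure n).-integrable setT
    (fun t => (\prod_(i < n) h i (tnth t i))%:E).
Proof.
move=> ih; have mh i : measurable_fun setT (h i).
  exact/measurable_EFinP/(measurable_int _ (ih i)).
apply/integrableP; split.
  by apply/measurable_EFinP; exact: measurable_prod_tnth.
under eq_integral do rewrite /= normr_prod.
rewrite (ge0_integral_prod_tnth (h := fun i x => `|h i x|))//; last first.
  by move=> i; exact: measurableT_comp.
have : (0 <= \prod_(i < n) \int[P]_x `|h i x|%:E < +oo)%E.
  elim/big_ind: _ => [|x y /andP[x0 xy] /andP[y0 yy]|i _]; first by rewrite lee01 ltry.
    rewrite mule_ge0//= -ge0_fin_numE ?mule_ge0// fin_numM// ge0_fin_numE//.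
  rewrite integral_ge0; last by move=> x _; rewrite lee_fin.
  by have /integrableP[] := ih i.
by case/andP.
Qed.

Lemma integral_prod_tnth n (h : 'I_n -> T -> R) :
  (forall i, P.-integrable setT (EFin \o h i)) ->
  (\int[power_measure n]_t (\prod_(i < n) h i (tnth t i))%:E)%E =
  (\prod_(i < n) \int[P]_x h i x)%:E.
Proof.
elim: n h => [|n IH] h ih.
  rewrite integral_power_measure0 ?big_ord0//.
  apply/measurable_EFinP; apply: measurable_prod_tnth => i.
  exact/measurable_EFinP/(measurable_int _ (ih i)).
set f := (fun t : n.+1.-tuple T => (\prod_(i < n.+1) h i (tnth t i))%:E).
have intf : (power_measure n.+1).-integrable setT f.
  exact: integrable_prod_tnth.
have mf : measurable_fun [set: n.+1.-tuple T] f := measurable_int _ intf.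
have intfc : (P \x power_measure n)%E.-integrable setT (f \o @tcons n).
  apply/integrableP; split.
    by apply: measurableT_comp => //; exact: measurable_tcons.
  have /integrableP[_] := intf.
  rewrite /= ge0_integral_distribution//.
  apply/measurable_EFinP; apply: measurableT_comp => //.
  by apply: measurable_prod_tnth => i; exact/measurable_EFinP/(measurable_int _ (ih i)).
rewrite /= integral_distribution//= -integral12_prod_meas1//= /fubini_F.
have fin0 : (\int[P]_x (h ord0 x)%:E)%E \is a fin_num.
  by apply: integrable_fin_num => //; exact: ih.
rewrite big_ord_recl EFinM [in RHS]/Rintegral fineK// muleC.
rewrite -(IH (fun i => h (lift ord0 i)))//.
set I := (\int[power_measure n]_t (\prod_(i < n) h (lift ord0 i) (tnth t i))%:E)%E.
have Ifin : I \is a fin_num.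
  apply: integrable_fin_num => //.
  by apply: (integrable_prod_tnth (h := fun i => h (lift ord0 i))) => i; exact: ih.
rewrite -(fineK Ifin) -integralZl//; last exact: ih.
apply: eq_integral => x _.
rewrite fineK// muleC -integralZl//; last first.
  by apply: (integrable_prod_tnth (h := fun i => h (lift ord0 i))) => i; exact: ih.
apply: eq_integral => t _ /=.
rewrite /f big_ord_recl tnth_tcons0 EFinM.
by congr (_ * _%:E)%E; apply: eq_bigr => i _; rewrite tnth_tconsS.
Qed.

End power_measure.

(** * Affine images of the uniform distribution *)

Section affine_substitution.
Context {R : realType}.
Local Notation leb := (@lebesgue_measure R).

Let affine (a b : R) (x : R) : measurableTypeR R := a * x + b.

Let measurable_affine a b : measurable_fun [set: measurableTypeR R] (affine a b).
Proof. by apply: measurable_funD => //; exact: measurable_funM. Qed.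

Let affine_image a b : {measure set (measurableTypeR R) -> \bar R} :=
  measure_function_pushforward__canonical__measure_function_Measure leb
    (measurable_affine a b).

Let lebesgue_measure_affine (a : {posnum R}) b (A : set R) : measurable A ->
  mscale (a%:num%:nng) (affine_image a%:num b) A = leb A.
Proof.
move=> mA; apply/esym.
apply: (lebesgue_measure_unique (mu := mscale (a%:num%:nng) (affine_image a%:num b)))
  => //= _ [[u v]] _ <-.
rewrite /mscale/= /pushforward.
have -> : affine a%:num b @^-1` `]u, v] =
    `](u - b) / a%:num, (v - b) / a%:num]%classic.
  apply/seteqP; split => x /=;
    by rewrite !in_itv/= /affine ltr_pdivrMr// ler_pdivlMr// ltrBlDr lerBrDr (mulrC x).
rewrite !lebesgue_measure_itv/= !lte_fin ltr_pM2r// ltrD2r.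
case: ifPn => uv; last by rewrite mule0.
rewrite -EFinB -EFinB -EFinM; congr _%:E.
by field.
Qed.

(** The affine image of Lebesgue measure, rescaled, has the right value on
    intervals, hence is Lebesgue measure; the reflection accounts for [a < 0]. *)
Lemma ge0_integral_affine (a b : R) (f : R -> \bar R) : a != 0 ->
  measurable_fun [set: R] f -> (forall x, (0 <= f x)%E) ->
  (`|a|%:E * \int[leb]_x f (a * x + b)%R = \int[leb]_x f x)%E.
Proof.
wlog a0 : a b f / 0 < a.
  move=> h an0 mf f0; case: (ltrgt0P a) an0 => // a0 an0.
    by have := h a b f a0 (lt0r_neq0 a0) mf f0; rewrite gtr0_norm.
  have a0' : 0 < - a by rewrite oppr_gt0.
  rewrite -(h (- a) (b) f) ?lt0r_neq0// gtr0_norm//; congr (_ * _)%E.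
  have mg c : measurable_fun [set: R] (fun x => f (c * x + b)).
    by apply: measurableT_comp => //; exact: measurable_affine.
  have mopp : measurable_fun [set: measurableTypeR R] (-%R : _ -> measurableTypeR R).
    exact: oppr_measurable.
  pose opp_image : {measure set (measurableTypeR R) -> \bar R} :=
    measure_function_pushforward__canonical__measure_function_Measure leb mopp.
  transitivity (\int[opp_image]_x f (a * x + b)%R)%E.
    by apply: eq_measure_integral => A mA _; apply/esym; exact: lebesgue_measureN.
  rewrite ge0_integral_pushforward//=; last exact: mg.
  by apply: eq_integral => x _; rewrite /= mulrN mulNr.
move=> an0 mf f0; rewrite gtr0_norm//.
pose p : {posnum R} := PosNum a0.
transitivity (\int[mscale (p%:num%:nng)%R (affine_image a b)]_x f x)%E; last first.
  by apply: eq_measure_integral => A mA _; exact: (lebesgue_measure_affine p).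
by rewrite ge0_integral_mscale// ge0_integral_pushforward.
Qed.

Lemma integral_expRN_norm : (\int[leb]_x (expR (- `|x|))%:E = 2%:E)%E.
Proof.
rewrite (@ge0_symfun_integralT _ (fun x => expR (- `|x|))); last 3 first.
- by move=> x; exact: expR_ge0.
- move=> x; apply: continuous_comp; last exact: continuous_expR.
  by apply: continuousN; exact: norm_continuous.
- by move=> x /=; rewrite normrN.
rewrite -[RHS]mule1; congr (_ * _)%E.
rewrite -(integral_exponential_pdf (rate := 1) ltr01).
rewrite [RHS](_ : _ = \int[leb]_(x in [set x | (0 <= x)%R]) (exponential_pdf 1 x)%:E)%E.
  apply: eq_integral => x; rewrite inE/= => x0.
  by rewrite exponential_pdfE// mul1r mulN1r ger0_norm.
rewrite [RHS]integral_mkcond; apply: eq_integral => x _.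
rewrite patchE; case: ifPn => //; rewrite notin_setE/= => /negP.
by rewrite -ltNge => /lt0_exponential_pdf ->.
Qed.

End affine_substitution.

Section uniform_cube.
Context {R : realType}.
Local Notation leb := (@lebesgue_measure R).

Let ltN11 : -1 < 1 :> R. Proof. lra. Qed.

Definition unif : probability (measurableTypeR R) R := uniform_prob ltN11.

(** The density of [a x + b], for [x] uniform on [[-1, 1]], is at most
    [(2 |a|)^-1]. *)
Lemma integral_unif_affine_le (a b : R) (f : R -> \bar R) : a != 0 ->
  measurable_fun [set: R] f -> (forall x, (0 <= f x)%E) ->
  (\int[unif]_x f (a * x + b)%R <= (2 * `|a|)^-1%:E * \int[leb]_x f x)%E.
Proof.
move=> a0 mf f0.
have mfa : measurable_fun [set: R] (fun x => f (a * x + b)%R).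
  by apply: measurableT_comp => //; apply: measurable_funD => //; exact: measurable_funM.
rewrite /unif integral_uniform//.
rewrite -(ge0_integral_affine b a0)// muleA -EFinM invfM -mulrA mulVf ?normr_eq0// mulr1.
rewrite (_ : 1 - -1 = 2 :> R); last by rewrite opprK.
rewrite lee_pmul2l//; apply: ge0_subset_integral => //.
Qed.

End uniform_cube.

(** * Linear images of the uniform distribution on the cube *)

Section schur.
Context {F : fieldType}.

Definition schur_complement n (W : 'M[F]_n.+1) : 'M[F]_n :=
  \matrix_(i, j) (W (lift ord0 i) (lift ord0 j)
    - W (lift ord0 i) ord0 / W ord0 ord0 * W ord0 (lift ord0 j)).

(** One step of Gaussian elimination. *)
Lemma det_schur n (W : 'M[F]_n.+1) : W ord0 ord0 != 0 ->
  \det W = W ord0 ord0 * \det (schur_complement W).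
Proof.
move=> W0.
pose L : 'M[F]_(1 + n) := block_mx 1%:M 0
  (\col_i (- (W (lift ord0 i) ord0 / W ord0 ord0))) 1%:M.
have dL : \det L = 1 by rewrite det_lblock !det1 mulr1.
pose M : 'M[F]_(1 + n) := W.
have -> : \det W = \det (L *m M) by rewrite det_mulmx dL mul1r.
have l0 : lshift n (ord0 : 'I_1) = ord0 by apply/val_inj.
have lS i : rshift 1 i = lift ord0 i by apply/val_inj.
have -> : L *m M = block_mx (ulsubmx M) (ursubmx M) 0 (schur_complement W).
  rewrite -[in LHS](submxK M) mulmx_block !mul1mx !mul0mx !addr0; congr block_mx.
    apply/matrixP => i j; rewrite !mxE big_ord1 !mxE !ord1 l0 lS.
    by rewrite mulNr divfK// addNr.
  apply/matrixP => i j; rewrite !mxE big_ord1 !mxE !ord1 l0 !lS.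
  by rewrite addrC mulNr.
rewrite det_ublock; congr (_ * _).
by rewrite [ulsubmx M]mx11_scalar det_scalar1 !mxE l0.
Qed.

End schur.

Section volume_of_linear_image.
Context {R : realType}.
Local Notation leb := (@lebesgue_measure R).
Local Notation cube := (power_measure (@unif R)).

Definition l1_kernel n (W : 'M[R]_n) (y : 'I_n -> R) (a : n.-tuple R) : R :=
  expR (- \sum_j `|\sum_i W j i * tnth a i - y j|).

Lemma measurable_l1_kernel n (W : 'M[R]_n) y :
  measurable_fun [set: n.-tuple (measurableTypeR R)] (l1_kernel W y).
Proof.
apply: measurableT_comp; first exact: measurable_expR.
apply: measurableT_comp; first exact: oppr_measurable.
apply: measurable_sum => j; apply: measurableT_comp => //.
apply: measurable_funB => //; apply: measurable_sum => i.
by apply: measurable_funM => //; exact: measurable_tnth.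
Qed.

Lemma l1_kernel_row_perm n (W : 'M[R]_n) y (s : 'S_n) a :
  l1_kernel (row_perm s W) (y \o s) a = l1_kernel W y a.
Proof.
congr (expR (- _)); rewrite [RHS](reindex_inj (@perm_inj _ s))/=.
by apply: eq_bigr => j _; under eq_bigr do rewrite mxE.
Qed.

Let kernel_shift n (W : 'M[R]_n.+1) (y : 'I_n.+1 -> R) (u : R) (j : 'I_n) : R :=
  y (lift ord0 j) - W (lift ord0 j) ord0 / W ord0 ord0 * (y ord0 + u).

(** Subtracting from the coordinate [j > 0] of [W a] a multiple of the coordinate
    [0], i.e. of [y 0 + u], eliminates the variable [x] from it: for given [u]
    what remains is a kernel in [n] variables, for the Schur complement. *)
Lemma l1_kernel_schur n (W : 'M[R]_n.+1) y x a : W ord0 ord0 != 0 ->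
  let u := W ord0 ord0 * x + (\sum_i W ord0 (lift ord0 i) * tnth a i - y ord0) in
  l1_kernel W y (tcons (x, a)) =
  expR (- `|u|) * l1_kernel (schur_complement W) (kernel_shift W y u) a.
Proof.
move=> W0 u; rewrite /l1_kernel -expRD -opprD; congr (expR (- _)).
rewrite big_ord_recl; congr (_ + _).
  rewrite big_ord_recl tnth_tcons0 /u -addrA; congr (`|_ + (_ - _)|).
  by apply: eq_bigr => i _; rewrite tnth_tconsS.
apply: eq_bigr => j _; congr `|_|.
rewrite big_ord_recl tnth_tcons0.
under eq_bigr do rewrite tnth_tconsS.
under [in RHS]eq_bigr do rewrite mxE mulrBl -(mulrA (_ / _)).
rewrite sumrB -mulr_sumr /kernel_shift /u.
by field.
Qed.

(** The density of [W a], for [a] uniform on the cube, is at most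
    [2 ^- n / |det W|], and the integral of [exp (- |.|)] over the line is [2].
    The linear change of variables is carried out one coordinate at a time,
    through Schur complements, so that only Tonelli's theorem and affine
    substitutions on the line are involved. *)
Lemma integral_l1_kernel_le n (W : 'M[R]_n) y : \det W != 0 ->
  (\int[cube n]_a (l1_kernel W y a)%:E <= (`|\det W|^-1)%:E)%E.
Proof.
elim: n W y => [|n IH] W y dW.
  rewrite integral_power_measure0; last first.
    by apply/measurable_EFinP; exact: measurable_l1_kernel.
  by rewrite lee_fin /l1_kernel big_ord0 oppr0 expR0 det_mx00 normr1 invr1.
wlog W0 : W y dW / W ord0 ord0 != 0.
  move=> h; have [j Wj0] : exists j, W j ord0 != 0.
    apply/existsP; apply: contra_neqT dW => /existsPn Wj.
    rewrite (expand_det_col _ ord0) big1// => j _.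
    by move: (Wj j); rewrite negbK => /eqP ->; rewrite mul0r.
  pose s := tperm ord0 j.
  have := h (row_perm s W) (y \o s).
  rewrite row_permE det_mulmx det_perm normrM normrX normrN1 expr1n mul1r.
  rewrite -row_permE mxE tpermL => /(_ _ Wj0).
  rewrite mulf_eq0 negb_or signr_eq0 dW => /(_ isT).
  by under eq_integral do rewrite l1_kernel_row_perm.
have mker : measurable_fun [set: n.+1.-tuple (measurableTypeR R)]
    (fun a => (l1_kernel W y a)%:E).
  by apply/measurable_EFinP; exact: measurable_l1_kernel.
rewrite ge0_integral_power_measureS//; last first.
  by move=> a; rewrite lee_fin expR_ge0.
rewrite (fubini_tonelli (fun z : measurableTypeR R * n.-tuple (measurableTypeR R) =>
  (l1_kernel W y (tcons z))%:E))/=; last 2 first.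
- apply/measurable_EFinP.
  by apply: (measurableT_comp (measurable_l1_kernel W y)); exact: measurable_tcons.
- by move=> z; rewrite lee_fin expR_ge0.
pose G (z : measurableTypeR R * n.-tuple (measurableTypeR R)) : \bar R :=
  (expR (- `|z.1|) *
   l1_kernel (schur_complement W) (kernel_shift W y z.1) z.2)%:E.
have G0 z : (0 <= G z)%E by rewrite lee_fin mulr_ge0 ?expR_ge0.
have mG : measurable_fun setT G.
  apply/measurable_EFinP; apply: measurable_funM.
    apply: measurableT_comp; first exact: measurable_expR.
    apply: measurableT_comp; first exact: oppr_measurable.
    exact: measurableT_comp.
  apply: measurableT_comp; first exact: measurable_expR.
  apply: measurableT_comp; first exact: oppr_measurable.
  apply: measurable_sum => j; apply: measurableT_comp => //.
  apply: measurable_funB.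
    apply: measurable_sum => i; apply: measurable_funM => //.
    by apply: (measurableT_comp (measurable_tnth i)).
  apply: measurable_funB => //; apply: measurable_funM => //.
  exact: measurable_funD.
have mexp : measurable_fun [set: measurableTypeR R] (fun u => expR (- `|u|)).
  apply: measurableT_comp; first exact: measurable_expR.
  apply: measurableT_comp; first exact: oppr_measurable.
  exact: normr_measurable.
have mGu a : measurable_fun [set: measurableTypeR R] (fun u => G (u, a)).
  exact: (measurableT_comp mG (measurable_pair2 a)).
have mGa u : measurable_fun [set: n.-tuple (measurableTypeR R)] (fun a => G (u, a)).
  exact: (measurableT_comp mG (measurable_pair1 u)).
have mkz : measurable_fun [set: measurableTypeR R * n.-tuple (measurableTypeR R)]
    (fun z => (l1_kernel W y (tcons z))%:E).
  apply/measurable_EFinP.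
  by apply: (measurableT_comp (measurable_l1_kernel W y)); exact: measurable_tcons.
have k0 z : (0 <= (l1_kernel W y (tcons z))%:E)%E by rewrite lee_fin expR_ge0.
pose b : R := (2 * `|W ord0 ord0|)^-1.
have b0 : 0 <= b by rewrite invr_ge0 mulr_ge0.
have mF := measurable_fun_fubini_tonelli_G (m1 := @lebesgue_measure R) _ mG G0.
have mK := measurable_fun_fubini_tonelli_G (m1 := @unif R) _ mkz k0.
apply: (@le_trans _ _ (\int[cube n]_a (b%:E * \int[leb]_u G (u, a)))%E).
  apply: ge0_le_integral; [by []| |exact: mK| |].
  - by move=> a _; apply: integral_ge0 => x _; exact: k0.
  - exact: measurable_funeM.
  - move=> a _.
    under eq_integral do rewrite l1_kernel_schur//.
    exact: (integral_unif_affine_le _ W0 (mGu a) (fun u => G0 (u, a))).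
rewrite ge0_integralZl//=; last by move=> a _; exact: integral_ge0.
rewrite -(fubini_tonelli G)//=.
apply: (@le_trans _ _ (b%:E *
   \int[leb]_u ((expR (- `|u|))%:E * (`|\det (schur_complement W)|^-1)%:E))%E).
  apply: lee_wpmul2l; first by rewrite lee_fin.
  have dS : \det (schur_complement W) != 0.
    by apply: contra_neq dW => dS; rewrite det_schur// dS mulr0.
  have mS u : measurable_fun [set: n.-tuple (measurableTypeR R)]
      (fun a => (l1_kernel (schur_complement W) (kernel_shift W y u) a)%:E).
    by apply/measurable_EFinP; exact: measurable_l1_kernel.
  apply: ge0_le_integral; [by []| | | |].
  - by move=> u _; apply: integral_ge0.
  - exact: (measurable_fun_fubini_tonelli_F (m2 := cube n) _ mG G0).
  - apply/measurable_EFinP; apply: measurable_funM => //; exact: mexp.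
  - move=> u _; rewrite /G/=; under eq_integral do rewrite EFinM.
    rewrite ge0_integralZl//; last by move=> *; rewrite lee_fin expR_ge0.
    by apply: lee_wpmul2l; [rewrite lee_fin expR_ge0|exact: IH].
rewrite ge0_integralZr//=; last by apply/measurable_EFinP; exact: mexp.
rewrite integral_expRN_norm -!EFinM lee_fin.
have dS : \det (schur_complement W) != 0.
  by apply: contra_neq dW => dS; rewrite det_schur// dS mulr0.
rewrite det_schur// normrM /b le_eqVlt; apply/orP; left; apply/eqP.
by field; rewrite !normr_eq0 W0 dS.
Qed.

End volume_of_linear_image.

(** * Determinantal sampling *)

Section integration_tools.
Context {d : measure_display} {T : measurableType d} {R : realType}.
Variable mu : {measure set T -> \bar R}.

Lemma integrable_bounded_mul (f g : T -> R) (C : R) :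
  measurable_fun setT f -> (forall x, `|f x| <= C) ->
  mu.-integrable setT (EFin \o g) ->
  mu.-integrable setT (EFin \o (f \* g)).
Proof.
move=> mf fC ig; apply: (le_integrable measurableT _ _ (integrableZl measurableT C ig)).
  apply/measurable_EFinP; apply: measurable_funM => //.
  exact/measurable_EFinP/(measurable_int _ ig).
move=> x _ /=; rewrite lee_fin !normrM ler_wpM2r//.
exact: le_trans (fC x) (ler_norm C).
Qed.

(** Jensen's inequality for the probability density [w]: integrate against [w]
    the tangent line [expR (- Z) >= expR (- m) * (1 + m - Z)]. *)
Lemma expR_le_integral (w Z : T -> R) (m : R) :
  (forall x, 0 <= w x) -> (forall x, 0 <= Z x) -> measurable_fun setT Z ->
  mu.-integrable setT (EFin \o w) -> mu.-integrable setT (EFin \o (w \* Z)) ->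
  (\int[mu]_x (w x)%:E = 1)%E -> (\int[mu]_x (w x * Z x)%:E <= m%:E)%E ->
  ((expR (- m))%:E <= \int[mu]_x (w x * expR (- Z x))%:E)%E.
Proof.
move=> w0 Z0 mZ iw iwZ w1 wZm.
have iL : mu.-integrable setT (fun x => ((expR (- m))%:E *
    ((1 + m)%:E * (w x)%:E - (w x * Z x)%:E))%E).
  by apply: integrableZl => //; apply: integrableB => //; exact: integrableZl.
have ie : mu.-integrable setT (EFin \o ((fun x => expR (- Z x)) \* w)).
  apply: (@integrable_bounded_mul _ _ 1) => //.
    apply: measurableT_comp; first exact: measurable_expR.
    exact: measurableT_comp.
  by move=> x; rewrite ger0_norm ?expR_ge0// -expR0 ler_expR oppr_le0.
apply: (@le_trans _ _ (\int[mu]_x ((expR (- m))%:E *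
    ((1 + m)%:E * (w x)%:E - (w x * Z x)%:E)))%E).
  rewrite integralZl//; last first.
    by apply: integrableB => //; exact: integrableZl.
  rewrite integralB//; last exact: integrableZl.
  rewrite integralZl// w1 mule1.
  rewrite -[leLHS]mule1; apply: lee_wpmul2l; first by rewrite lee_fin expR_ge0.
  rewrite leeBrDr; last first.
    by apply/integrable_fin_num.
  by rewrite EFinD leeD2l.
apply: le_integral => //.
  by apply: eq_integrable ie => // x _ /=; rewrite mulrC.
move=> x _ /=; rewrite lee_fin.
rewrite (_ : _ - _ = w x * (1 + (m - Z x))); last by ring.
rewrite mulrCA ler_wpM2l//.
rewrite [in leRHS](_ : - Z x = - m + (m - Z x)); last by ring.
by rewrite expRD ler_wpM2l ?expR_ge0 ?expR_ge1Dx.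
Qed.

End integration_tools.

Section determinantal_sampling.
Context {d : measure_display} {T : measurableType d} {R : realType}.
Variable mu : probability T R.
Variables (n : nat) (phi : 'I_n.+1 -> T -> R) (K : R).
Hypothesis mphi : forall i, measurable_fun setT (phi i).
Hypothesis phiK : forall i x, `|phi i x| <= K.
Hypothesis phi_on : forall i j, \int[mu]_x (phi i x * phi j x) = (i == j)%:R.
Local Notation pow := (power_measure mu n.+1).

Definition sample_matrix (t : n.+1.-tuple T) : 'M[R]_n.+1 :=
  \matrix_(j, i) phi i (tnth t j).

Let expansion (h : T -> R) j0 (s s' : {perm 'I_n.+1}) j x : R :=
  phi (s j) x * phi (s' j) x * (if j == j0 then h x else 1).

(** Both determinants are expanded over permutations, so that each term is a
    product of functions of the independent points. *)
Let det2_expansion (h : T -> R) j0 t :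
  \det (sample_matrix t) ^+ 2 * h (tnth t j0) =
  \sum_(s : {perm 'I_n.+1}) \sum_(s' : {perm 'I_n.+1}) (-1) ^+ s * (-1) ^+ s' *
    \prod_j expansion h j0 s s' j (tnth t j).
Proof.
rewrite expr2 {1}/determinant mulr_suml mulr_suml; apply: eq_bigr => s _.
rewrite /determinant mulr_sumr mulr_suml; apply: eq_bigr => s' _.
rewrite /expansion !big_split/= mulrACA -!mulrA; congr (_ * (_ * _)).
under eq_bigr do rewrite mxE.
under [in X in _ * X]eq_bigr do rewrite mxE.
congr (_ * (_ * _)).
rewrite (bigD1 j0)//= eqxx big1 ?mulr1// => j /negbTE ->//.
Qed.

Let integrable_phi2 (h : T -> R) i i' : mu.-integrable setT (EFin \o h) ->
  mu.-integrable setT (EFin \o (fun x => phi i x * phi i' x * h x)).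
Proof.
move=> ih; apply: (@integrable_bounded_mul _ _ _ mu (phi i \* phi i') h (K * K)) => //.
  exact: measurable_funM.
by move=> x; rewrite normrM ler_pM.
Qed.

Let integrable_cst1 : mu.-integrable setT (EFin \o (fun=> 1 : R)).
Proof. exact: finite_measure_integrable_cst. Qed.

Let integrable_expansion h j0 s s' j : mu.-integrable setT (EFin \o h) ->
  mu.-integrable setT (EFin \o expansion h j0 s s' j).
Proof.
move=> ih; rewrite /expansion; case: (j == j0); exact: integrable_phi2.
Qed.

Let det2_expansionE (h : T -> R) j0 :
  EFin \o (fun t => \det (sample_matrix t) ^+ 2 * h (tnth t j0)) =
  (fun t => \sum_(s : {perm 'I_n.+1}) \sum_(s' : {perm 'I_n.+1})
    ((-1) ^+ s * (-1) ^+ s')%:E *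
    (\prod_j expansion h j0 s s' j (tnth t j))%:E)%E.
Proof.
apply/funext => t /=; rewrite det2_expansion -sumEFin.
by apply: eq_bigr => s _; rewrite -sumEFin.
Qed.

Lemma integrable_det2 (h : T -> R) j0 : mu.-integrable setT (EFin \o h) ->
  pow.-integrable setT
    (EFin \o (fun t => \det (sample_matrix t) ^+ 2 * h (tnth t j0))).
Proof.
move=> ih; rewrite det2_expansionE.
apply: integrable_sum => // s _; apply: integrable_sum => // s' _.
apply: integrableZl => //; apply: integrable_prod_tnth => j.
exact: integrable_expansion.
Qed.

(** Orthonormality kills every pair of distinct permutations: as two
    permutations that agree away from [j0] are equal, two distinct ones differ at
    some [j != j0], whose factor has the integral [0]. *)
Lemma integral_det2 (h : T -> R) j0 : mu.-integrable setT (EFin \o h) ->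
  (\int[pow]_t (\det (sample_matrix t) ^+ 2 * h (tnth t j0))%:E)%E =
  (\sum_(s : {perm 'I_n.+1}) \int[mu]_x (phi (s j0) x ^+ 2 * h x))%:E.
Proof.
move=> ih.
have := det2_expansionE h j0; rewrite /comp => ->.
have ips s s' : pow.-integrable setT
   (fun t => (\prod_j expansion h j0 s s' j (tnth t j))%:E).
  by apply: integrable_prod_tnth => j; exact: integrable_expansion.
rewrite integral_sum//=; last first.
  by move=> s; apply: integrable_sum => // s' _; exact: integrableZl.
rewrite -sumEFin; apply: eq_bigr => s _.
rewrite integral_sum//=; last by move=> s'; exact: integrableZl.
rewrite (bigD1 s)//= big1 ?adde0; last first.
  move=> s' ss'; rewrite integralZl//= integral_prod_tnth; last first.
    by move=> j; exact: integrable_expansion.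
  have [j jj0 sj] : exists2 j, j != j0 & s j != s' j.
    apply/exists_inP; apply: contraNT ss' => /exists_inPn agree.
    have agr j : j != j0 -> s j = s' j.
      by move=> jj0; apply/eqP; rewrite -[_ == _]negbK; exact: agree.
    apply/eqP/permP => j; have [->|/agr//] := eqVneq j j0.
    have [i si] : exists i, s i = s' j0.
      by exists (s^-1%g (s' j0)); rewrite permKV.
    have [ij0|ij0] := eqVneq i j0; first by rewrite -si ij0.
    by move: (agr _ ij0); rewrite si => /perm_inj /esym/eqP; rewrite (negbTE ij0).
  rewrite (bigD1 j)//= /expansion (negbTE jj0).
  under eq_Rintegral do rewrite mulr1.
  by rewrite phi_on (negbTE sj) mul0r mule0.
rewrite -signr_addb addbb expr0; under eq_integral do rewrite mul1e.
rewrite integral_prod_tnth; last by move=> j; exact: integrable_expansion.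
rewrite (bigD1 j0)//= big1 ?mulr1.
  congr (_%:E); apply: eq_Rintegral => x _.
  by rewrite /expansion eqxx expr2.
move=> j jj0; rewrite /expansion (negbTE jj0).
by under eq_Rintegral do rewrite mulr1; rewrite phi_on eqxx.
Qed.

End determinantal_sampling.

(** * The volume of a ball of L^1 *)

Section l1_ball_volume.
Context {d : measure_display} {T : measurableType d} {R : realType}.
Variable mu : probability T R.
Variables (n : nat) (phi : 'I_n.+1 -> T -> R) (K : R).
Hypothesis mphi : forall i, measurable_fun setT (phi i).
Hypothesis phiK : forall i x, `|phi i x| <= K.
Hypothesis phi_on : forall i j, \int[mu]_x (phi i x * phi j x) = (i == j)%:R.
Local Notation pow := (power_measure mu n.+1).
Local Notation cube := (power_measure (@unif R) n.+1).
Local Notation N := ((n.+1)`!%:R : R).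

Let N0 : 0 < N. Proof. by rewrite ltr0n fact_gt0. Qed.

Let K0 : 0 <= K.
Proof. exact: le_trans (normr_ge0 _) (phiK ord0 point). Qed.

Let icst1 : mu.-integrable setT (EFin \o (fun=> 1 : R)).
Proof. exact: finite_measure_integrable_cst. Qed.

Let icst_pow : pow.-integrable setT (fun=> 1%E).
Proof.
exact: (finite_measure_integrable_cst pow 1 measurableT).
Qed.

(** The density of the random points; [integral_det2] makes it a probability
    density, each point of which has the density [n.+1^-1 \sum_i phi_i^2]. *)
Let weight (t : n.+1.-tuple T) : R := N^-1 * \det (sample_matrix phi t) ^+ 2.

Let weight_ge0 t : 0 <= weight t.
Proof. by rewrite mulr_ge0 ?invr_ge0 ?ler0n// sqr_ge0. Qed.

Let integrable_weight : pow.-integrable setT (EFin \o weight).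
Proof.
have := @integrable_det2 _ _ _ mu _ _ _ mphi phiK (fun=> 1) ord0.
move=> /(_ icst1) /(integrableZl measurableT N^-1).
by apply: eq_integrable => // t _; rewrite /weight /= mulr1 -EFinM.
Qed.

Let integral_weight : (\int[pow]_t (weight t)%:E = 1)%E.
Proof.
have := @integral_det2 _ _ _ mu _ _ _ mphi phiK phi_on (fun=> 1) ord0.
move=> /(_ icst1).
under eq_integral do rewrite mulr1.
rewrite (eq_bigr (fun=> 1)); last first.
  move=> s _; under eq_Rintegral do rewrite mulr1 expr2.
  by rewrite phi_on eqxx.
rewrite sumr_const card_Sn => E.
under eq_integral do rewrite /weight EFinM.
rewrite integralZl//; last first.
  have := @integrable_det2 _ _ _ mu _ _ _ mphi phiK (fun=> 1) ord0.
  move=> /(_ icst1).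
  by apply: eq_integrable => // t _ /=; rewrite mulr1.
by rewrite E -EFinM mulVf// gt_eqF.
Qed.

Section sample_mean.
Variable g : T -> R.
Hypothesis g0 : forall x, 0 <= g x.
Hypothesis ig : mu.-integrable setT (EFin \o g).

Let integrable_weight_tnth j :
  pow.-integrable setT (EFin \o (fun t => weight t * g (tnth t j))).
Proof.
have := @integrable_det2 _ _ _ mu _ _ _ mphi phiK g j ig.
move=> /(integrableZl measurableT N^-1).
by apply: eq_integrable => // t _; rewrite /weight /= -EFinM mulrA.
Qed.

Let integral_weight_tnth j :
  (\int[pow]_t (weight t * g (tnth t j))%:E <= (K ^+ 2 * \int[mu]_x g x)%:E)%E.
Proof.
under eq_integral do rewrite /weight -mulrA EFinM.
have ii := @integrable_det2 _ _ _ mu _ _ _ mphi phiK g j ig.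
rewrite integralZl// (@integral_det2 _ _ _ mu _ _ _ mphi phiK phi_on g j ig).
rewrite -EFinM lee_fin ler_pdivrMl//.
rewrite -card_Sn -sumr_const mulr_suml; apply: ler_sum => s _.
rewrite mul1r -RintegralZl//; apply: le_Rintegral => //.
- apply: (@integrable_bounded_mul _ _ _ mu (fun x => phi (s j) x ^+ 2) g (K ^+ 2)) => //.
    exact: measurable_funX.
  by move=> x; rewrite normrX lerXn2r// nnegrE.
- exact: (integrableZl measurableT (K ^+ 2) ig).
- move=> x _; apply: ler_wpM2r => //.
  by rewrite -[_ ^+ 2]ger0_norm ?sqr_ge0// normrX lerXn2r// nnegrE.
Qed.

Lemma integrable_weight_sum c : pow.-integrable setT
  (EFin \o (fun t => weight t * (c * \sum_j g (tnth t j)))).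
Proof.
have -> : EFin \o (fun t => weight t * (c * \sum_j g (tnth t j))) =
    (fun t => c%:E * \sum_j (weight t * g (tnth t j))%:E)%E.
  apply/funext => t /=; rewrite sumEFin -EFinM; congr _%:E.
  by rewrite mulrCA mulr_sumr.
apply: integrableZl => //; apply: integrable_sum => // j _. exact: integrable_weight_tnth.
Qed.

Lemma integral_weight_sum c : 0 <= c ->
  (\int[pow]_t (weight t * (c * \sum_j g (tnth t j)))%:E <=
   (c * n.+1%:R * K ^+ 2 * \int[mu]_x g x)%:E)%E.
Proof.
move=> c0.
have E t : ((weight t * (c * \sum_j g (tnth t j)))%:E =
    c%:E * \sum_j (weight t * g (tnth t j))%:E)%E.
  by rewrite sumEFin -EFinM mulrCA mulr_sumr.
under eq_integral do rewrite E.
rewrite integralZl//; last first.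
  by apply: integrable_sum => // j _; exact: integrable_weight_tnth.
rewrite (_ : _ * \int[mu]_x g x =
    c * \sum_(j < n.+1) (K ^+ 2 * \int[mu]_x g x)); last first.
  by rewrite sumr_const card_ord -mulr_natl; ring.
rewrite EFinM; apply: lee_wpmul2l; first by rewrite lee_fin.
rewrite integral_sum//.
by rewrite -sumEFin; apply: lee_sum => j _; exact: integral_weight_tnth.
Qed.

End sample_mean.

Let measurable_det : measurable_fun setT (fun t => \det (sample_matrix phi t)).
Proof.
apply: measurable_sum => s; apply: measurable_funM => //.
rewrite (_ : (fun _ => _) = fun t => \prod_j phi (s j) (tnth t j)).
  by apply: (measurable_prod_tnth (h := fun j => phi (s j))) => j; exact: mphi.
by apply/funext => t; apply: eq_bigr => j _; rewrite mxE.
Qed.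

Let measurable_weight : measurable_fun setT weight.
Proof. by apply: measurable_funM => //; exact: measurable_funX. Qed.

(** The Cauchy-Schwarz inequality, as the square of the determinant has the
    integral [n.+1`!]. *)
Let integral_abs_det : (\int[pow]_t (N^-1 * `|\det (sample_matrix phi t)|)%:E
   <= ((Num.sqrt N)^-1)%:E)%E.
Proof.
have s0 : 0 < Num.sqrt N by rewrite sqrtr_gt0.
have sE : N = Num.sqrt N ^+ 2 by rewrite sqr_sqrtr// ltW.
pose q : R := (2 * Num.sqrt N)^-1.
have q0 : 0 <= q by rewrite invr_ge0 mulr_ge0// ltW.
apply: (@le_trans _ _ (\int[pow]_t (q%:E * ((weight t)%:E + 1)))%E).
  apply: ge0_le_integral => //.
  - apply/measurable_EFinP; apply: measurable_funM => //.
    exact: measurableT_comp.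
  - apply: measurable_funeM; apply: emeasurable_funD => //.
    exact/measurable_EFinP.
  - move=> t _; rewrite -EFinD -EFinM lee_fin /weight /q {1 3}sE.
    set D := \det _; set r := Num.sqrt N.
    rewrite -subr_ge0 [leRHS](_ : _ = (2 * r)^-1 * (`|D| / r - 1) ^+ 2).
      by rewrite mulr_ge0// sqr_ge0.
    by rewrite -(real_normK (num_real D)); field; rewrite gt_eqF.
rewrite integralZl//; last exact: integrableD.
rewrite integralD//.
rewrite integral_weight integral_cst// mul1e.
rewrite [X in (_ * (_ + X))%E](_ : _ = 1%E); last exact: probability_setT.
rewrite -EFinD -EFinM lee_fin.
rewrite le_eqVlt; apply/orP; left; apply/eqP; rewrite /q.
by field; rewrite gt_eqF.
Qed.

Lemma integrable_lincomb (b : 'I_n.+1 -> R) :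
  mu.-integrable setT (EFin \o (fun x => \sum_i b i * phi i x)).
Proof.
have -> : EFin \o (fun x => \sum_i b i * phi i x) =
    (fun x => \sum_i (b i)%:E * (phi i x * 1)%:E)%E.
  by apply/funext => x; rewrite /= -sumEFin; apply: eq_bigr => i _; rewrite mulr1.
apply: integrable_sum => // i _; apply: integrableZl => //.
exact: (@integrable_bounded_mul _ _ _ mu (phi i) (fun=> 1) K).
Qed.

(** By Jensen's inequality [expR (- s ||g||_1)] is at most the average, over
    the random points [t], of [expR (- kap \sum_j |g (t_j)|)]. For fixed points
    the latter is an [l1_kernel] in [a], of determinant proportional to
    [\prod_i lam i * \det (sample_matrix phi t)]. *)
Lemma integral_expR_l1_le (lam : 'I_n.+1 -> R) (c : T -> R) (s : R) :
  (forall i, lam i != 0) -> mu.-integrable setT (EFin \o c) -> 0 < s -> 0 < K ->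
  (\int[cube]_a (expR (- (s * \int[mu]_x
      `|\sum_i lam i * tnth a i * phi i x - c x|)))%:E <=
   ((n.+1%:R * K ^+ 2 / s) ^+ n.+1 / (\prod_i `|lam i| * Num.sqrt N))%:E)%E.
Proof.
move=> lam0 ic s0 Kp.
have mc : measurable_fun setT c by exact/measurable_EFinP/(measurable_int _ ic).
pose kap := s / (n.+1%:R * K ^+ 2).
have kap0 : 0 < kap by rewrite divr_gt0// mulr_gt0// exprn_gt0.
pose W t : 'M[R]_n.+1 := \matrix_(j, i) (kap * lam i * phi i (tnth t j)).
have detW t : \det (W t) =
    kap ^+ n.+1 * \prod_i lam i * \det (sample_matrix phi t).
  have -> : W t = kap *: (sample_matrix phi t *m diag_mx (\row_i lam i)).
    apply/matrixP => j i; rewrite mul_mx_diag !mxE.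
    by rewrite -mulrA (mulrC (lam i)).
  rewrite detZ det_mulmx det_diag mulrAC -mulrA; congr (_ * (_ * _)).
  by apply: eq_bigr => i _; rewrite mxE.
pose g (a : n.+1.-tuple R) x := `|\sum_i lam i * tnth a i * phi i x - c x|.
have ig a : mu.-integrable setT (EFin \o g a).
  apply: integrable_norm.
  exact: (integrableB measurableT (integrable_lincomb (fun i => lam i * tnth a i)) ic).
have mga a : measurable_fun setT (g a).
  exact/measurable_EFinP/(measurable_int _ (ig a)).
pose Q (z : n.+1.-tuple (measurableTypeR R) * n.+1.-tuple T) : \bar R :=
  (weight z.2 * expR (- \sum_j kap * g z.1 (tnth z.2 j)))%:E.
have QE a t : Q (a, t) =
    (weight t * l1_kernel (W t) (fun j => kap * c (tnth t j)) a)%:E.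
  congr (_ * expR (- _))%:E; apply: eq_bigr => j _ /=.
  rewrite -[kap in LHS]gtr0_norm// -normrM; congr `|_|.
  rewrite mulrBr mulr_sumr; congr (_ - _); apply: eq_bigr => i _.
  by rewrite mxE; ring.
have Q0 z : (0 <= Q z)%E by rewrite lee_fin mulr_ge0 ?expR_ge0.
have mg : measurable_fun
    [set: n.+1.-tuple (measurableTypeR R) * T] (fun z => g z.1 z.2).
  apply: measurableT_comp => //; apply: measurable_funB; last first.
    by apply: (measurableT_comp mc).
  apply: measurable_sum => i; apply: measurable_funM.
    apply: measurable_funM => //.
    by apply: (measurableT_comp (measurable_tnth i)).
  exact: (measurableT_comp (mphi i)).
have mQ : measurable_fun setT Q.
  apply/measurable_EFinP; apply: measurable_funM.
    exact: (measurableT_comp measurable_weight).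
  apply: measurableT_comp; first exact: measurable_expR.
  apply: measurableT_comp; first exact: oppr_measurable.
  apply: measurable_sum => j; apply: measurable_funM => //.
  apply: (measurableT_comp mg (g := fun z => (z.1, tnth z.2 j))).
  apply: measurable_fun_pair => //.
  exact: (measurableT_comp (measurable_tnth j) measurable_snd).
have mI : measurable_fun [set: n.+1.-tuple (measurableTypeR R)]
    (fun a => (\int[mu]_x (g a x)%:E)%E).
  apply: (measurable_fun_fubini_tonelli_F (m2 := mu)
    (fun z : n.+1.-tuple (measurableTypeR R) * T => (g z.1 z.2)%:E)).
    by apply/measurable_EFinP; exact: mg.
  by move=> z; rewrite lee_fin normr_ge0.
apply: (@le_trans _ _ (\int[cube]_a \int[pow]_t Q (a, t))%E).
  apply: ge0_le_integral => //.
  - apply/measurable_EFinP.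
    apply: measurableT_comp; first exact: measurable_expR.
    apply: measurableT_comp; first exact: oppr_measurable.
    apply: measurable_funM => //; rewrite /Rintegral.
    exact: (measurableT_comp (fine_measurable measurableT) mI).
  - exact: (measurable_fun_fubini_tonelli_F (m2 := pow) Q mQ Q0).
  - move=> a _.
    apply: le_trans (expR_le_integral (mu := pow) (w := weight)
      (Z := fun t => kap * \sum_j g a (tnth t j)) (m := s * \int[mu]_x g a x)
      _ _ _ _ _ _ _) _ => //.
    + by move=> t; apply: mulr_ge0; [exact: ltW|apply: sumr_ge0 => j _; exact: normr_ge0].
    + apply: measurable_funM => //; apply: measurable_sum => j.
      by apply: (measurableT_comp (mga a)); exact: measurable_tnth.
    + exact: (integrable_weight_sum (g := g a)).
    + apply: le_trans (integral_weight_sum (g := g a) _ (ig a) (ltW kap0)) _.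
        by move=> x; exact: normr_ge0.
      rewrite lee_fin le_eqVlt; apply/orP; left; apply/eqP; rewrite /kap.
      by field; rewrite ?gt_eqF// addr_gt0.
    + rewrite le_eqVlt; apply/orP; left; apply/eqP; apply: eq_integral => t _.
      by rewrite /Q /= mulr_sumr.
rewrite (fubini_tonelli Q)//.
apply: (@le_trans _ _ (\int[pow]_t ((kap ^+ n.+1 * \prod_i `|lam i|)^-1%:E *
   (N^-1 * `|\det (sample_matrix phi t)|)%:E))%E).
  apply: ge0_le_integral => //.
  - by move=> t _; apply: integral_ge0.
  - exact: (measurable_fun_fubini_tonelli_G (m1 := cube) Q mQ Q0).
  - apply: measurable_funeM; apply/measurable_EFinP; apply: measurable_funM => //.
    exact: measurableT_comp.
  - move=> t _; under eq_integral do rewrite QE EFinM.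
    rewrite ge0_integralZl//; last 3 first.
    + by apply/measurable_EFinP; exact: measurable_l1_kernel.
    + by move=> a _; rewrite lee_fin expR_ge0.
    + by rewrite lee_fin.
    have [D0|D0] := eqVneq (\det (sample_matrix phi t)) 0.
      by rewrite /weight D0 expr0n mulr0 mul0e normr0 mulr0 mule0.
    have W0 : \det (W t) != 0.
      rewrite detW; apply: mulf_neq0 => //; apply: mulf_neq0.
        by rewrite expf_neq0// gt_eqF.
      by apply/prodf_neq0 => i _; exact: lam0.
    apply: le_trans (lee_wpmul2l _ (integral_l1_kernel_le _ W0)) _.
      by rewrite lee_fin.
    rewrite -!EFinM lee_fin detW !normrM normrX (gtr0_norm kap0) normr_prod /weight.
    rewrite -(real_normK (num_real (\det _))) le_eqVlt; apply/orP; left; apply/eqP.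
    have p0 : \prod_i `|lam i| != 0.
      by apply/prodf_neq0 => i _; rewrite normr_eq0.
    have k0 : kap ^+ n.+1 != 0 by rewrite expf_neq0// gt_eqF.
    have D0' : `|\det (sample_matrix phi t)| != 0 by rewrite normr_eq0.
    by field; rewrite p0 k0 D0' gt_eqF.
rewrite ge0_integralZl//; last 2 first.
- apply/measurable_EFinP; apply: measurable_funM => //; exact: measurableT_comp.
- by rewrite lee_fin invr_ge0 mulr_ge0 ?prodr_ge0// exprn_ge0// ltW.
apply: le_trans (lee_wpmul2l _ integral_abs_det) _.
  by rewrite lee_fin invr_ge0 mulr_ge0 ?prodr_ge0// exprn_ge0// ltW.
rewrite -EFinM lee_fin -[_ / s]invf_div -/kap exprVn !invfM le_eqVlt.
by apply/orP; left; apply/eqP; rewrite mulrA.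
Qed.

End l1_ball_volume.

(** * Subgaussian sums and coverings *)

Section exponential_bounds.
Context {R : realType}.

(** For small [t], [expR (- t) <= 1 - t + t ^+ 2] and
    [expR t <= 1 + t + 2 * t ^+ 2], because [(1 - t + t ^+ 2) * (1 + t)] is
    [1 + t ^+ 3] and [(1 + t + 2 * t ^+ 2) * (1 - t)] is
    [1 + t ^+ 2 * (1 - 2 * t)]; for large [t], [t <= 2 * t ^+ 2]. *)
Lemma expR_add_expRN_le (t : R) : expR t + expR (- t) <= 2 * expR (2 * t ^+ 2).
Proof.
wlog t0 : t / 0 <= t.
  move=> h; have [/h//|/ltW t0] := leP 0 t.
  by have := h (- t); rewrite opprK sqrrN addrC oppr_ge0; exact.
have e1 := expR_ge1Dx (2 * t ^+ 2).
have eN : expR (- t) <= 1 - t + t ^+ 2.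
  rewrite expRN -[leLHS]mul1r ler_pdivrMr ?expR_gt0//.
  have y0 : 0 <= 1 - t + t ^+ 2 by nra.
  apply: le_trans (ler_wpM2l y0 (expR_ge1Dx t)).
  by rewrite [leRHS](_ : _ = 1 + t ^+ 3) ?lerDl ?exprn_ge0//; ring.
have [t2|t2] := leP t 2^-1; last first.
  have : expR t <= expR (2 * t ^+ 2) by rewrite ler_expR; nra.
  have : expR (- t) <= 1 by rewrite -expR0 ler_expR oppr_le0.
  have : 0 < expR (2 * t ^+ 2) by exact: expR_gt0.
  by have := sqr_ge0 t; lra.
have eP : expR t <= 1 + t + 2 * t ^+ 2.
  rewrite -[t in expR t]opprK expRN -[leLHS]mul1r ler_pdivrMr ?expR_gt0//.
  have y0 : 0 <= 1 + t + 2 * t ^+ 2 by nra.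
  apply: le_trans (ler_wpM2l y0 (expR_ge1Dx (- t))).
  rewrite [leRHS](_ : _ = 1 + t ^+ 2 * (1 - 2 * t)); last by ring.
  by rewrite lerDl mulr_ge0 ?sqr_ge0//; lra.
by have := sqr_ge0 t; lra.
Qed.

Lemma ln2_ge_half : 2^-1 <= ln 2 :> R.
Proof.
have e2 : expR 2^-1 <= 2 :> R.
  have := expR_ge1Dx (- 2^-1 : R); rewrite expRN => h.
  have e0 : 0 < expR 2^-1 :> R by exact: expR_gt0.
  have : 2^-1 * expR 2^-1 <= (expR 2^-1)^-1 * expR 2^-1 :> R.
    by rewrite ler_pM2r//; lra.
  by rewrite mulVf ?gt_eqF//; lra.
by rewrite -ler_expR lnK// posrE.
Qed.

(** By induction, since [(1 + n^-1)^n <= expR 1]. *)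
Lemma expn_le_fact (n : nat) : n%:R ^+ n <= n`!%:R * expR 1 ^+ n :> R.
Proof.
elim: n => [|n IH]; first by rewrite !expr0 mul1r.
have [->|n0] := posnP n; first by rewrite !expr1 mul1r -expR0 ler_expR.
rewrite factS natrM [n.+1%:R ^+ _]exprS -mulrA ler_wpM2l//.
have n0' : 0 < n%:R :> R by rewrite ltr0n.
have -> : n.+1%:R = n%:R * (1 + n%:R^-1) :> R.
  by rewrite mulrDr mulr1 mulfV ?gt_eqF// -natr1.
rewrite exprMn exprSr mulrA; apply: ler_pM => //.
apply: (@le_trans _ _ (expR n%:R^-1 ^+ n)).
  by rewrite lerXn2r ?nnegrE ?expR_ge0 ?expR_ge1Dx// addr_ge0// invr_ge0.
by rewrite -expRM_natl mulfV// gt_eqF.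
Qed.

Local Notation leb := (@lebesgue_measure R).

Lemma integral_unifN (f : R -> \bar R) :
  measurable_fun [set: R] f -> (forall x, (0 <= f x)%E) ->
  (\int[@unif R]_a f (- a)%R = \int[@unif R]_a f a)%E.
Proof.
move=> mf f0.
have mfN : measurable_fun [set: R] (fun a => f (- a)).
  by apply: measurableT_comp => //.
rewrite /unif !integral_uniform//; congr (_ * _)%E.
rewrite [LHS]integral_mkcond [RHS]integral_mkcond.
rewrite -[RHS](@ge0_integral_affine _ (-1) 0); last 3 first.
- by rewrite oppr_eq0 oner_neq0.
- by apply/(measurable_restrictT _ _).1 => //; exact: measurable_funS mf.
- by move=> x; rewrite patchE; case: ifP.
rewrite normrN1 mul1e; apply: eq_integral => x _.
rewrite !patchE mulN1r addr0.
suff -> : (- x \in `[-1, 1]%classic) = (x \in `[-1, 1]%classic) by [].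
by apply/idP/idP; rewrite !inE/= !in_itv/= => /andP[? ?]; apply/andP; split; lra.
Qed.

(** By symmetry [expR (u * a)] may be replaced by the mean of [expR (u * a)] and
    [expR (- u * a)]. *)
Lemma mgf_unif_le (u : R) :
  (\int[@unif R]_a (expR (u * a))%:E <= (expR (2 * u ^+ 2))%:E)%E.
Proof.
have mu_ v : measurable_fun [set: measurableTypeR R] (fun a => (expR (v * a))%:E).
  apply/measurable_EFinP; apply: measurableT_comp; first exact: measurable_expR.
  exact: measurable_funM.
set I := (\int[_]_a _)%E.
have IN : (\int[@unif R]_a (expR (- u * a))%:E = I)%E.
  rewrite -integral_unifN//; last exact: mu_.
  by apply: eq_integral => a _; rewrite mulrNN.
suff : (2%:E * I <= 2%:E * (expR (2 * u ^+ 2))%:E)%E by rewrite lee_pmul2l.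
have -> : (2%:E * I = \int[@unif R]_a (expR (u * a) + expR (- u * a))%:E)%E.
  under eq_integral do rewrite EFinD.
  rewrite ge0_integralD//; [|exact: mu_..].
  by rewrite IN mule_natl.
have mS : measurable_fun [set: measurableTypeR R]
    (fun a => (expR (u * a) + expR (- u * a))%:E).
  apply/measurable_EFinP; apply: measurable_funD; apply/measurable_EFinP; exact: mu_.
rewrite /unif integral_uniform//.
apply: (@le_trans _ _ ((1 - -1)^-1%R%:E *
   \int[leb]_(x in `[(-1)%R, 1%R]) (2 * expR (2 * u ^+ 2))%:E)%E).
  apply: lee_wpmul2l; first by rewrite lee_fin invr_ge0; lra.
  apply: ge0_le_integral => //.
  - exact: measurable_funTS.
  - move=> a; rewrite /= in_itv/= => /andP[a1 a2]; rewrite lee_fin mulNr.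
    apply: le_trans (expR_add_expRN_le _) _.
    rewrite ler_wpM2l// ler_expR ler_wpM2l// exprMn ler_piMr ?sqr_ge0//.
    nra.
rewrite integral_cst//= lebesgue_measure_itv/= lte_fin.
rewrite ifT; last by lra.
by rewrite -EFinD -!EFinM lee_fin le_eqVlt; apply/orP; left; apply/eqP; field.
Qed.

End exponential_bounds.

Section covering.
Context {d : measure_display} {T : measurableType d} {R : realType}.
Variable mu : probability T R.
Variables (n : nat) (phi : 'I_n.+1 -> T -> R) (K : R).
Hypothesis mphi : forall i, measurable_fun setT (phi i).
Hypothesis phiK : forall i x, `|phi i x| <= K.
Hypothesis phi_on : forall i j, \int[mu]_x (phi i x * phi j x) = (i == j)%:R.
Hypothesis Kp : 0 < K.
Local Notation cube := (power_measure (@unif R) n.+1).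
Local Notation N := (n.+1%:R : R).

Definition random_sum (a : n.+1.-tuple R) (x : T) : R :=
  (\sum_i tnth a i * phi i x) / Num.sqrt N.

Definition exp_moment (th : R) (a : n.+1.-tuple R) : R :=
  \int[mu]_x (expR (th * random_sum a x) + expR (- (th * random_sum a x))).

Let sN0 : 0 < Num.sqrt N. Proof. by rewrite sqrtr_gt0 ltr0n. Qed.

Lemma measurable_random_sum a : measurable_fun setT (random_sum a).
Proof.
apply: measurable_funM => //; apply: measurable_sum => i.
exact: measurable_funM.
Qed.

Let measurable_random_sum2 : measurable_fun
  [set: n.+1.-tuple (measurableTypeR R) * T] (fun z => random_sum z.1 z.2).
Proof.
apply: measurable_funM => //; apply: measurable_sum => i.
apply: measurable_funM; last exact: (measurableT_comp (mphi i)).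
exact: (measurableT_comp (measurable_tnth i)).
Qed.

Lemma random_sum_bounded a x :
  `|random_sum a x| <= (\sum_i `|tnth a i| * K) / Num.sqrt N.
Proof.
rewrite normrM [X in _ * X]gtr0_norm ?invr_gt0// ler_wpM2r ?invr_ge0 ?(ltW sN0)//.
apply: le_trans (ler_norm_sum _ _ _) _; apply: ler_sum => i _.
by rewrite normrM ler_wpM2l.
Qed.

Let integrable_exp_sum th a :
  mu.-integrable setT (EFin \o (fun x => expR (th * random_sum a x))).
Proof.
have mr := measurable_random_sum a.
have me : measurable_fun setT (fun x => expR (th * random_sum a x)).
  apply: measurableT_comp; first exact: measurable_expR.
  exact: measurable_funM.
pose C := expR (`|th| * ((\sum_i `|tnth a i| * K) / Num.sqrt N)).
have := @integrable_bounded_mul _ _ _ mu _ (fun=> 1) C me.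
have eC x : `|expR (th * random_sum a x)| <= C.
  rewrite ger0_norm ?expR_ge0// ler_expR; apply: le_trans (ler_norm _) _.
  by rewrite normrM ler_wpM2l// random_sum_bounded.
move=> /(_ eC (finite_measure_integrable_cst mu 1 measurableT)).
by apply: eq_integrable => // x _ /=; rewrite mulr1.
Qed.

Lemma integrable_exp_moment th a : mu.-integrable setT
  (EFin \o (fun x => expR (th * random_sum a x) + expR (- (th * random_sum a x)))).
Proof.
have := integrableD measurableT (integrable_exp_sum th a) (integrable_exp_sum (- th) a).
by apply: eq_integrable => // x _ /=; rewrite mulNr.
Qed.

(** The terms are independent, and the parameters [th * phi i x / sqrt n] of their
    moment generating functions have squares with a sum of at most
    [th ^+ 2 * K ^+ 2]. *)
Lemma mgf_random_sum_le th x :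
  (\int[cube]_a (expR (th * random_sum a x))%:E <= (expR (2 * th ^+ 2 * K ^+ 2))%:E)%E.
Proof.
pose u i := th * phi i x / Num.sqrt N.
have E (a : n.+1.-tuple R) :
    expR (th * random_sum a x) = \prod_i expR (u i * tnth a i).
  rewrite -expR_sum; congr expR; rewrite /random_sum mulrA mulr_sumr mulr_suml.
  by apply: eq_bigr => i _; rewrite /u; ring.
under eq_integral do rewrite E.
rewrite (ge0_integral_prod_tnth (@unif R) (h := fun i a => expR (u i * a))); last 2 first.
- move=> i; apply: measurableT_comp; first exact: measurable_expR.
  exact: measurable_funM.
- by move=> *; exact: expR_ge0.
apply: (@le_trans _ _ (\prod_(i < n.+1) expR (2 * u i ^+ 2))%:E).
  suff /andP[] : (0 <= \prod_(i < n.+1) \int[@unif R]_a (expR (u i * a))%:E <=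
      (\prod_(i < n.+1) expR (2 * u i ^+ 2))%:E)%E by [].
  apply: (big_ind2 (fun (x : \bar R) (y : R) => (0 <= x <= y%:E)%E)) => //.
  - by rewrite lee01 lexx.
  - move=> x1 y1 x2 y2 /andP[x10 xy1] /andP[x20 xy2].
    by rewrite mule_ge0// EFinM lee_pmul.
  - by move=> i _; rewrite mgf_unif_le integral_ge0// => a _; rewrite lee_fin expR_ge0.
rewrite lee_fin -expR_sum ler_expR.
apply: (@le_trans _ _ (\sum_(i < n.+1) 2 * th ^+ 2 * K ^+ 2 / N)).
  apply: ler_sum => i _; rewrite /u.
  rewrite [leRHS](_ : _ = 2 * th ^+ 2 / N * K ^+ 2); last by ring.
  rewrite [leLHS](_ : _ = 2 * th ^+ 2 / N * phi i x ^+ 2); last first.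
    by rewrite expr_div_n sqr_sqrtr// exprMn; ring.
  apply: ler_wpM2l; first by apply: divr_ge0 => //; apply: mulr_ge0 => //; exact: sqr_ge0.
  by rewrite -[_ ^+ 2]ger0_norm ?sqr_ge0// normrX lerXn2r ?nnegrE// ltW.
by rewrite sumr_const card_ord -[_ *+ n.+1]mulr_natr divfK// pnatr_eq0.
Qed.

Let exp_momentE th a : ((exp_moment th a)%:E = \int[mu]_x
  (expR (th * random_sum a x) + expR (- (th * random_sum a x)))%:E)%E.
Proof.
rewrite /exp_moment /Rintegral fineK//.
by apply: integrable_fin_num => //; exact: integrable_exp_moment.
Qed.

Lemma integral_exp_moment_le th :
  (\int[cube]_a (exp_moment th a)%:E <= (2 * expR (2 * th ^+ 2 * K ^+ 2))%:E)%E.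
Proof.
pose F (z : n.+1.-tuple (measurableTypeR R) * T) : \bar R :=
  (expR (th * random_sum z.1 z.2) + expR (- (th * random_sum z.1 z.2)))%:E.
have F0 z : (0 <= F z)%E by rewrite lee_fin addr_ge0 ?expR_ge0.
have mF : measurable_fun setT F.
  apply/measurable_EFinP; apply: measurable_funD.
    apply: measurableT_comp; first exact: measurable_expR.
    exact: measurable_funM.
  apply: measurableT_comp; first exact: measurable_expR.
  apply: measurableT_comp; first exact: oppr_measurable.
  exact: measurable_funM.
under eq_integral do rewrite exp_momentE.
rewrite (fubini_tonelli F)//.
rewrite -[leRHS]mule1 -(probability_setT mu) -integral_cst//.
apply: ge0_le_integral => //.
- by move=> x _; exact: integral_ge0.
- exact: (measurable_fun_fubini_tonelli_G (m1 := cube) F mF F0).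
- move=> x _; rewrite /F/=; under eq_integral do rewrite EFinD.
  have mx t : measurable_fun [set: n.+1.-tuple (measurableTypeR R)]
      (fun a => (expR (t * random_sum a x))%:E).
    apply/measurable_EFinP.
    apply: measurableT_comp; first exact: measurable_expR.
    apply: measurable_funM => //.
    exact: (measurableT_comp measurable_random_sum2 (measurable_pair2 x)).
  under eq_integral do rewrite -mulNr.
  rewrite ge0_integralD//; [|exact: mx..].
  rewrite mulr_natl mulr2n EFinD; apply: leeD; first exact: mgf_random_sum_le.
  by apply: le_trans (mgf_random_sum_le _ _) _; rewrite sqrrN.
Qed.

Lemma measurable_exp_moment th :
  measurable_fun [set: n.+1.-tuple (measurableTypeR R)] (exp_moment th).
Proof.
apply: (measurableT_comp (fine_measurable measurableT)).
apply: (measurable_fun_fubini_tonelli_F (m2 := mu)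
  (fun z : n.+1.-tuple (measurableTypeR R) * T =>
     (expR (th * random_sum z.1 z.2) + expR (- (th * random_sum z.1 z.2)))%:E)).
  apply/measurable_EFinP; apply: measurable_funD.
    apply: measurableT_comp; first exact: measurable_expR.
    exact: measurable_funM.
  apply: measurableT_comp; first exact: measurable_expR.
  apply: measurableT_comp; first exact: oppr_measurable.
  exact: measurable_funM.
by move=> z; rewrite lee_fin addr_ge0 ?expR_ge0.
Qed.

(** By Markov's inequality the exponential moment exceeds twice the bound on its
    mean on at most half of the cube. On the rest some distance to a centre is
    at most [eps], which makes [expR (N - (N / eps) * dist)] at least [1]; hence
    the integrals of these [m] functions, bounded by sampling, add up to at least
    one half. *)
Lemma prod_le_covering (lam : 'I_n.+1 -> R) (m : nat) (c : 'I_m -> T -> R)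
    (eps th : R) :
  (forall i, lam i != 0) -> (forall i, mu.-integrable setT (EFin \o c i)) ->
  0 < eps ->
  (forall a : n.+1.-tuple R,
     exp_moment th a <= 4 * expR (2 * th ^+ 2 * K ^+ 2) ->
     exists i, \int[mu]_x `|(\sum_j lam j * tnth a j * phi j x) / Num.sqrt N - c i x|
       <= eps) ->
  \prod_i `|lam i| <= 2 * m%:R * (expR 2 * K ^+ 2 * eps) ^+ n.+1.
Proof.
move=> lam0 ic eps0 cover.
pose lamN i := lam i / Num.sqrt N.
have lamN0 i : lamN i != 0 by rewrite mulf_neq0// invr_neq0// gt_eqF.
pose B := expR (2 * th ^+ 2 * K ^+ 2).
have B0 : 0 < B by exact: expR_gt0.
pose s := N / eps.
have s0 : 0 < s by rewrite divr_gt0.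
pose dist i (a : n.+1.-tuple R) :=
  \int[mu]_x `|\sum_j lamN j * tnth a j * phi j x - c i x|.
(* Markov's inequality and the covering, before integration over the cube. *)
have pointwise a : 1 <= exp_moment th a / (4 * B) +
    \sum_(i < m) expR N * expR (- (s * dist i a)).
  have S0 (J : pred 'I_m) : 0 <= \sum_(i | J i) expR N * expR (- (s * dist i a)).
    by apply: sumr_ge0 => i _; rewrite mulr_ge0 ?expR_ge0.
  have [le4|gt4] := leP (exp_moment th a) (4 * B); last first.
    rewrite -[leLHS]addr0 lerD// ler_pdivlMr ?mulr_gt0// mul1r.
    exact: ltW.
  have [i di] := cover a le4.
  rewrite -[leLHS]add0r lerD//.
    rewrite divr_ge0 ?mulr_ge0 ?(ltW B0)//.
    by apply: Rintegral_ge0 => x _; rewrite addr_ge0 ?expR_ge0.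
  rewrite (bigD1 i)//= -[leLHS]addr0 lerD// -expRD -[leLHS]expR0 ler_expR.
  rewrite subr_ge0 /s mulrAC ler_pdivrMr// ler_wpM2l//.
  apply: le_trans di; rewrite le_eqVlt; apply/orP; left; apply/eqP.
  apply: eq_Rintegral => x _; congr `|_ - _|; rewrite mulr_suml.
  by apply: eq_bigr => j _; rewrite /lamN; ring.
have mexpd i : measurable_fun [set: n.+1.-tuple (measurableTypeR R)]
    (fun a => expR (- (s * dist i a))).
  apply: measurableT_comp; first exact: measurable_expR.
  apply: measurableT_comp; first exact: oppr_measurable.
  apply: measurable_funM => //.
  apply: (measurableT_comp (fine_measurable measurableT)).
  apply: (measurable_fun_fubini_tonelli_F (m2 := mu)
    (fun z : n.+1.-tuple (measurableTypeR R) * T =>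
     `|\sum_j lamN j * tnth z.1 j * phi j z.2 - c i z.2|%:E)) => //.
  apply/measurable_EFinP; apply: measurableT_comp => //.
  have mci : measurable_fun setT (c i).
    exact/measurable_EFinP/(measurable_int _ (ic i)).
  apply: measurable_funB; last exact: (measurableT_comp mci).
  apply: measurable_sum => j; apply: measurable_funM.
    apply: measurable_funM => //.
    exact: (measurableT_comp (measurable_tnth j)).
  exact: (measurableT_comp (mphi j)).
have mdist i : measurable_fun [set: n.+1.-tuple (measurableTypeR R)]
    (fun a => expR N * expR (- (s * dist i a))).
  exact: measurable_funM.
have mexp := measurable_exp_moment th.
have exp_moment_ge0 a : 0 <= exp_moment th a.
  by apply: Rintegral_ge0 => x _; rewrite addr_ge0 ?expR_ge0.
pose V := (N * K ^+ 2 / s) ^+ n.+1 / (\prod_i `|lamN i| * Num.sqrt (n.+1)`!%:R).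
have volumes : 1 <= 2^-1 + m%:R * (expR N * V).
  rewrite -lee_fin.
  apply: (@le_trans _ _ (\int[cube]_a ((4 * B)^-1%:E * (exp_moment th a)%:E +
    \sum_(i < m) (expR N * expR (- (s * dist i a)))%:E))%E).
    have I1 : (\int[cube]_a (cst 1 a) = 1 :> \bar R)%E.
      by rewrite integral_cst// mul1e; exact: probability_setT.
    rewrite -[leLHS]I1; apply: ge0_le_integral => //.
    - apply: emeasurable_funD.
        by apply: measurable_funeM; apply/measurable_EFinP; exact: mexp.
      by apply: emeasurable_sum => i; apply/measurable_EFinP; exact: mdist.
    - move=> a _ /=; rewrite sumEFin -EFinM -EFinD lee_fin mulrC; exact: pointwise.
  rewrite ge0_integralD//; last 4 first.
  - move=> a _; rewrite -EFinM lee_fin mulr_ge0// invr_ge0 mulr_ge0// ltW//.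
  - by apply: measurable_funeM; apply/measurable_EFinP; exact: mexp.
  - by move=> a _; apply: sume_ge0 => i _; rewrite lee_fin mulr_ge0 ?expR_ge0.
  - by apply: emeasurable_sum => i; apply/measurable_EFinP; exact: mdist.
  rewrite EFinD; apply: leeD.
    rewrite ge0_integralZl//; last 3 first.
    - by apply/measurable_EFinP; exact: mexp.
    - by move=> a _; rewrite lee_fin.
    - by rewrite lee_fin invr_ge0 mulr_ge0// ltW.
    apply: le_trans (lee_wpmul2l _ (integral_exp_moment_le th)) _.
      by rewrite lee_fin invr_ge0 mulr_ge0// ltW.
    rewrite -EFinM lee_fin -/B le_eqVlt; apply/orP; left; apply/eqP.
    by field; rewrite gt_eqF.
  rewrite ge0_integral_sum//; last first.
    by move=> i; apply/measurable_EFinP; exact: mdist.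
  rewrite -[m in leRHS]card_ord -sumr_const mulr_suml -sumEFin.
  apply: lee_sum => i _; rewrite mul1r EFinM.
  under eq_integral do rewrite EFinM.
  rewrite ge0_integralZl//; last by apply/measurable_EFinP; exact: mexpd.
  apply: lee_wpmul2l; first by rewrite lee_fin expR_ge0.
  exact: (integral_expR_l1_le mphi phiK phi_on lamN0 (ic i) s0 Kp).
set L := \prod_i `|lam i|.
have L0 : 0 < L by apply: prodr_gt0 => i _; rewrite normr_gt0.
pose r := Num.sqrt N ^+ n.+1; pose q : R := Num.sqrt (n.+1)`!%:R.
have r0 : 0 < r by rewrite exprn_gt0.
have q0 : 0 < q by rewrite sqrtr_gt0 ltr0n fact_gt0.
have VE : V = (K ^+ 2 * eps) ^+ n.+1 * r / (L * q).
  have cancel (x : R) : x != 0 -> x * K ^+ 2 / (x / eps) = K ^+ 2 * eps.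
    by move=> x0; field; rewrite x0 gt_eqF.
  rewrite /V /s cancel ?pnatr_eq0//.
  have -> : \prod_i `|lamN i| = L / r.
    rewrite /lamN; under eq_bigr do rewrite normrM [X in _ * X]gtr0_norm ?invr_gt0//.
    by rewrite big_split/= prodr_const card_ord exprVn.
  by rewrite -/q; field; rewrite !gt_eqF.
(* The factor N ^ (N / 2) coming from the normalisation of the sums is
   compensated by the square root of the factorial, up to an exponential
   factor. *)
have rq : r <= q * expR 1 ^+ n.+1.
  have r2 : r ^+ 2 = N ^+ n.+1 by rewrite /r -exprM mulnC exprM sqr_sqrtr.
  have q2 : q ^+ 2 = (n.+1)`!%:R by rewrite sqr_sqrtr.
  have qe0 : 0 <= q * expR 1 ^+ n.+1.
    by rewrite mulr_ge0 ?exprn_ge0 ?expR_ge0// ltW.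
  rewrite -(@ler_pXn2r _ 2)// ?nnegrE ?(ltW r0)//.
  rewrite exprMn r2 q2; apply: le_trans (expn_le_fact n.+1) _.
  apply: ler_wpM2l => //; rewrite -exprM ler_weXn2l ?leq_pmulr//.
  by rewrite -[leLHS]expR0 ler_expR.
have half : 2^-1 <= m%:R * (expR N * V) by lra.
have eN : expR N = expR 1 ^+ n.+1 by rewrite -expRM_natl mulr1.
have e2 : expR 2 = expR 1 * expR 1 :> R by rewrite -expRD; congr expR; lra.
rewrite -(ler_pM2l (_ : 0 < 2^-1 :> R))// -(ler_pM2r q0).
apply: (@le_trans _ _ (m%:R * (expR N * V) * (L * q))).
  by rewrite -mulrA ler_wpM2r// mulr_ge0// ltW.
rewrite VE [leLHS](_ : _ = m%:R * expR N * (K ^+ 2 * eps) ^+ n.+1 * r); last first.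
  by field; rewrite !gt_eqF.
rewrite [leRHS](_ : _ = m%:R * expR N * (K ^+ 2 * eps) ^+ n.+1 *
    (q * expR 1 ^+ n.+1)); last first.
  by rewrite e2 eN !exprMn; field.
by rewrite ler_wpM2l// !mulr_ge0 ?expR_ge0// exprn_ge0// mulr_ge0 ?sqr_ge0// ltW.
Qed.

End covering.

(** * Bounded functions and orthogonal series *)

Section bounded_functions.
Context {d : measure_display} {T : measurableType d} {R : realType}.
Variable mu : probability T R.

Definition bounded_mfun (f : T -> R) : Prop :=
  measurable_fun setT f /\ exists C, forall x, `|f x| <= C.

Lemma bounded_mfun_cst c : bounded_mfun (fun=> c).
Proof. by split => //; exists `|c|. Qed.

Lemma bounded_mfunD f g : bounded_mfun f -> bounded_mfun g ->
  bounded_mfun (fun x => f x + g x).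
Proof.
move=> [mf [C fC]] [mg [C' gC]]; split; first exact: measurable_funD.
by exists (C + C') => x; rewrite (le_trans (ler_normD _ _))// lerD.
Qed.

Lemma bounded_mfunM f g : bounded_mfun f -> bounded_mfun g ->
  bounded_mfun (fun x => f x * g x).
Proof.
move=> [mf [C fC]] [mg [C' gC]]; split; first exact: measurable_funM.
by exists (C * C') => x; rewrite normrM ler_pM.
Qed.

Lemma bounded_mfunZ c f : bounded_mfun f -> bounded_mfun (fun x => c * f x).
Proof. by move=> bf; apply: bounded_mfunM => //; exact: bounded_mfun_cst. Qed.

Lemma bounded_mfunB f g : bounded_mfun f -> bounded_mfun g ->
  bounded_mfun (fun x => f x - g x).
Proof.
move=> bf bg; apply: bounded_mfunD => //.
have -> : (fun x => - g x) = (fun x => -1 * g x).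
  by apply/funext => x; rewrite mulN1r.
exact: bounded_mfunZ.
Qed.

Lemma bounded_mfun_sum (I : Type) (s : seq I) (f : I -> T -> R) :
  (forall i, bounded_mfun (f i)) -> bounded_mfun (fun x => \sum_(i <- s) f i x).
Proof.
move=> bf; elim: s => [|i s IH].
  by under eq_fun do rewrite big_nil; exact: bounded_mfun_cst.
by under eq_fun do rewrite big_cons; exact: bounded_mfunD.
Qed.

Lemma bounded_mfun_mul_integrable f g : bounded_mfun f ->
  mu.-integrable setT (EFin \o g) ->
  mu.-integrable setT (EFin \o (fun x => f x * g x)).
Proof. by move=> [mf [C fC]] ig; exact: (integrable_bounded_mul mf fC ig). Qed.

Lemma bounded_mfun_integrable f : bounded_mfun f ->
  mu.-integrable setT (EFin \o f).
Proof.
move=> bf; have := bounded_mfun_mul_integrable bf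
  (finite_measure_integrable_cst mu 1 measurableT).
by apply: eq_integrable => // x _ /=; rewrite mulr1.
Qed.

Lemma Rintegral_sum (I : Type) (s : seq I) (f : I -> T -> R) :
  (forall i, mu.-integrable setT (EFin \o f i)) ->
  \int[mu]_x (\sum_(i <- s) f i x) = \sum_(i <- s) \int[mu]_x f i x.
Proof.
move=> intf; elim: s => [|i s IH].
  under eq_Rintegral do rewrite big_nil.
  by rewrite big_nil Rintegral_cst// mul0r.
under eq_Rintegral do rewrite big_cons.
rewrite big_cons -IH RintegralD//; elim: s {IH} => [|j s IH].
  apply: eq_integrable (finite_measure_integrable_cst mu 0 measurableT) => //.
  by move=> x _ /=; rewrite big_nil.
apply: eq_integrable (integrableD measurableT (intf j) IH) => // x _ /=.
by rewrite big_cons.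
Qed.

(** The Cauchy-Schwarz inequality, in the form of the arithmetic-geometric mean
    inequality [2 * e * |f x| <= f x ^+ 2 + e ^+ 2]. *)
Lemma integral_norm_le_of_sqr (f : T -> R) (e : R) : measurable_fun setT f -> 0 < e ->
  (\int[mu]_x (f x ^+ 2)%:E <= (e ^+ 2)%:E)%E -> (\int[mu]_x `|f x|%:E <= e%:E)%E.
Proof.
move=> mf e0 fe.
have mf2 : measurable_fun setT (fun x => f x ^+ 2) by exact: measurable_funX.
apply: (@le_trans _ _ (\int[mu]_x ((2 * e)^-1%:E * (f x ^+ 2)%:E + (e / 2)%:E))%E).
  apply: ge0_le_integral => //.
  - by apply/measurable_EFinP; exact: measurableT_comp.
  - apply: emeasurable_funD => //; apply: measurable_funeM; exact/measurable_EFinP.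
  - move=> x _; rewrite -EFinM -EFinD lee_fin -subr_ge0.
    rewrite [leRHS](_ : _ = (2 * e)^-1 * (`|f x| - e) ^+ 2).
      by rewrite mulr_ge0 ?sqr_ge0// invr_ge0 mulr_ge0// ltW.
    by rewrite -(real_normK (num_real (f x))); field; rewrite gt_eqF.
have e20 : 0 <= (2 * e)^-1 by rewrite invr_ge0 mulr_ge0// ltW.
rewrite ge0_integralD//; last 3 first.
- by move=> x _; rewrite -EFinM lee_fin mulr_ge0// sqr_ge0.
- by apply: measurable_funeM; exact/measurable_EFinP.
- by move=> x _; rewrite lee_fin divr_ge0// ltW.
rewrite ge0_integralZl//; last 2 first.
- exact/measurable_EFinP.
- by move=> x _; rewrite lee_fin sqr_ge0.
rewrite integral_cst//= [X in (_ + _ * X)%E](_ : _ = 1%E); last exact: probability_setT.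
rewrite mule1.
apply: le_trans (leeD2r _ (lee_wpmul2l _ fe)) _; first by rewrite lee_fin.
rewrite -EFinM -EFinD lee_fin le_eqVlt; apply/orP; left; apply/eqP.
by field; rewrite gt_eqF.
Qed.

End bounded_functions.

Section riesz_fischer.
Context {d : measure_display} {T : measurableType d} {R : realType}.
Variable mu : probability T R.
Variables (e : nat -> T -> R) (alpha : nat -> R) (M : R).
Hypothesis be : forall j, bounded_mfun (e j).
Hypothesis oe : forall i j, \int[mu]_x (e i x * e j x) = if i == j then alpha i else 0.
Hypothesis alphaM : forall n, \sum_(j < n) alpha j <= M.

Let u (n : nat) x := \sum_(j < n) e j x.

Let bu n : bounded_mfun (u n).
Proof. exact: bounded_mfun_sum. Qed.

Let u_diff m n x : (m <= n)%N -> u n x - u m x = \sum_(m <= j < n) e j x.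
Proof.
move=> mn; rewrite /u -!(big_mkord xpredT (e ^~ x)).
by rewrite (@big_cat_nat _ _ _ m 0 n)//= addrAC subrr add0r.
Qed.

Let alpha_ge0 j : 0 <= alpha j.
Proof.
have := oe j j; rewrite eqxx => <-.
by apply: Rintegral_ge0 => x _; rewrite -expr2 sqr_ge0.
Qed.

Let integral_u_diff m n : (m <= n)%N ->
  (\int[mu]_x ((u n x - u m x) ^+ 2)%:E)%E = (\sum_(m <= j < n) alpha j)%:E.
Proof.
move=> mn.
have b2 : bounded_mfun (fun x => (u n x - u m x) ^+ 2).
  under eq_fun do rewrite expr2; apply: bounded_mfunM; exact: bounded_mfunB.
rewrite -[LHS]fineK; last first.
  by apply: integrable_fin_num => //; exact: (bounded_mfun_integrable mu b2).
congr _%:E; rewrite -[LHS]/(\int[mu]_x ((u n x - u m x) ^+ 2)).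
under eq_Rintegral do rewrite u_diff// expr2 mulr_suml.
rewrite Rintegral_sum; last first.
  move=> i; apply: bounded_mfun_integrable; apply: bounded_mfunM => //.
  exact: bounded_mfun_sum.
rewrite !big_seq; apply: eq_bigr => i imn.
under eq_Rintegral do rewrite mulr_sumr.
rewrite Rintegral_sum; last first.
  by move=> j; apply: bounded_mfun_integrable; exact: bounded_mfunM.
rewrite (bigD1_seq i)//= ?iota_uniq// oe eqxx big1 ?addr0// => j ji.
by rewrite oe eq_sym (negbTE ji).
Qed.

Let tail_small (i : nat) : exists N, forall n, (N <= n)%N ->
  \sum_(N <= j < n) alpha j <= ((2^-1) ^+ i) ^+ 2.
Proof.
pose S n := \sum_(j < n) alpha j.
have Snd : nondecreasing_seq S.
  by apply/nondecreasing_seqP => n; rewrite /S big_ord_recr/= lerDl.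
have Sub : has_ubound (range S).
  by exists M => _ [n _ <-]; exact: alphaM.
have Ssup : has_sup (range S) by split => //; exists (S 0%N), 0%N.
have q0 : 0 < ((2^-1) ^+ i) ^+ 2 :> R by rewrite !exprn_gt0.
have [_ [N _ <-] SN] := sup_adherent q0 Ssup.
exists N => n Nn; have : S n <= sup (range S) by apply: ub_le_sup => //; exists n.
have -> : \sum_(N <= j < n) alpha j = S n - S N.
  rewrite /S -!(big_mkord xpredT alpha) (@big_cat_nat _ _ _ N 0 n)//=.
  by rewrite addrC addrK.
by move: SN; lra.
Qed.

(** The Riesz-Fischer theorem. A subsequence of partial sums whose increments are
    summable in [L^1] converges almost everywhere; Fatou's lemma bounds the
    distance of its limit [w] to the partial sums in [L^2], which makes the
    integrals against bounded functions converge. The sum stops at [J] because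
    the functions [e j] are orthogonal to [psi] from there on. *)
Lemma orthogonal_series_cvg : exists w : T -> R,
  [/\ measurable_fun setT w, (\int[mu]_x (w x ^+ 2)%:E <= M%:E)%E &
    forall (psi : T -> R) J, bounded_mfun psi ->
      (forall j, (J <= j)%N -> \int[mu]_x (e j x * psi x) = 0) ->
      \int[mu]_x (w x * psi x) = \sum_(j < J) \int[mu]_x (e j x * psi x)].
Proof.
have [N0 N0P] := choice tail_small.
(* An increasing sequence dominating N0, along which the remainders decrease
   geometrically. *)
pose N i := (\sum_(j < i.+1) N0 j + i)%N.
have N0N i : (N0 i <= N i)%N.
  rewrite /N big_ord_recr/= -addnA; exact: leq_trans (leq_addr i _) (leq_addl _ _).
have NS i : (N i <= N i.+1)%N.
  by rewrite /N [X in (_ <= X + _)%N]big_ord_recr/= leq_add// leq_addr.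
have Nmono i j : (i <= j)%N -> (N i <= N j)%N.
  by apply: (homo_leq (leqnn) leq_trans) => k; exact: NS.
have iN i : (i <= N i)%N by rewrite leq_addl.
pose v i := u (N i).
pose q i : R := 2^-1 ^+ i.
have q0 i : 0 < q i by rewrite exprn_gt0.
have bv i : bounded_mfun (v i) by exact: bu.
have mv i : measurable_fun setT (v i) by case: (bv i).
have v_diff i j : (i <= j)%N ->
    (\int[mu]_x ((v j x - v i x) ^+ 2)%:E <= (q i ^+ 2)%:E)%E.
  move=> ij; rewrite integral_u_diff ?Nmono// lee_fin.
  apply: le_trans (N0P i (N j) _); last exact: leq_trans (N0N i) (Nmono _ _ ij).
  rewrite (@big_cat_nat _ _ _ (N i) (N0 i))//= ?Nmono//.
  by rewrite lerDr sumr_ge0.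
have mdiff i j : measurable_fun setT (fun x => v j x - v i x).
  exact: measurable_funB.
have v_diff1 i : (\int[mu]_x `|v i.+1 x - v i x|%:E <= (q i)%:E)%E.
  exact: (integral_norm_le_of_sqr (mdiff i i.+1) (q0 i) (v_diff i i.+1 (leqnSn i))).
pose H x := (\sum_(0 <= i <oo) `|v i.+1 x - v i x|%:E)%E.
have mH : measurable_fun setT H.
  apply: ge0_emeasurable_sum => // i _.
  by apply/measurable_EFinP; exact: measurableT_comp.
have H0 x : (0 <= H x)%E by apply: nneseries_ge0 => i _ _; rewrite lee_fin.
have intH : (\int[mu]_x H x < +oo)%E.
  rewrite integral_nneseries//; last first.
    by move=> i; apply/measurable_EFinP; exact: measurableT_comp.
  apply: (@le_lt_trans _ _ (\sum_(0 <= i <oo) (q i)%:E)%E).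
    apply: lee_nneseries => [i _ _|i _]; last exact: v_diff1.
    by apply: integral_ge0 => x _; rewrite lee_fin.
  apply: (@le_lt_trans _ _ 2%:E); last exact: ltry.
  apply: lime_le; first by apply: is_cvg_nneseries => i _ _; rewrite lee_fin ltW.
  apply: nearW => k; rewrite sumEFin lee_fin.
  suff -> : \sum_(0 <= i < k) q i = 2 - 2 * q k by rewrite gerBl mulr_ge0// ltW.
  elim: k => [|k IH]; first by rewrite big_nil /q expr0 mulr1 subrr.
  by rewrite big_nat_recr//= IH /q exprS; field.
have iH : mu.-integrable setT H.
  by apply/integrableP; split => //; under eq_integral do rewrite gee0_abs//.
have ae_cvg : {ae mu, forall x, cvgn (v ^~ x)}.
  apply: filterS (integrable_ae measurableT iH) => x /(_ I) Hfin.
  pose D i := v i.+1 x - v i x.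
  have cD : cvgn (series D).
    apply: normed_cvg; apply: nondecreasing_is_cvgn.
      apply/nondecreasing_seqP => i.
      by rewrite /normed_series_of /series/= big_nat_recr//= lerDl.
    exists (fine (H x)) => _ [i _ <-].
    rewrite -lee_fin fineK// /normed_series_of /series/= -sumEFin.
    by apply: nneseries_lim_ge => j _ _; rewrite lee_fin.
  have -> : v ^~ x = (fun i => v 0%N x + series D i).
    apply/funext => i.
    by rewrite /series/= (telescope_sumr (v ^~ x))// addrC subrK.
  exact: is_cvgD (is_cvg_cst _) cD.
(* The upper limit is measurable even where the sequence diverges. *)
pose w x := fine (limn_esup (fun i => (v i x)%:E)).
have mw : measurable_fun setT w.
  apply: (measurableT_comp (fine_measurable measurableT)).
  by apply: measurable_fun_limn_esup => i; apply/measurable_EFinP; exact: mv.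
have ae_w : {ae mu, forall x, v ^~ x @ \oo --> w x}.
  apply: filterS ae_cvg => x cv.
  have cE : (fun i => (v i x)%:E) @ \oo --> (limn (v ^~ x))%:E.
    by apply/fine_cvgP; split; [exact: nearW|exact: cv].
  have -> : w x = limn (v ^~ x).
    rewrite /w is_cvg_limn_esupE; first by rewrite (cvg_lim _ cE).
    by apply/cvg_ex; eexists; exact: cE.
  exact: cv.
have fatou_w (z : T -> R) (B : R) J : measurable_fun setT z ->
    (forall j, (J <= j)%N -> (\int[mu]_x ((v j x - z x) ^+ 2)%:E <= B%:E)%E) ->
    (\int[mu]_x ((w x - z x) ^+ 2)%:E <= B%:E)%E.
  move=> mz vz.
  pose f j x := ((v (j + J)%N x - z x) ^+ 2)%:E.
  have mf j : measurable_fun setT (f j).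
    by apply/measurable_EFinP; apply: measurable_funX; exact: measurable_funB.
  have f0 j x : setT x -> (0 <= f j x)%E by rewrite lee_fin sqr_ge0.
  have := fatou mu measurableT mf f0.
  have -> : (\int[mu]_x limn_einf (f^~ x) = \int[mu]_x ((w x - z x) ^+ 2)%:E)%E.
    apply: ae_eq_integral => //.
    - have -> : (fun x => limn_einf (f^~ x)) =
          (fun x => - limn_esup (fun j => - f j x))%E.
        apply/funext => x; rewrite -limn_einfN; congr limn_einf.
        by apply/funext => j; rewrite /comp oppeK.
      apply: measurableT_comp => //; apply: measurable_fun_limn_esup => j.
      exact: measurableT_comp.
    - by apply/measurable_EFinP; apply: measurable_funX; exact: measurable_funB.
    apply: filterS ae_w => x vw _.
    have fE : (fun j => f j x) @ \oo --> ((w x - z x) ^+ 2)%:E.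
      apply/fine_cvgP; split; first exact: nearW.
      have vJ : (fun j => v (j + J)%N x) @ \oo --> w x.
        by rewrite (cvg_shiftn J (v ^~ x)).
      rewrite expr2 (_ : fine \o _ =
          (fun j => (v (j + J)%N x - z x) * (v (j + J)%N x - z x))).
        by apply: cvgM; apply: cvgB => //; exact: cvg_cst.
      by apply/funext => j; rewrite /f/= expr2.
    by rewrite is_cvg_limn_einfE; [exact: cvg_lim|apply/cvg_ex; eexists; exact: fE].
  move=> /le_trans; apply; rewrite limn_einf_lim.
  apply: lime_le; first exact: is_cvg_einfs.
  apply: nearW => j; apply: (@le_trans _ _ (\int[mu]_x f j x)%E).
    by apply: ereal_inf_lbound; exists j => //=.
  by apply: vz; exact: leq_addl.
have w2 : (\int[mu]_x (w x ^+ 2)%:E <= M%:E)%E.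
  have := fatou_w (fun=> 0) M 0%N (measurable_cst _).
  under eq_integral do rewrite subr0; apply => j _.
  under eq_integral do rewrite subr0.
  rewrite (_ : (\int[mu]_x (v j x ^+ 2)%:E)%E =
      (\int[mu]_x ((u (N j) x - u 0%N x) ^+ 2)%:E)%E).
    by rewrite integral_u_diff// big_mkord lee_fin.
  by apply: eq_integral => x _; rewrite [u 0%N x]big_ord0 subr0.
have wint : mu.-integrable setT (EFin \o w).
  apply/integrableP; split; first exact/measurable_EFinP.
  have M0 : 0 <= M by have := alphaM 0; rewrite big_ord0.
  apply: (@le_lt_trans _ _ (M + 1)%:E); last exact: ltry.
  apply: integral_norm_le_of_sqr => //; first by rewrite ltr_pwDr.
  apply: le_trans w2 _; rewrite lee_fin; nra.
exists w; split => // psi J bpsi psiJ.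
  have [mpsi [C psiC]] := bpsi.
  have C0 : 0 <= C by apply: le_trans (psiC point).
  set S := \sum_(j < J) _.
  have vpsi i : (J <= N i)%N -> \int[mu]_x (v i x * psi x) = S.
    move=> Ji; rewrite /v /u; under eq_Rintegral do rewrite mulr_suml.
    rewrite Rintegral_sum; last first.
      by move=> j; apply: bounded_mfun_integrable; exact: bounded_mfunM.
    rewrite -!(big_mkord xpredT (fun j => \int[mu]_x (e j x * psi x))).
    rewrite (@big_cat_nat _ _ _ J 0 (N i))//= [X in _ + X]big_nat.
    rewrite [X in _ + X]big1 ?addr0 ?big_mkord// => j.
    by move=> /andP[Jj _]; exact: psiJ.
  have close i : (J <= i)%N -> `|\int[mu]_x (w x * psi x) - S| <= C * q i.
    move=> Ji; rewrite -(vpsi i); last exact: leq_trans Ji (iN i).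
    have vint : mu.-integrable setT (EFin \o (fun x => v i x * psi x)).
      by apply: bounded_mfun_integrable; exact: bounded_mfunM.
    have wpint : mu.-integrable setT (EFin \o (fun x => w x * psi x)).
      have := bounded_mfun_mul_integrable bpsi wint.
      by apply: eq_integrable => // x _ /=; rewrite mulrC.
    rewrite -RintegralB//.
    have dint : mu.-integrable setT (EFin \o (fun x => w x - v i x)).
      exact: (integrableB measurableT wint (bounded_mfun_integrable mu (bv i))).
    have := integral_norm_le_of_sqr (measurable_funB mw (mv i)) (q0 i)
      (fatou_w (v i) (q i ^+ 2) i (mv i) (v_diff i)).
    move=> L1.
    apply: le_trans (le_normr_Rintegral _ _) _ => //.
      exact: (integrableB measurableT wpint vint).
    apply: (@le_trans _ _ (\int[mu]_x (C * `|w x - v i x|))).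
      apply: le_Rintegral => //.
      - apply: (@integrable_norm _ _ _ mu _ (fun x => w x * psi x - v i x * psi x)).
        exact: (integrableB measurableT wpint vint).
      - exact: (integrableZl measurableT C (integrable_norm dint)).
      - by move=> x _; rewrite -mulrBl normrM mulrC ler_wpM2r.
    rewrite RintegralZl//; last exact: integrable_norm.
    apply: ler_wpM2l => //; rewrite -lee_fin /Rintegral fineK//.
    by apply: integrable_fin_num => //; exact: integrable_norm.
  apply/eqP; rewrite -subr_eq0 -normr_le0; apply/ler_addgt0Pr => r r0; rewrite add0r.
  have : q @ \oo --> 0 by apply: cvg_expr; rewrite gtr0_norm//; lra.
  have rC : 0 < r / (C + 1) by rewrite divr_gt0// ltr_pwDr.
  move=> /cvgr0Pnorm_le /(_ _ rC) qr; near \oo => i.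
  apply: le_trans (close i _) _; first by near: i; exists J.
  apply: (@le_trans _ _ ((C + 1) * (r / (C + 1)))); last first.
    by rewrite mulrC divfK// gt_eqF// ltr_pwDr.
  apply: ler_pM => //; [exact: ltW|by rewrite lerDl|].
  by rewrite -[leLHS]gtr0_norm//; near: i.
Unshelve. all: by end_near. Qed.

End riesz_fischer.

(** * Multiplier operators on L^p, p finite *)

Section Lp_tools.
Context {disp : measure_display} {T : measurableType disp} {R : realType}.
Variable mu : probability T R.

Lemma Lfun_measurable (q : \bar R) f : f \in Lfun mu q -> measurable_fun setT f.
Proof. by rewrite inE => /andP[/[!inE]]. Qed.

Lemma LnormyE (f : T -> \bar R) : ('N[mu]_(+oo%E)[f] = ess_sup mu (abse \o f))%E.
Proof.
rewrite unlock /Lnorm ifT// [X in (0 < X)%E](_ : _ = 1%E)//.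
exact: probability_setT.
Qed.

Lemma Lnormy_le (f : T -> R) (C : R) : (forall x, `|f x| <= C) ->
  ('N[mu]_(+oo%E)[EFin \o f] <= C%:E)%E.
Proof.
by move=> fC; rewrite LnormyE; apply/ess_supP; apply: nearW => x; rewrite /= lee_fin.
Qed.

Lemma bounded_mfun_Lfun (q : \bar R) f : (1 <= q)%E -> bounded_mfun f ->
  f \in Lfun mu q.
Proof.
move=> q1 [mf [C fC]].
have muT : mu [set: T] \is a fin_num by rewrite probability_setT.
apply: (Lfun_subset q1 (leey 1) muT (leey q)).
rewrite inE; apply/andP; split; rewrite inE//=.
by apply: le_lt_trans (Lnormy_le fC) _; exact: ltry.
Qed.

(** Hoelder's inequality with the constant function [1]. *)
Lemma integral_norm_le_Lnorm (q : \bar R) (f : T -> R) : (1 <= q)%E ->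
  measurable_fun setT f -> (\int[mu]_x `|f x|%:E <= 'N[mu]_q[EFin \o f])%E.
Proof.
case: q => [r| |]// r1 mf; last first.
  rewrite LnormyE; set S := ess_sup _ _.
  have S0 : (0 <= S)%E by rewrite /S -LnormyE Lnorm_ge0.
  have : (\int[mu]_x `|f x|%:E <= \int[mu]_x (cst S x))%E.
    apply: ae_ge0_le_integral => //.
    - by apply/measurable_EFinP; exact: measurableT_comp.
    - by apply: filterS (ess_sup_ge mu (abse \o (EFin \o f))) => x fx _.
  move=> /le_trans; apply; rewrite integral_cst//.
  by rewrite [X in (_ * X)%E](_ : _ = 1%E) ?mule1//; exact: probability_setT.
move: r1; rewrite lee_fin le_eqVlt => /predU1P[<-|r1]; first by rewrite Lnorm1.
have r0 : 0 < r by rewrite (lt_trans ltr01).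
have rr : r^-1 + ((1 - r^-1)^-1)^-1 = 1 by rewrite invrK addrC subrK.
have r'0 : 0 < (1 - r^-1)^-1 by rewrite invr_gt0 subr_gt0 invf_lt1.
have := hoelder mu mf (measurable_cst (1 : R)) r0 r'0 rr.
rewrite Lnorm1 (_ : EFin \o cst 1 = cst 1%E)// Lnorm_cst1.
rewrite [X in (_ <= _ * X)%E -> _](_ : _ = 1%E) ?mule1; last first.
  by apply: etrans (poweR1r _); congr (_ `^ _)%E; exact: probability_setT.
by under eq_integral do rewrite /= mulr1.
Qed.

Lemma Lfun_integrable1 (q : \bar R) f : (1 <= q)%E -> f \in Lfun mu q ->
  mu.-integrable setT (EFin \o f).
Proof.
move=> q1 fq; apply/(Lfun1_integrable mu f).
apply: (Lfun_subset _ q1 _ q1 fq); [exact: lexx|exact: fin_num_measure].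
Qed.

End Lp_tools.

Section multiplier_tools.
Context {R : realType} {d : nat} {disp : measure_display}
  {T : measurableType disp}.
Variable mu : probability T R.
Variables (phi : multi_index d -> T -> R) (K : R).
Hypothesis mphi : forall m, measurable_fun setT (phi m).
Hypothesis phiK : forall m x, `|phi m x| <= K.
Hypothesis phi_on : forall m m', \int[mu]_x (phi m x * phi m' x) = (m == m')%:R.
Variables (n : nat) (idx : 'I_n -> multi_index d).

Definition lincomb (b : 'I_n -> R) (x : T) : R := \sum_i b i * phi (idx i) x.

Lemma bounded_phi m : bounded_mfun (phi m).
Proof. by split => //; exists K. Qed.

Lemma bounded_lincomb b : bounded_mfun (lincomb b).
Proof.
by apply: bounded_mfun_sum => i; apply: bounded_mfunZ; exact: bounded_phi.
Qed.

Lemma fourier_lincomb b m :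
  fourier mu phi (lincomb b) m = \sum_i b i * (idx i == m)%:R.
Proof.
rewrite /fourier; under eq_Rintegral do rewrite mulr_suml.
rewrite Rintegral_sum; last first.
  move=> i; apply: bounded_mfun_integrable; apply: bounded_mfunM; last exact: bounded_phi.
  by apply: bounded_mfunZ; exact: bounded_phi.
apply: eq_bigr => i _; under eq_Rintegral do rewrite -mulrA.
rewrite RintegralZl// ?phi_on//.
by apply: bounded_mfun_integrable; apply: bounded_mfunM; exact: bounded_phi.
Qed.

Lemma multiplier_value_lincomb (lam : multi_index d -> R) (q : \bar R) b :
  (1 <= q)%E ->
  multiplier_value mu phi lam q (lincomb b) (lincomb (fun i => lam (idx i) * b i)).
Proof.
move=> q1; split; first exact: bounded_mfun_Lfun q1 (bounded_lincomb _).
move=> m; rewrite !fourier_lincomb mulr_sumr; apply: eq_bigr => i _.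
by case: eqVneq => [->|]; rewrite ?mulr1 ?mulr0.
Qed.

End multiplier_tools.

(** For an unbounded multiplier the entropy number is infinite, so boundedness may
    be assumed when it is bounded from below. *)
Lemma multiplier_entropy_ge {R : realType} {d : nat} {disp : measure_display}
  {T : measurableType disp} (mu : probability T R)
  (phi : multi_index d -> T -> R) (lam : multi_index d -> R) (p q : \bar R)
  (k : nat) (B : R) :
  (multiplier_bounded mu phi lam p q ->
   forall (eps : R) (c : 'I_(2 ^ k.-1) -> T -> R), 0 < eps ->
    (forall i, c i \in Lfun mu q) ->
    (forall g, multiplier_ball mu phi lam p q g ->
      exists i, ('N[mu]_q[EFin \o (g \- c i)%R] <= eps%:E)%E) ->
    B <= eps) ->
  (B%:E <= multiplier_entropy mu phi lam p q k)%E.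
Proof.
move=> h; rewrite /multiplier_entropy; case: ifPn => [/asboolP bd|_]; last exact: leey.
apply: le_ereal_inf_tmp => _ [eps [eps0 [c [cq cov]]] <-].
by rewrite lee_fin; exact: (h bd eps c).
Qed.

Section finite_p.
Context {R : realType} {d : nat} {disp : measure_display}
  {T : measurableType disp}.
Variable mu : probability T R.
Variables (phi : multi_index d -> T -> R) (K : R).
Hypothesis mphi : forall m, measurable_fun setT (phi m).
Hypothesis phiK : forall m x, `|phi m x| <= K.
Hypothesis phi_on : forall m m', \int[mu]_x (phi m x * phi m' x) = (m == m')%:R.
Hypothesis Kp : 0 < K.

(** This is [ln (t / r) <= t / r]. *)
Lemma powR_le_expR (r t : R) : 1 <= r -> 0 <= t -> t `^ r <= r `^ r * expR t.
Proof.
move=> r1; rewrite le_eqVlt => /predU1P[<-|t0].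
  by rewrite powR0 ?gt_eqF ?mulr_ge0 ?powR_ge0 ?expR_ge0// (lt_le_trans ltr01).
have r0 : 0 < r by rewrite (lt_le_trans ltr01).
rewrite /powR !gt_eqF//= -expRD ler_expR.
have tr : 0 < t / r by rewrite divr_gt0.
have := ltW (ln_sublinear tr); rewrite ln_div ?posrE// => h.
have := ler_wpM2l (ltW r0) h; rewrite mulrBr [r * (t / r)]mulrC divfK ?gt_eqF//.
by lra.
Qed.

(** For finite [p], the functions [random_sum phi a] with a controlled
    exponential moment are multiples of elements of the unit ball of [L^p]
    by a factor independent of the number of frequencies, since
    [t `^ r <= r `^ r * expR t]. *)
Lemma entropy_lower_bound_finite_p (r : R) (q : \bar R) : 1 <= r -> (1 <= q)%E ->
  exists2 C : R, 0 < C & forall (lam : multi_index d -> R) (n k : nat)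
    (idx : 'I_n.+1 -> multi_index d), injective idx ->
    (forall i, lam (idx i) != 0) ->
    forall eps c, 0 < eps ->
    (forall i : 'I_(2 ^ k.-1), c i \in Lfun mu q) ->
    (forall g, multiplier_ball mu phi lam r%:E q g ->
      exists i, ('N[mu]_q[EFin \o (g \- c i)%R] <= eps%:E)%E) ->
    \prod_i `|lam (idx i)| <= 2 * (2 ^ k.-1)%:R * (C * eps) ^+ n.+1.
Proof.
move=> r1 q1; have r0 : 0 < r by rewrite (lt_le_trans ltr01).
pose A := r `^ r * (4 * expR (2 * 1 ^+ 2 * K ^+ 2)).
have A0 : 0 <= A by rewrite mulr_ge0 ?powR_ge0// mulr_ge0 ?expR_ge0.
pose B := 1 + A.
have B0 : 0 < B by rewrite ltr_pwDl.
exists (expR 2 * K ^+ 2 * B); first by rewrite !mulr_gt0 ?expR_gt0 ?exprn_gt0.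
move=> lam n k idx idx_inj lam0 eps c eps0 cq cov.
pose phin i := phi (idx i).
have phin_on i j : \int[mu]_x (phin i x * phin j x) = (i == j)%:R.
  by rewrite /phin phi_on (inj_eq idx_inj).
rewrite -[_ * B * eps]mulrA.
have ic i : mu.-integrable setT (EFin \o c i) by exact: Lfun_integrable1 q1 (cq i).
apply: (prod_le_covering (mu := mu) (phi := phin) _ _ phin_on Kp
  (c := fun i x => B * c i x) (th := 1) lam0).
- by move=> i; exact: mphi.
- by move=> i x; exact: phiK.
- by move=> i; exact: (integrableZl measurableT B (ic i)).
- by rewrite mulr_gt0.
move=> a aM.
pose b i := tnth a i / (Num.sqrt n.+1%:R * B).
have fE x : lincomb phi idx b x = random_sum phin a x / B.
  rewrite /lincomb /random_sum !mulr_suml; apply: eq_bigr => i _.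
  by rewrite /b /phin invfM; ring.
have mrs := measurable_random_sum (fun i => mphi (idx i)) a.
have fball : unit_ball mu r%:E (lincomb phi idx b).
  split; first exact: bounded_mfun_Lfun (bounded_lincomb mphi phiK idx b).
  have le_exp x : `|lincomb phi idx b x| `^ r <= B^-1 * (r `^ r *
      (expR (1 * random_sum phin a x) + expR (- (1 * random_sum phin a x)))).
    rewrite fE mulrC normrM gtr0_norm ?invr_gt0//.
    have B1 : 0 < B^-1 <= 1 by rewrite invr_gt0 B0 invf_le1// lerDl.
    apply: le_trans (ge1r_powRZ B1 (normr_ge0 _) r1) _.
    apply: ler_wpM2l; first by rewrite invr_ge0 ltW.
    apply: le_trans (powR_le_expR r1 (normr_ge0 _)) _.
    apply: ler_wpM2l; first exact: powR_ge0.
    rewrite mul1r; case: (ger0P (random_sum phin a x)) => _.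
      by rewrite lerDl expR_ge0.
    by rewrite lerDr expR_ge0.
  have ie := integrable_exp_moment mu (fun i => mphi (idx i))
    (fun i => phiK (idx i)) 1 a.
  have int_le : (\int[mu]_x (`|lincomb phi idx b x| `^ r)%:E <= 1)%E.
    apply: (@le_trans _ _ (\int[mu]_x ((B^-1 * r `^ r)%:E *
      (expR (1 * random_sum phin a x) + expR (- (1 * random_sum phin a x)))%:E))%E).
      apply: ge0_le_integral => //.
      - apply/measurable_EFinP.
        apply: (measurableT_comp (measurable_powR r)); apply: measurableT_comp => //.
        by case: (bounded_lincomb mphi phiK idx b).
      - apply: measurable_funeM; exact: (measurable_int _ ie).
      - by move=> x _; rewrite -EFinM lee_fin -mulrA le_exp.
    rewrite integralZl//.
    have -> : (\int[mu]_x (expR (1 * random_sum phin a x) +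
        expR (- (1 * random_sum phin a x)))%:E = (exp_moment mu phin 1 a)%:E)%E.
      by rewrite /exp_moment /Rintegral fineK//; exact: integrable_fin_num.
    rewrite -EFinM lee_fin -mulrA mulrC ler_pdivrMr// mul1r /B.
    apply: (@le_trans _ _ A); last by rewrite lerDr.
    by rewrite /A ler_wpM2l ?powR_ge0.
  rewrite unlock /Lnorm -[leRHS](poweR1r r^-1).
  apply: gt0_ler_poweR.
  - by rewrite invr_ge0 ltW.
  - by rewrite in_itv/= leey integral_ge0// => x _; rewrite poweR_ge0.
  - by rewrite in_itv/= leey lee01.
  - exact: int_le.
have gval := multiplier_value_lincomb mphi phiK phi_on idx lam b q1.
have [i gi] := cov _ (ex_intro2 _ _ _ fball gval).
exists i.
set g := lincomb _ _ (fun i => _ * _) in gval gi.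
have mci := Lfun_measurable (cq i).
have mg : measurable_fun setT g := Lfun_measurable gval.1.
have L1 := le_trans (integral_norm_le_Lnorm mu q1 (measurable_funB mg mci)) gi.
have ig : mu.-integrable setT (EFin \o g).
  exact: bounded_mfun_integrable (bounded_lincomb mphi phiK idx _).
have igc : mu.-integrable setT (EFin \o (fun x => g x - c i x)).
  exact: (integrableB measurableT ig (ic i)).
have -> : \int[mu]_x `|(\sum_j lam (idx j) * tnth a j * phin j x) /
    Num.sqrt n.+1%:R - B * c i x| = \int[mu]_x (B * `|g x - c i x|).
  apply: eq_Rintegral => x _; rewrite -[B in RHS]gtr0_norm// -normrM mulrBr.
  congr `|_ - _|; rewrite /g /lincomb mulr_suml mulr_sumr; apply: eq_bigr => j _.
  rewrite /b /phin; field; rewrite ?gt_eqF//.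
rewrite RintegralZl//; last exact: integrable_norm.
rewrite ler_wpM2l ?(ltW B0)// -lee_fin /Rintegral fineK//.
by apply: integrable_fin_num => //; exact: integrable_norm.
Qed.

End finite_p.

(** * Multiplier operators on L^oo *)

Section orthonormal_system.
Context {R : realType} {d : nat} {disp : measure_display}
  {T : measurableType disp}.
Variable mu : probability T R.
Variables (phi : multi_index d -> T -> R) (K : R).
Hypothesis mphi : forall m, measurable_fun setT (phi m).
Hypothesis phiK : forall m x, `|phi m x| <= K.
Hypothesis phi_on : forall m m', \int[mu]_x (phi m x * phi m' x) = (m == m')%:R.

Local Notation fourier := (fourier mu phi).

Let bphi m : bounded_mfun (phi m).
Proof. exact: bounded_phi mphi phiK m. Qed.

Let integrable_fourier (f : T -> R) m : mu.-integrable setT (EFin \o f) ->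
  mu.-integrable setT (EFin \o (fun x => f x * phi m x)).
Proof.
move=> fi; have := bounded_mfun_mul_integrable (bphi m) fi.
by apply: eq_integrable => // x _ /=; rewrite mulrC.
Qed.

Lemma fourierD f g m : mu.-integrable setT (EFin \o f) ->
  mu.-integrable setT (EFin \o g) ->
  fourier (fun x => f x + g x) m = fourier f m + fourier g m.
Proof.
move=> fi gi; rewrite /Defs.fourier; under eq_Rintegral do rewrite mulrDl.
by rewrite RintegralD//; exact: integrable_fourier.
Qed.

Lemma fourierB f g m : mu.-integrable setT (EFin \o f) ->
  mu.-integrable setT (EFin \o g) ->
  fourier (fun x => f x - g x) m = fourier f m - fourier g m.
Proof.
move=> fi gi; rewrite /Defs.fourier; under eq_Rintegral do rewrite mulrBl.
by rewrite RintegralB//; exact: integrable_fourier.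
Qed.

Lemma fourierZ c f m : mu.-integrable setT (EFin \o f) ->
  fourier (fun x => c * f x) m = c * fourier f m.
Proof.
move=> fi; rewrite /Defs.fourier; under eq_Rintegral do rewrite -mulrA.
by rewrite RintegralZl//; exact: integrable_fourier.
Qed.

(** The distance of [f] to its projection on the span of the [phi m] with [m] in
    [s] has a nonnegative square. *)
Lemma bessel (f : T -> R) (s : seq (multi_index d)) : bounded_mfun f -> uniq s ->
  \sum_(m <- s) fourier f m ^+ 2 <= \int[mu]_x (f x ^+ 2).
Proof.
move=> bf us; pose p x := \sum_(m <- s) fourier f m * phi m x.
have bp : bounded_mfun p.
  by apply: bounded_mfun_sum => m; exact: bounded_mfunZ.
have int2 g h : bounded_mfun g -> bounded_mfun h ->
    mu.-integrable setT (EFin \o (fun x => g x * h x)).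
  by move=> bg bh; apply: bounded_mfun_integrable; exact: bounded_mfunM.
have fp : \int[mu]_x (f x * p x) = \sum_(m <- s) fourier f m ^+ 2.
  under eq_Rintegral do rewrite mulr_sumr.
  rewrite Rintegral_sum; last by move=> m; apply: int2 => //; exact: bounded_mfunZ.
  apply: eq_bigr => m _; under eq_Rintegral do rewrite mulrCA.
  by rewrite RintegralZl ?expr2//; exact: int2.
have pp : \int[mu]_x (p x * p x) = \sum_(m <- s) fourier f m ^+ 2.
  under eq_Rintegral do rewrite {1}/p mulr_suml.
  rewrite Rintegral_sum; last by move=> m; apply: int2 => //; exact: bounded_mfunZ.
  rewrite !big_seq; apply: eq_bigr => m ms.
  under eq_Rintegral do rewrite mulr_sumr.
  rewrite Rintegral_sum; last by move=> m'; apply: int2 => //; exact: bounded_mfunZ.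
  have E m' : \int[mu]_x (fourier f m * phi m x * (fourier f m' * phi m' x)) =
      fourier f m * fourier f m' * (m == m')%:R.
    under eq_Rintegral do rewrite mulrACA.
    by rewrite RintegralZl ?phi_on//; exact: int2.
  rewrite (bigD1_seq m)//= E eqxx mulr1 big1 ?addr0 ?expr2// => m' m'm.
  by rewrite E eq_sym (negbTE m'm) mulr0.
have : 0 <= \int[mu]_x ((f x - p x) ^+ 2).
  by apply: Rintegral_ge0 => x _; exact: sqr_ge0.
have sqE x : (f x - p x) ^+ 2 = f x ^+ 2 - 2 * (f x * p x) + p x * p x by ring.
under eq_Rintegral do rewrite sqE.
have ff2 : mu.-integrable setT (EFin \o (fun x => f x ^+ 2)).
  by under eq_fun do rewrite expr2; exact: int2.
have fp2 := integrableZl measurableT 2 (int2 _ _ bf bp).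
have ffp : mu.-integrable setT (EFin \o (fun x => f x ^+ 2 - 2 * (f x * p x))).
  exact: (integrableB measurableT ff2 fp2).
rewrite RintegralD//; last exact: int2.
rewrite RintegralB// RintegralZl//; last exact: int2.
by rewrite fp pp; lra.
Qed.

(** The function [w] is the sum of the series of the [b m * fourier G m * phi m],
    which converges by the theorem of Riesz and Fischer because Bessel's
    inequality bounds the squares of its coefficients. *)
Lemma exists_multiplier_L2 (G : T -> R) (b : multi_index d -> R) (B E : R) :
  bounded_mfun G -> (forall m, `|b m| <= B) -> \int[mu]_x (G x ^+ 2) <= E ->
  exists w : T -> R, [/\ measurable_fun setT w,
    (\int[mu]_x (w x ^+ 2)%:E <= (B ^+ 2 * E)%:E)%E &
    forall m, fourier w m = b m * fourier G m].
Proof.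
move=> bG bB GE.
have B0 : 0 <= B by apply: le_trans (bB [ffun=> 0%N]).
pose coef m := b m * fourier G m.
(* The multi-indices are enumerated by their codes; numbers that are not codes
   contribute zero terms. *)
pose e j x := if pickle_inv j is Some m then coef m * phi m x else 0.
pose alpha j := if pickle_inv j is Some m then coef m ^+ 2 else 0.
have be j : bounded_mfun (e j).
  rewrite /e; case: pickle_inv => [m|]; last exact: bounded_mfun_cst.
  exact: bounded_mfunZ.
have pinv j m : @pickle_inv (multi_index d) j = Some m -> pickle m = j.
  by move=> jm; have := @pickle_invK (multi_index d) j; rewrite jm.
have int_cc c c' m m' :
    \int[mu]_x (c * phi m x * (c' * phi m' x)) = c * c' * (m == m')%:R.
  under eq_Rintegral do rewrite mulrACA.
  rewrite RintegralZl ?phi_on//.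
  by apply: bounded_mfun_integrable; exact: bounded_mfunM.
have oe i j : \int[mu]_x (e i x * e j x) = if i == j then alpha i else 0.
  rewrite /e /alpha; case Ei : (pickle_inv i) => [m|]; last first.
    under eq_Rintegral do rewrite mul0r.
    by rewrite Rintegral_cst// mul0r; case: ifP.
  case Ej : (pickle_inv j) => [m'|]; last first.
    under eq_Rintegral do rewrite mulr0.
    rewrite Rintegral_cst// mul0r; case: eqP => // ij.
    by move: Ej; rewrite -ij Ei.
  rewrite int_cc; case: (eqVneq i j) => [ij|ij].
    by move: Ej; rewrite -ij Ei => -[<-]; rewrite eqxx mulr1 expr2.
  case: eqVneq => [mm'|_]; last by rewrite mulr0.
  by move: ij; rewrite -(pinv _ _ Ei) -(pinv _ _ Ej) mm' eqxx.
have alphaM k : \sum_(j < k) alpha j <= B ^+ 2 * E.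
  pose s := pmap (@pickle_inv (multi_index d)) (iota 0 k).
  have us : uniq s by apply: (pmap_uniq (@pickle_invK _)); exact: iota_uniq.
  have -> : \sum_(j < k) alpha j = \sum_(m <- s) coef m ^+ 2.
    rewrite -(big_mkord xpredT alpha) /s /index_iota subn0.
    elim: (iota 0 k) => [|j l IH]; first by rewrite !big_nil.
    rewrite big_cons IH /alpha /=; case: pickle_inv => [m|]/=; last by rewrite add0r.
    by rewrite big_cons.
  apply: (@le_trans _ _ (\sum_(m <- s) B ^+ 2 * fourier G m ^+ 2)).
    apply: ler_sum => m _; rewrite exprMn ler_wpM2r ?sqr_ge0//.
    by rewrite -[_ ^+ 2]ger0_norm ?sqr_ge0// normrX lerXn2r ?nnegrE.
  rewrite -mulr_sumr ler_wpM2l ?sqr_ge0//.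
  exact: le_trans (bessel bG us) GE.
have [w [mw w2 wpsi]] := orthogonal_series_cvg be oe alphaM.
exists w; split => // m.
rewrite /Defs.fourier (wpsi _ (pickle m).+1)//; last first.
  move=> j mj; rewrite /e; case Ej : (pickle_inv j) => [m'|]; last first.
    by under eq_Rintegral do rewrite mul0r; rewrite Rintegral_cst// mul0r.
  have := int_cc (coef m') 1 m' m; under eq_Rintegral do rewrite mul1r.
  move=> ->; case: eqVneq => [mm'|_]; last by rewrite mulr0.
  by move: mj; rewrite -mm' (pinv _ _ Ej) ltnn.
rewrite big_ord_recr/= big1 ?add0r; last first.
  move=> j _; rewrite /e; case Ej : (pickle_inv j) => [m'|]; last first.
    by under eq_Rintegral do rewrite mul0r; rewrite Rintegral_cst// mul0r.
  have := int_cc (coef m') 1 m' m; under eq_Rintegral do rewrite mul1r.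
  move=> ->; case: eqVneq => [mm'|_]; last by rewrite mulr0.
  have : (pickle m' < pickle m)%N by rewrite (pinv _ _ Ej).
  by rewrite mm' ltnn.
rewrite /e pickleK_inv.
have := int_cc (coef m) 1 m m; under eq_Rintegral do rewrite mul1r.
by move=> ->; rewrite eqxx !mulr1.
Qed.

End orthonormal_system.

Section truncation.
Context {R : realType}.

Definition truncate (tau t : R) : R := Num.max (- tau) (Num.min tau t).

Lemma norm_truncate_le (tau t : R) : 0 <= tau -> `|truncate tau t| <= tau.
Proof.
move=> tau0; rewrite /truncate ler_norml le_max lexx/=.
by rewrite ge_max ge_min lexx andbT; lra.
Qed.

(** The difference is the excess of [|t|] over [tau], and
    [y ^+ 2 <= 4 * expR y] for [y] the product of [th] and this excess. *)
Lemma sqr_truncateB_le (tau th t : R) : 0 < th -> 0 <= tau ->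
  (truncate tau t - t) ^+ 2 <=
  4 / th ^+ 2 * expR (- (th * tau)) * (expR (th * t) + expR (- (th * t))).
Proof.
move=> th0 tau0.
have quad (y : R) : 0 <= y -> y ^+ 2 <= 4 * expR y.
  move=> y0; have := expR_ge1Dx (y / 2) => h.
  have -> : expR y = expR (y / 2) ^+ 2.
    by rewrite expr2 -expRD; congr expR; field.
  have : (y / 2) ^+ 2 <= expR (y / 2) ^+ 2.
    by rewrite lerXn2r ?nnegrE ?expR_ge0 ?divr_ge0//; lra.
  by rewrite expr_div_n; lra.
have key (y u : R) : 0 <= y -> u ^+ 2 = (y / th) ^+ 2 ->
    expR y <= expR (- (th * tau)) * (expR (th * t) + expR (- (th * t))) ->
    u ^+ 2 <= 4 / th ^+ 2 * expR (- (th * tau)) * (expR (th * t) + expR (- (th * t))).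
  move=> y0 -> ey; rewrite expr_div_n ler_pdivrMr ?exprn_gt0//.
  apply: le_trans (quad y y0) _.
  rewrite [leRHS](_ : _ =
      4 * (expR (- (th * tau)) * (expR (th * t) + expR (- (th * t))))).
    by rewrite ler_wpM2l.
  by field; rewrite gt_eqF.
have [tlt|tge] := ltP tau t.
  apply: (key (th * (t - tau))).
    by apply: mulr_ge0; [exact: ltW|rewrite subr_ge0; exact: ltW].
    rewrite /truncate min_l ?(ltW tlt)// max_r; last by lra.
    by rewrite [th * _]mulrC mulfK ?gt_eqF// -sqrrN opprB.
  rewrite [leRHS]mulrDr -!expRD.
  rewrite (_ : th * (t - tau) = - (th * tau) + th * t); last by ring.
  by rewrite lerDl expR_ge0.
have [tlt'|tge'] := ltP t (- tau).
  apply: (key (th * (- tau - t))).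
    by apply: mulr_ge0; [exact: ltW|rewrite subr_ge0; exact: ltW].
    rewrite /truncate min_r// max_l; last exact: ltW.
    by rewrite [th * _]mulrC mulfK ?gt_eqF.
  rewrite [leRHS]mulrDr -!expRD.
  rewrite (_ : th * (- tau - t) = - (th * tau) - th * t); last by ring.
  by rewrite lerDr expR_ge0.
rewrite /truncate min_r// max_r// subrr expr0n/=.
apply: mulr_ge0; last by rewrite addr_ge0 ?expR_ge0.
by rewrite mulr_ge0 ?expR_ge0// divr_ge0// sqr_ge0.
Qed.

End truncation.

Section square_integrable_functions.
Context {disp : measure_display} {T : measurableType disp} {R : realType}.
Variable mu : probability T R.

Lemma sqr_integrable_Lfun2 (f : T -> R) (B : R) : measurable_fun setT f ->
  (\int[mu]_x (f x ^+ 2)%:E <= B%:E)%E -> f \in Lfun mu 2%:E.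
Proof.
move=> mf fB; rewrite inE; apply/andP; split; rewrite inE//=.
rewrite /finite_norm unlock /Lnorm; apply: poweR_lty.
apply: le_lt_trans (ltry B); apply: le_trans fB.
rewrite le_eqVlt; apply/orP; left; apply/eqP; apply: eq_integral => x _.
by rewrite /= -[2%R]/(2%:R) powR_mulrn// real_normK// num_real.
Qed.

Lemma sqr_integral_add_le (f g : T -> R) (A B : R) :
  measurable_fun setT f -> measurable_fun setT g ->
  (\int[mu]_x (f x ^+ 2)%:E <= A%:E)%E -> (\int[mu]_x (g x ^+ 2)%:E <= B%:E)%E ->
  (\int[mu]_x ((f x + g x) ^+ 2)%:E <= (2 * A + 2 * B)%:E)%E.
Proof.
move=> mf mg fA gB.
have mf2 : measurable_fun setT (fun x => (f x ^+ 2)%:E).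
  by apply/measurable_EFinP; exact: measurable_funX.
have mg2 : measurable_fun setT (fun x => (g x ^+ 2)%:E).
  by apply/measurable_EFinP; exact: measurable_funX.
apply: (@le_trans _ _ (\int[mu]_x (2%:E * (f x ^+ 2)%:E + 2%:E * (g x ^+ 2)%:E))%E).
  apply: ge0_le_integral => //.
  - by move=> x _; rewrite lee_fin sqr_ge0.
  - by apply/measurable_EFinP; apply: measurable_funX; exact: measurable_funD.
  - by apply: emeasurable_funD; exact: measurable_funeM.
  - by move=> x _; rewrite -!EFinM -EFinD lee_fin; have := sqr_ge0 (f x - g x); nra.
have p0 (h : T -> R) x : setT x -> (0 <= 2%:E * (h x ^+ 2)%:E)%E.
  by move=> _; rewrite -EFinM lee_fin mulr_ge0 ?sqr_ge0.
rewrite ge0_integralD//;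
  [|exact: p0|exact: measurable_funeM|exact: p0|exact: measurable_funeM].
have q0 (h : T -> R) x : setT x -> (0 <= (h x ^+ 2)%:E)%E.
  by move=> _; rewrite lee_fin sqr_ge0.
rewrite !ge0_integralZl//; [|exact: q0|exact: q0].
rewrite (EFinD (2 * A)) (EFinM 2 A) (EFinM 2 B).
by apply: leeD; apply: lee_wpmul2l.
Qed.

Lemma bounded_sqr_integral_le (f : T -> R) (C : R) : measurable_fun setT f ->
  (forall x, `|f x| <= C) -> (\int[mu]_x (f x ^+ 2)%:E <= (C ^+ 2)%:E)%E.
Proof.
move=> mf fC; rewrite -[leRHS]mule1 -(@probability_setT _ _ _ mu) -integral_cst//.
apply: ge0_le_integral => //.
- by move=> x _; rewrite lee_fin sqr_ge0.
- by apply/measurable_EFinP; exact: measurable_funX.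
- move=> x _; rewrite lee_fin -[_ ^+ 2]ger0_norm ?sqr_ge0// normrX lerXn2r ?nnegrE//.
  exact: le_trans (fC x).
Qed.

End square_integrable_functions.

Section infinite_p.
Context {R : realType} {d : nat} {disp : measure_display}
  {T : measurableType disp}.
Variable mu : probability T R.
Variables (phi : multi_index d -> T -> R) (K : R).
Hypothesis mphi : forall m, measurable_fun setT (phi m).
Hypothesis phiK : forall m x, `|phi m x| <= K.
Hypothesis phi_on : forall m m', \int[mu]_x (phi m x * phi m' x) = (m == m')%:R.
Hypothesis phi_complete : forall f, f \in Lfun mu 2%:E ->
  (forall m, fourier mu phi f m = 0) -> f = cst 0 %[ae mu].
Hypothesis Kp : 0 < K.

(** For [q <= 2] the function [g] itself is a value in [L^q]. For [q > 2] the
    bounded operator provides a value [g0] in [L^q]; it lies in [L^2] and has the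
    Fourier coefficients of [g], so that completeness identifies them. *)
Lemma exists_multiplier_value (lam : multi_index d -> R) (q : \bar R) (f g : T -> R) :
  (1 <= q)%E -> multiplier_bounded mu phi lam +oo%E q -> f \in Lfun mu +oo%E ->
  multiplier_value mu phi lam 2%:E f g ->
  exists2 g0, multiplier_value mu phi lam q f g0 & g0 = g %[ae mu].
Proof.
move=> q1 [bd _] fy [g2 gval].
have muT : mu [set: T] \is a fin_num by exact: fin_num_measure.
have [q2|q2] := leP q 2%:E.
  exists g; last exact: ae_eq_refl.
  by split => //; apply: (Lfun_subset q1 _ muT q2 g2); rewrite lee_fin ler1n.
have [g0 [g0q g0val]] := bd f fy.
exists g0 => //.
have two1 : (1 <= 2%:E :> \bar R)%E by rewrite lee_fin ler1n.
have g02 : g0 \in Lfun mu 2%:E by exact: (Lfun_subset two1 q1 muT (ltW q2) g0q).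
have ig0 := Lfun_integrable1 two1 g02; have ig := Lfun_integrable1 two1 g2.
have D2 : (fun x => g0 x - g x) \in Lfun mu 2%:E.
  have sq f' : f' \in Lfun mu 2%:E ->
      (\int[mu]_x (f' x ^+ 2)%:E <= (\int[mu]_x (f' x ^+ 2))%:E)%E.
    move=> /Lfun2_integrable_sqr h; rewrite /Rintegral fineK//.
    exact: integrable_fin_num.
  have mg := Lfun_measurable g2; have mg0 := Lfun_measurable g02.
  have mNg : measurable_fun setT (fun x => - g x) by exact: measurableT_comp.
  apply: (sqr_integrable_Lfun2 (measurable_funB mg0 mg)).
  apply: (sqr_integral_add_le mg0 mNg (sq _ g02)).
  by under eq_integral do rewrite sqrrN; exact: sq.
have := phi_complete D2.
have z m : fourier mu phi (fun x => g0 x - g x) m = 0.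
  by rewrite (fourierB mphi phiK)// g0val gval subrr.
move=> /(_ z); apply: filterS => x /= h /h /eqP; rewrite subr_eq0 => /eqP.
by [].
Qed.

Section one_ball_cover.
Variables (n : nat) (idx : 'I_n.+2 -> multi_index d).
Hypothesis idx_inj : injective idx.
Local Notation N := (n.+2%:R : R).
Let phin i := phi (idx i).

Let phin_on i j : \int[mu]_x (phin i x * phin j x) = (i == j)%:R.
Proof. by rewrite /phin phi_on (inj_eq idx_inj). Qed.

(** Truncate [random_sum phin a] at the height [tau], and restore the [n.+2]
    Fourier coefficients that this has changed. The square of the change [G] has
    an integral of at most [delta ^+ 2 / n.+2], because of the exponential
    moment; hence its coefficients on [idx] have absolute values with a sum of
    at most [1] by the Cauchy-Schwarz inequality, and restoring them costs at
    most [K] in [L^oo]. Outside [idx] the coefficients of [G] are left over. *)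
Lemma exists_bounded_lift (a : n.+2.-tuple R) (tau th delta : R) :
  0 < th -> 0 <= tau -> 0 < delta <= 1 ->
  exp_moment mu phin th a <= 4 * expR (2 * th ^+ 2 * K ^+ 2) ->
  16 / th ^+ 2 * expR (2 * th ^+ 2 * K ^+ 2 - th * tau) <= delta ^+ 2 / N ->
  exists h G : T -> R, [/\ measurable_fun setT h,
    (forall x, `|h x| <= tau + K), bounded_mfun G,
    \int[mu]_x (G x ^+ 2) <= delta ^+ 2 &
    forall m, fourier mu phi h m =
      if [exists i, idx i == m] then fourier mu phi (random_sum phin a) m
      else fourier mu phi G m].
Proof.
move=> th0 tau0 /andP[delta0 delta1] aM small.
pose f := random_sum phin a.
have mf : measurable_fun setT f := measurable_random_sum (fun i => mphi (idx i)) a.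
have bf : bounded_mfun f.
  split => //; eexists => x.
  exact: (random_sum_bounded (fun i => phiK (idx i)) a x).
pose ftau x := truncate tau (f x).
have bftau : bounded_mfun ftau.
  split; last by exists tau => x; exact: norm_truncate_le.
  apply: measurable_maxr => //; exact: measurable_minr.
pose G x := ftau x - f x.
have bG : bounded_mfun G by exact: bounded_mfunB.
have bG2 : bounded_mfun (fun x => G x ^+ 2).
  by under eq_fun do rewrite expr2; exact: bounded_mfunM.
have iexp := integrable_exp_moment mu (fun i => mphi (idx i))
  (fun i => phiK (idx i)) th a.
have G2 : \int[mu]_x (G x ^+ 2) <= delta ^+ 2 / N.
  apply: le_trans small.
  apply: (@le_trans _ _ (\int[mu]_x (4 / th ^+ 2 * expR (- (th * tau)) *
      (expR (th * f x) + expR (- (th * f x)))))).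
    apply: le_Rintegral => //.
    - exact: bounded_mfun_integrable.
    - exact: (integrableZl measurableT (4 / th ^+ 2 * expR (- (th * tau))) iexp).
    - by move=> x _; exact: sqr_truncateB_le.
  rewrite RintegralZl// -/(exp_moment mu phin th a).
  have c0 : 0 <= 4 / th ^+ 2 * expR (- (th * tau)).
    by rewrite mulr_ge0 ?expR_ge0// divr_ge0// sqr_ge0.
  apply: le_trans (ler_wpM2l c0 aM) _.
  rewrite expRD le_eqVlt; apply/orP; left; apply/eqP.
  by field; rewrite gt_eqF.
have N1 : 1 <= N by rewrite ler1n.
have N0 : 0 < N by exact: lt_le_trans N1.
pose g i := fourier mu phi G (idx i).
have bess : \sum_i g i ^+ 2 <= delta ^+ 2 / N.
  have := bessel mphi phiK phi_on bG (s := map idx (enum 'I_n.+2)).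
  rewrite map_inj_uniq ?enum_uniq// => /(_ isT).
  by rewrite big_map big_enum/= => /le_trans; apply.
have sumg : \sum_i `|g i| <= 1.
  (* Cauchy-Schwarz, in the form of the arithmetic-geometric mean inequality. *)
  apply: (@le_trans _ _ (\sum_(i < n.+2) (N * g i ^+ 2 / delta + delta / N) / 2)).
    apply: ler_sum => i _; rewrite -(real_normK (num_real (g i))) -subr_ge0.
    rewrite [leRHS](_ : _ = (N * `|g i| - delta) ^+ 2 / (2 * delta * N)).
      by rewrite divr_ge0 ?sqr_ge0// !mulr_ge0// ltW.
    by field; rewrite ?gt_eqF.
  have -> : \sum_(i < n.+2) (N * g i ^+ 2 / delta + delta / N) / 2 =
      (N * (\sum_i g i ^+ 2) / delta + delta) / 2.
    rewrite -mulr_suml big_split/=; congr ((_ + _) / 2).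
      by rewrite mulr_sumr mulr_suml.
    by rewrite sumr_const card_ord -[_ *+ n.+2]mulr_natr divfK ?gt_eqF.
  have : N * (\sum_i g i ^+ 2) / delta <= delta.
    rewrite ler_pdivrMr// mulrC -expr2.
    by rewrite -ler_pdivlMr.
  by lra.
pose h x := ftau x - lincomb phi idx g x.
exists h, G; split => //.
- apply: measurable_funB; first by case: bftau.
  by case: (bounded_lincomb mphi phiK idx g).
- move=> x; apply: le_trans (ler_normB _ _) _; apply: lerD.
    exact: norm_truncate_le.
  apply: le_trans (ler_norm_sum _ _ _) _.
  apply: (@le_trans _ _ (\sum_i `|g i| * K)).
    by apply: ler_sum => i _; rewrite normrM ler_wpM2l.
  by rewrite -mulr_suml -[leRHS]mul1r ler_wpM2r// ltW.
- by apply: le_trans G2 _; rewrite ler_pdivrMr// ler_peMr ?sqr_ge0.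
- move=> m.
  have bl := bounded_lincomb mphi phiK idx g.
  have ift := bounded_mfun_integrable mu bftau.
  have il := bounded_mfun_integrable mu bl.
  have if_ := bounded_mfun_integrable mu bf.
  rewrite (fourierB mphi phiK)// (fourier_lincomb mphi phiK phi_on).
  have Gm : fourier mu phi G m = fourier mu phi ftau m - fourier mu phi f m.
    by rewrite (fourierB mphi phiK).
  case: ifPn => [/existsP[i /eqP im]|/existsPn im].
    rewrite (bigD1 i)//= im eqxx mulr1 big1 ?addr0; last first.
      by move=> j ji; rewrite -im (inj_eq idx_inj) (negbTE ji) mulr0.
    by rewrite /g im Gm; rewrite -/f; ring.
  rewrite big1 ?subr0; last by move=> i _; rewrite (negbTE (im i)) mulr0.
  rewrite Gm.
  have -> : f = lincomb phi idx (fun i => tnth a i / Num.sqrt N).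
    apply/funext => x; rewrite /f /random_sum /lincomb mulr_suml.
    by apply: eq_bigr => i _; rewrite /phin; ring.
  rewrite (fourier_lincomb mphi phiK phi_on) big1 ?subr0// => i _.
  by rewrite (negbTE (im i)) mulr0.
Qed.

End one_ball_cover.

End infinite_p.

Section infinite_p_bound.
Context {R : realType} {d : nat} {disp : measure_display}
  {T : measurableType disp}.
Variable mu : probability T R.
Variables (phi : multi_index d -> T -> R) (K : R).
Hypothesis mphi : forall m, measurable_fun setT (phi m).
Hypothesis phiK : forall m x, `|phi m x| <= K.
Hypothesis phi_on : forall m m', \int[mu]_x (phi m x * phi m' x) = (m == m')%:R.
Hypothesis phi_complete : forall f, f \in Lfun mu 2%:E ->
  (forall m, fourier mu phi f m = 0) -> f = cst 0 %[ae mu].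
Hypothesis Kp : 0 < K.

(** With [th = sqrt (ln n.+2)] and [tau = kap * th] for a large constant [kap],
    the functions provided by [exists_bounded_lift] are bounded by a multiple of
    [sqrt (ln n.+2)]. Their images differ from those of the random sums by a
    function [w], of norm at most [A * t * delta] in [L^2] as it involves the
    frequencies outside [idx] only; [delta] is chosen such that it contributes
    [t / 2]. *)
Lemma entropy_lower_bound_infinite_p (q : \bar R) (A : R) : (1 <= q)%E -> 0 < A ->
  exists2 C : R, 0 < C & forall (lam : multi_index d -> R) (n k : nat)
    (idx : 'I_n.+2 -> multi_index d) (t : R), injective idx ->
    (forall i, lam (idx i) != 0) -> 0 < t ->
    (forall m, (forall i, idx i != m) -> `|lam m| <= A * t) ->
    multiplier_bounded mu phi lam +oo%E q ->
    forall eps c, 0 < eps ->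
    (forall i : 'I_(2 ^ k.-1), c i \in Lfun mu q) ->
    (forall g, multiplier_ball mu phi lam +oo%E q g ->
      exists i, ('N[mu]_q[EFin \o (g \- c i)%R] <= eps%:E)%E) ->
    \prod_i `|lam (idx i)| <= 2 * (2 ^ k.-1)%:R *
      (C * (Num.sqrt (ln n.+2%:R) * eps) + t / 2) ^+ n.+2.
Proof.
move=> q1 A0.
pose E0 := expR 2 * K ^+ 2.
have E00 : 0 < E0 by rewrite mulr_gt0 ?expR_gt0 ?exprn_gt0.
(* Small enough for E0 * A * delta <= 1 / 2, as needed for the term t / 2. *)
pose delta := (1 + 2 * E0 * A)^-1.
have dden : 1 <= 1 + 2 * E0 * A by rewrite lerDl !mulr_ge0// ltW.
have delta0 : 0 < delta by rewrite invr_gt0 (lt_le_trans ltr01).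
have delta1 : delta <= 1 by rewrite invf_le1// (lt_le_trans ltr01).
have dE : E0 * (A * delta) <= 2^-1.
  rewrite mulrA ler_pdivrMr ?(lt_le_trans ltr01)//; lra.
(* The part of kap that makes the exponential factor in the hypothesis of
   exists_bounded_lift smaller than delta ^ 2 / N. *)
pose kap0 := 64 / delta ^+ 2.
have kap00 : 0 < kap0 by rewrite divr_gt0// exprn_gt0.
pose kap := 2 * K ^+ 2 + 1 + kap0.
have kap_gt0 : 0 < kap by rewrite !addr_gt0// mulr_gt0// exprn_gt0.
exists (E0 * (kap + 2 * K)).
  by rewrite mulr_gt0// addr_gt0// mulr_gt0.
move=> lam n k idx t idx_inj lam0 t0 tail bdd eps c eps0 cq cov.
set N : R := n.+2%:R.
pose L := ln N.
have N2 : 2 <= N by rewrite ler_nat.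
have N0 : 0 < N by apply: lt_le_trans N2.
have L2 : 2^-1 <= L by apply: le_trans ln2_ge_half _; rewrite ler_ln ?posrE.
have L0 : 0 < L by apply: lt_le_trans L2.
pose th := Num.sqrt L.
have th0 : 0 < th by rewrite sqrtr_gt0.
have th2 : th ^+ 2 = L by rewrite sqr_sqrtr// ltW.
pose tau := kap * th.
have tau0 : 0 < tau by rewrite mulr_gt0.
have thalf : 2^-1 <= th by rewrite -(@ler_pXn2r _ 2)// ?nnegrE ?(ltW th0)// th2; lra.
have small : 16 / th ^+ 2 * expR (2 * th ^+ 2 * K ^+ 2 - th * tau) <= delta ^+ 2 / N.
  have -> : th * tau = kap * L by rewrite /tau mulrCA -expr2 th2.
  rewrite th2 (_ : _ - _ = - L + - (kap0 * L)); last by rewrite /kap; ring.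
  rewrite expRD expRN lnK ?posrE// mulrCA mulrC ler_wpM2r ?invr_ge0 ?(ltW N0)//.
  have kL : 0 < kap0 * L by rewrite mulr_gt0.
  have : expR (- (kap0 * L)) <= (kap0 * L)^-1.
    rewrite expRN lef_pV2 ?posrE ?expR_gt0//.
    by apply: le_trans (expR_ge1Dx _); rewrite lerDr.
  have c0 : 0 <= 16 / L by rewrite divr_ge0// ltW.
  move=> /(ler_wpM2l c0) /le_trans; apply.
  have -> : 16 / L / (kap0 * L) = delta ^+ 2 * (4^-1 / L ^+ 2).
    by rewrite /kap0; field; rewrite !gt_eqF.
  rewrite ler_piMr ?sqr_ge0// ler_pdivrMr ?exprn_gt0// mul1r.
  by rewrite (_ : 4^-1 = 2^-1 ^+ 2) ?lerXn2r ?nnegrE ?(ltW L0)//; field.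
pose s := (tau + K)^-1.
have tK0 : 0 < tau + K by rewrite addr_gt0.
have s0 : 0 < s by rewrite invr_gt0.
pose phin i := phi (idx i).
have phin_on i j : \int[mu]_x (phin i x * phin j x) = (i == j)%:R.
  by rewrite /phin phi_on (inj_eq idx_inj).
have ic i : mu.-integrable setT (EFin \o c i) by exact: Lfun_integrable1 q1 (cq i).
pose eps' := (tau + K) * eps + A * t * delta.
have eps'0 : 0 < eps' by rewrite addr_gt0 ?mulr_gt0.
have main : \prod_i `|lam (idx i)| <= 2 * (2 ^ k.-1)%:R * (E0 * eps') ^+ n.+2.
  apply: (prod_le_covering (mu := mu) (phi := phin) _ _ phin_on Kp
    (c := fun i x => (tau + K) * c i x) (th := th) lam0).
  - by move=> i; exact: mphi.
  - by move=> i x; exact: phiK.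
  - by move=> i; exact: (integrableZl measurableT (tau + K) (ic i)).
  - by [].
  move=> a aM.
  have dd : 0 < delta <= 1 by rewrite delta0.
  have [h [G [mh hb bG G2 hE]]] :=
    exists_bounded_lift mphi phiK phi_on Kp idx_inj th0 (ltW tau0) dd aM small.
  (* The multiplier restricted to the frequencies outside idx. *)
  pose b m := if [exists i, idx i == m] then 0 else lam m.
  have bA m : `|b m| <= A * t.
    rewrite /b; case: ifPn => [_|/existsPn]; last exact: tail.
    by rewrite normr0 mulr_ge0// ltW.
  have [w [mw w2 wE]] := exists_multiplier_L2 mphi phiK phi_on bG bA G2.
  rewrite -exprMn in w2.
  have Atd0 : 0 < A * t * delta by rewrite !mulr_gt0.
  have w1 := integral_norm_le_of_sqr mw Atd0 w2.
  pose LF := lincomb phi idx (fun i => lam (idx i) * (tnth a i / Num.sqrt N)).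
  have bLF : bounded_mfun LF by exact: bounded_lincomb.
  have [mLF [CF LFC]] := bLF.
  pose g x := LF x + w x.
  have mg : measurable_fun setT g by exact: measurable_funD.
  have two1 : (1 <= 2%:E :> \bar R)%E by rewrite lee_fin ler1n.
  have g2 : g \in Lfun mu 2%:E.
    apply: (sqr_integrable_Lfun2 mg).
    exact: (sqr_integral_add_le mLF mw (bounded_sqr_integral_le mu mLF LFC) w2).
  have w2' : w \in Lfun mu 2%:E by exact: sqr_integrable_Lfun2 mw w2.
  have iw := Lfun_integrable1 two1 w2'; have ig := Lfun_integrable1 two1 g2.
  have iLF := bounded_mfun_integrable mu bLF.
  pose f' x := s * h x; pose g' x := s * g x.
  have bh : bounded_mfun h by split => //; exists (tau + K).
  have ih := bounded_mfun_integrable mu bh.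
  have f'y : f' \in Lfun mu +oo%E.
    exact: (bounded_mfun_Lfun mu (leey _) (bounded_mfunZ s bh)).
  have f'ball : unit_ball mu +oo%E f'.
    split => //; apply: Lnormy_le => x.
    by rewrite normrM gtr0_norm// /s mulrC ler_pdivrMr// mul1r.
  have g'val : multiplier_value mu phi lam 2%:E f' g'.
    split.
      rewrite (_ : g' = s \o* g); first by apply: Lfun_scale => //; rewrite ler1n.
      by apply/funext => x /=; rewrite mulrC.
    move=> m; rewrite (fourierZ mphi phiK)// (fourierZ mphi phiK)//.
    rewrite mulrCA; congr (_ * _); rewrite (fourierD mphi phiK)// wE hE /b.
    rewrite (fourier_lincomb mphi phiK phi_on).
    have rsE : random_sum phin a = lincomb phi idx (fun i => tnth a i / Num.sqrt N).
      apply/funext => x; rewrite /random_sum /lincomb mulr_suml.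
      by apply: eq_bigr => i _; rewrite /phin -/N; ring.
    case: ifPn => [_|/existsPn im].
      rewrite mul0r addr0 rsE (fourier_lincomb mphi phiK phi_on) mulr_sumr.
      by apply: eq_bigr => i _; case: eqVneq => [->|]; rewrite ?mulr1 ?mulr0.
    by rewrite big1 ?add0r// => i _; rewrite (negbTE (im i)) mulr0.
  have [g0 g0val g0g'] := exists_multiplier_value mphi phiK phi_complete q1 bdd f'y g'val.
  have [i gi] := cov _ (ex_intro2 _ _ _ f'ball g0val).
  exists i.
  have mc := Lfun_measurable (cq i); have mg0 := Lfun_measurable g0val.1.
  have L1 := le_trans (integral_norm_le_Lnorm mu q1 (measurable_funB mg0 mc)) gi.
  have ig'c : mu.-integrable setT (EFin \o (fun x => g' x - c i x)).
    exact: (integrableB measurableT (integrableZl measurableT s ig) (ic i)).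
  have L1' : \int[mu]_x `|g' x - c i x| <= eps.
    rewrite -lee_fin /Rintegral fineK; last first.
      by apply: integrable_fin_num => //; exact: integrable_norm.
    apply: le_trans L1; rewrite le_eqVlt; apply/orP; left; apply/eqP.
    apply: ae_eq_integral => //.
    - apply/measurable_EFinP; apply: measurableT_comp => //.
      by apply: measurable_funB => //; exact: measurable_funM.
    - by apply/measurable_EFinP; apply: measurableT_comp => //; exact: measurable_funB.
    - by apply: filterS g0g' => x /= gx _; rewrite gx.
  have w1' : \int[mu]_x `|w x| <= A * t * delta.
    rewrite -lee_fin /Rintegral fineK//.
    by apply: integrable_fin_num => //; exact: integrable_norm.
  apply: (@le_trans _ _ (\int[mu]_x ((tau + K) * `|g' x - c i x| + `|w x|))).
    have LFE x : (\sum_j lam (idx j) * tnth a j * phin j x) / Num.sqrt N = LF x.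
      by rewrite /LF /lincomb mulr_suml; apply: eq_bigr => j _; rewrite /phin; ring.
    under eq_Rintegral do rewrite LFE.
    apply: le_Rintegral => //.
    - apply: (@integrable_norm _ _ _ mu _ (fun x => LF x - (tau + K) * c i x)).
      exact: (integrableB measurableT iLF (integrableZl measurableT (tau + K) (ic i))).
    - exact: (integrableD measurableT
        (integrableZl measurableT (tau + K) (integrable_norm ig'c)) (integrable_norm iw)).
    - move=> x _.
      have -> : LF x - (tau + K) * c i x = (tau + K) * (g' x - c i x) - w x.
        by rewrite /g' /g /s; field; rewrite gt_eqF.
      by apply: le_trans (ler_normB _ _) _; rewrite lerD2r normrM gtr0_norm.
  rewrite RintegralD//; last 2 first.
  - exact: (integrableZl measurableT (tau + K) (integrable_norm ig'c)).
  - exact: integrable_norm.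
  rewrite RintegralZl//; last exact: integrable_norm.
  by apply: lerD => //; rewrite ler_wpM2l// ltW.
apply: le_trans main _.
rewrite ler_wpM2l ?mulr_ge0// lerXn2r// ?nnegrE.
- by rewrite mulr_ge0// ltW.
- rewrite addr_ge0 ?divr_ge0 ?(ltW t0)//; apply: mulr_ge0.
    by apply: ltW; rewrite mulr_gt0// addr_gt0// mulr_gt0.
  by apply: ltW; exact: mulr_gt0.
rewrite -/N -/L -/th /eps' mulrDr; apply: lerD.
  rewrite [leRHS](_ : _ = E0 * ((kap + 2 * K) * th * eps)); last by ring.
  rewrite ler_wpM2l ?(ltW E00)// ler_wpM2r ?(ltW eps0)// mulrDl -/tau lerD2l.
  by have := ler_wpM2l (ltW Kp) thalf; lra.
rewrite [leLHS](_ : _ = E0 * (A * delta) * t); last by ring.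
by rewrite mulrC ler_wpM2l// ltW.
Qed.

End infinite_p_bound.

(** * Enlarging the set of frequencies *)

(** The logarithm increases by at most [n.+2^-1], which is at most [4 / n.+3] times
    [ln n.+2 >= 1 / 2]. *)
Lemma ln_nat_succ_le {R : realType} (n : nat) :
  ln n.+3%:R <= expR (4 / n.+3%:R) * ln n.+2%:R :> R.
Proof.
have : 2 <= n.+2%:R :> R by rewrite ler_nat.
rewrite -[n.+3%:R]natr1; move: (n.+2%:R : R) => N N2.
have N0 : 0 < N by apply: lt_le_trans N2.
have N10 : 0 < N + 1 by rewrite addr_gt0.
have ln_half : 2^-1 <= ln N.
  by apply: le_trans ln2_ge_half _; rewrite ler_ln ?posrE.
have i0 : 0 < N^-1 by rewrite invr_gt0.
have -> : N + 1 = N * (1 + N^-1) by rewrite mulrDr mulr1 mulfV ?gt_eqF.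
rewrite lnM ?posrE ?addr_gt0// mulrDr mulr1 mulfV ?gt_eqF//.
have ln_le : ln (1 + N^-1) <= N^-1 by rewrite le_ln1Dx// (lt_trans _ i0)// ltrN10.
have inv_le : N^-1 <= 2 / (N + 1).
  rewrite ler_pdivlMr// mulrDr mulVf ?gt_eqF// mulr1.
  have : N^-1 <= 1 by rewrite invf_le1//; lra.
  by lra.
have e1 := ler_wpM2r (le_trans (ltW _) ln_half) (expR_ge1Dx (4 / (N + 1))).
apply: le_trans (e1 _); last by rewrite invr_gt0.
have c0 : 0 <= 4 / (N + 1) by rewrite divr_ge0// ltW.
have := ler_wpM2l c0 ln_half.
have -> : 4 / (N + 1) * 2^-1 = 2 / (N + 1) by field; rewrite gt_eqF.
by rewrite mulrDl mul1r; lra.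
Qed.

(** Adjoining to [n.+2] numbers of geometric mean [t] a number larger than
    [expR 2 * t] raises the geometric mean by a factor of at least
    [expR (2 / n.+3)], which is more than the square root of the logarithm of
    their number grows by. *)
Lemma adjoin_mean {R : realType} (n : nat) (t x : R) : 0 < t -> expR 2 * t < x ->
  exists t', [/\ 0 < t', x * t ^+ n.+2 = t' ^+ n.+3 &
    t ^+ 2 / ln n.+2%:R <= t' ^+ 2 / ln n.+3%:R].
Proof.
move=> t0 tx.
have x0 : 0 < x by apply: lt_trans tx; rewrite mulr_gt0 ?expR_gt0.
have N0 : 0 < n.+3%:R :> R by rewrite ltr0n.
have ln_gt0 k : 0 < ln k.+2%:R :> R by rewrite ln_gt0// ltr1n.
exists (t * expR (ln (x / t) / n.+3%:R)); split.
- by rewrite mulr_gt0 ?expR_gt0.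
- rewrite exprMn -expRM_natl [_ * (_ / _)]mulrC divfK ?gt_eqF// lnK ?posrE ?divr_gt0//.
  by rewrite [t ^+ n.+3]exprS; field; rewrite gt_eqF.
rewrite exprMn -[leRHS]mulrA ler_pM2l ?exprn_gt0// -expRM_natl.
rewrite ler_pdivlMr// mulrC ler_pdivrMr//.
apply: le_trans (ln_nat_succ_le n) _; rewrite ler_pM2r// ler_expR mulrA.
rewrite ler_pM2r ?invr_gt0//.
have : 2 <= ln (x / t).
  by rewrite -ler_expR lnK ?posrE ?divr_gt0// ler_pdivlMr// ltW.
by lra.
Qed.

Section enlarging_the_index_set.
Context {R : realType} {I : eqType}.
Variables (lam : I -> R) (L : R) (m : nat).
Hypothesis lamL : forall i, `|lam i| <= L.
Hypothesis m0 : (0 < m)%N.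

Definition adjoin n (idx : 'I_n -> I) (j : I) (i : 'I_n.+1) : I :=
  if unlift ord0 i is Some i' then idx i' else j.

Lemma adjoin_inj n (idx : 'I_n -> I) j : injective idx ->
  (forall i, idx i != j) -> injective (adjoin idx j).
Proof.
move=> inj nj i i'; rewrite /adjoin.
case: unliftP => [k ->|->]; case: unliftP => [k' ->|->] //.
- by move=> /inj ->.
- by move=> e; have := nj k; rewrite e eqxx.
- by move=> e; have := nj k'; rewrite -e eqxx.
Qed.

Lemma prod_adjoin n (idx : 'I_n -> I) j (F : I -> R) :
  \prod_i F (adjoin idx j i) = F j * \prod_i F (idx i).
Proof.
rewrite big_ord_recl /adjoin unlift_none; congr (_ * _).
by apply: eq_bigr => i _; rewrite liftK.
Qed.

(** Adjoin frequencies whose multiplier exceeds [expR 2] times the normalised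
    mean [t'], as long as there are any. The ratio of [t' ^+ 2] to the logarithm
    of the number of frequencies does not decrease; as [t'] is bounded by [L],
    this number stays bounded and the process stops. *)
Lemma exists_dominating_index_set n (idx : 'I_n.+2 -> I) (t : R) :
  injective idx -> (forall i, lam (idx i) != 0) -> 0 < t ->
  \prod_i `|lam (idx i)| = 2 * m%:R * t ^+ n.+2 ->
  exists n' (idx' : 'I_n'.+2 -> I) t', [/\ injective idx',
    forall i, lam (idx' i) != 0, 0 < t',
    \prod_i `|lam (idx' i)| = 2 * m%:R * t' ^+ n'.+2 &
    t ^+ 2 / ln n.+2%:R <= t' ^+ 2 / ln n'.+2%:R /\
    (forall j, (forall i, idx' i != j) -> `|lam j| <= expR 2 * t')].
Proof.
move=> inj0 lam0 t0 prod0.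
have ln_half k : 2^-1 <= ln k.+2%:R :> R.
  by apply: le_trans ln2_ge_half _; rewrite ler_ln ?posrE// ler_nat.
have ln_gt0 k : 0 < ln k.+2%:R :> R by apply: lt_le_trans (ln_half k).
set Phi := t ^+ 2 / ln n.+2%:R.
have Phi0 : 0 < Phi by rewrite divr_gt0// exprn_gt0.
(* From n0 frequencies on, t <= L contradicts Phi <= t ^ 2 / ln n. *)
pose n0 := Num.Def.archi_bound (expR (L ^+ 2 / Phi)).
have n0P : expR (L ^+ 2 / Phi) < n0%:R.
  by apply: archi_boundP; exact: expR_ge0.
have L0 : 0 <= L by apply: le_trans (lamL (idx ord0)).
suff : forall r n (idx : 'I_n.+2 -> I) t, (n0 <= n + r)%N ->
    injective idx -> (forall i, lam (idx i) != 0) -> 0 < t ->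
    \prod_i `|lam (idx i)| = 2 * m%:R * t ^+ n.+2 -> Phi <= t ^+ 2 / ln n.+2%:R ->
    exists n' (idx' : 'I_n'.+2 -> I) t', [/\ injective idx',
      forall i, lam (idx' i) != 0, 0 < t',
      \prod_i `|lam (idx' i)| = 2 * m%:R * t' ^+ n'.+2 &
      Phi <= t' ^+ 2 / ln n'.+2%:R /\
      (forall j, (forall i, idx' i != j) -> `|lam j| <= expR 2 * t')].
  by move=> /(_ n0 n idx t); apply => //; exact: leq_addl.
clearbody n0 Phi; clear n idx t inj0 lam0 t0 prod0; elim=> [|r IH].
  move=> n idx t; rewrite addn0 => n0n inj lam0 t0 prod0 Phit; exfalso.
  have N0 : 0 < n.+2%:R :> R by rewrite ltr0n.
  have tL : t <= L.
    have : t ^+ n.+2 <= L ^+ n.+2.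
      apply: (@le_trans _ _ (2 * m%:R * t ^+ n.+2)).
        rewrite ler_peMl ?exprn_ge0 ?(ltW t0)// -natrM ler1n.
        by rewrite muln_gt0.
      rewrite -prod0 -[in leRHS](card_ord n.+2) -prodr_const.
      by apply: ler_prod => i _; rewrite normr_ge0 lamL.
    by rewrite ler_pXn2r ?nnegrE ?(ltW t0).
  have : n.+2%:R <= expR (L ^+ 2 / Phi).
    rewrite -[leLHS]lnK ?posrE// ler_expR ler_pdivlMr// mulrC -ler_pdivlMr//.
    apply: le_trans Phit _; rewrite ler_wpM2r ?invr_ge0 ?(ltW (ln_gt0 n))//.
    by rewrite ler_pXn2r ?nnegrE ?(ltW t0).
  move=> /le_lt_trans/(_ n0P); rewrite ltr_nat => /leq_trans/(_ n0n).
  by rewrite ltnNge (leq_trans (leqnSn n) (leqnSn n.+1)).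
move=> n idx t n0n inj lam0 t0 prod0 Phit.
case: (pselect (forall j, (forall i, idx i != j) -> `|lam j| <= expR 2 * t)) => [tail|].
  by exists n, idx, t.
move=> /existsNP[j /not_implyP[nj /negP]]; rewrite -ltNge => lamj.
have lamj0 : 0 < `|lam j| by apply: lt_trans lamj; rewrite mulr_gt0 ?expR_gt0.
have [t' [t'0 t'E t'Phi]] := adjoin_mean n t0 lamj.
apply: (IH n.+1 (adjoin idx j) t') => //.
- by rewrite addSnnS.
- exact: adjoin_inj.
- move=> i; rewrite /adjoin; case: unliftP => [i' _|_] //.
  by rewrite -normr_gt0.
- by rewrite (prod_adjoin idx j (fun i => `|lam i|)) prod0 mulrCA t'E.
- exact: le_trans t'Phi.
Qed.

End enlarging_the_index_set.

(** * The bound for arbitrary sets of frequencies *)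

Section the_factor_V.
Context {R : realType}.

Lemma log2_ge1 (n : nat) : 1 <= log2 n.+2%:R :> R.
Proof.
have ln2 : 0 < ln 2 :> R by apply: lt_le_trans ln2_ge_half; rewrite invr_gt0.
by rewrite /log2 ler_pdivlMr// mul1r ler_ln ?posrE// ler_nat.
Qed.

Lemma powR_inv_sqrt (x : R) : 0 <= x -> x `^ (- 2^-1) = (Num.sqrt x)^-1.
Proof. by move=> x0; rewrite powRN powR12_sqrt. Qed.

Lemma Vfactor_ge0 (p q : \bar R) (n : nat) : 0 <= Vfactor p q n.+2 :> R.
Proof.
rewrite /Vfactor; case: ifP => _; case: ifP => _; rewrite ?powR_ge0//.
by rewrite invr_ge0 (le_trans ler01 (log2_ge1 n)).
Qed.

Lemma Vfactor_le1 (p q : \bar R) (n : nat) : Vfactor p q n.+2 <= 1 :> R.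
Proof.
have h1 := log2_ge1 n; have h0 : 0 < log2 n.+2%:R :> R by apply: lt_le_trans h1.
have h : log2 n.+2%:R `^ (- 2^-1) <= 1 :> R.
  rewrite powR_inv_sqrt ?(ltW h0)// invf_le1 ?sqrtr_gt0//.
  by rewrite -[leLHS]sqrtr1 ler_sqrt// ltW.
by rewrite /Vfactor; case: ifP => _; case: ifP => _ //; rewrite invf_le1.
Qed.

(** [log2 x] is at least [ln x] as [ln 2 <= 1], and at least [1] for [x >= 2], so
    that its inverse is at most its power of exponent [- 1 / 2]. *)
Lemma Vfactor_infinite_p (q : \bar R) (n : nat) :
  Vfactor +oo%E q n.+2 <= (Num.sqrt (ln n.+2%:R))^-1 :> R.
Proof.
have h1 := log2_ge1 n; have h0 : 0 < log2 n.+2%:R :> R by apply: lt_le_trans h1.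
have ln2 : 0 < ln 2 :> R by apply: lt_le_trans ln2_ge_half; rewrite invr_gt0.
have lnN : 0 < ln n.+2%:R :> R by rewrite ln_gt0// ltr1n.
have ln21 : ln 2 <= 1 :> R.
  by have := @le_ln1Dx R 1; apply; rewrite (lt_trans _ ltr01)// ltrN10.
have h : log2 n.+2%:R `^ (- 2^-1) <= (Num.sqrt (ln n.+2%:R))^-1 :> R.
  rewrite powR_inv_sqrt ?(ltW h0)// lef_pV2 ?posrE ?sqrtr_gt0// ler_sqrt ?(ltW h0)//.
  by rewrite /log2 ler_pdivlMr// ler_piMr// ltW.
rewrite /Vfactor eqxx; case: ifP => _ //.
apply: le_trans h; rewrite powR_inv_sqrt ?(ltW h0)// lef_pV2 ?posrE ?sqrtr_gt0//.
rewrite -[leRHS]ger0_norm ?(ltW h0)// -sqrtr_sqr ler_sqrt ?sqr_ge0//.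
by rewrite expr2 ler_peMl// ltW.
Qed.

End the_factor_V.

Section entropy_lower_bound.
Context {R : realType} {d : nat} {disp : measure_display}
  {T : measurableType disp}.
Variable mu : probability T R.
Variables (phi : multi_index d -> T -> R) (K : R).
Hypothesis mphi : forall m, measurable_fun setT (phi m).
Hypothesis phiK : forall m x, `|phi m x| <= K.
Hypothesis phi_on : forall m m', \int[mu]_x (phi m x * phi m' x) = (m == m')%:R.
Hypothesis phi_complete : forall f, f \in Lfun mu 2%:E ->
  (forall m, fourier mu phi f m = 0) -> f = cst 0 %[ae mu].
Hypothesis Kp : 0 < K.

(** The number [t] is the geometric mean of the multipliers on [idx], divided by
    [2 ^ (k / n.+2)]. For [p = oo] the set of frequencies is enlarged first, which
    does not decrease [t / sqrt (ln n.+2)]. *)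
Lemma entropy_lower_bound (p q : \bar R) : (1 <= p)%E -> (1 <= q)%E ->
  exists2 C : R, 0 < C & forall (lam : multi_index d -> R) (L : R) (n k : nat)
    (idx : 'I_n.+2 -> multi_index d) (t : R), (forall m, `|lam m| <= L) ->
    injective idx -> (forall i, lam (idx i) != 0) -> 0 < t ->
    \prod_i `|lam (idx i)| = 2 * (2 ^ k.-1)%:R * t ^+ n.+2 ->
    ((C * t * Vfactor p q n.+2)%:E <= multiplier_entropy mu phi lam p q k)%E.
Proof.
have cancel_expn (m n : nat) (x y : R) : 0 < x -> 0 <= y ->
    2 * (2 ^ m)%:R * x ^+ n.+2 <= 2 * (2 ^ m)%:R * y ^+ n.+2 -> x <= y.
  move=> x0 y0; rewrite ler_pM2l ?mulr_gt0 ?ltr0n ?expn_gt0//.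
  by rewrite ler_pXn2r ?nnegrE ?(ltW x0).
case: p => [r| |]// r1 q1.
  rewrite lee_fin in r1.
  have [C C0 CP] := entropy_lower_bound_finite_p mphi phiK phi_on Kp r1 q1.
  exists C^-1; first by rewrite invr_gt0.
  move=> lam L n k idx t lamL inj lam0 t0 prodE.
  apply: multiplier_entropy_ge => _ eps c eps0 cq cov.
  have := CP lam n.+1 k idx inj lam0 eps c eps0 cq cov.
  rewrite prodE => /cancel_expn -/(_ t0 (mulr_ge0 (ltW C0) (ltW eps0))) tC.
  rewrite -mulrA mulrC ler_pdivrMr// mulrC [eps * C]mulrC; apply: le_trans tC.
  by rewrite mulrC ler_piMr ?Vfactor_le1// ltW.
have [C C0 CP] := entropy_lower_bound_infinite_p mphi phiK phi_on phi_complete Kp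
  q1 (expR_gt0 2).
exists (2 * C)^-1; first by rewrite invr_gt0 mulr_gt0.
move=> lam L n k idx t lamL inj lam0 t0 prodE.
apply: multiplier_entropy_ge => bdd eps c eps0 cq cov.
have m0 : (0 < 2 ^ k.-1)%N by rewrite expn_gt0.
have [n' [idx' [t' [inj' lam0' t'0 prodE' [tt' tail]]]]] :=
  exists_dominating_index_set lamL m0 inj lam0 t0 prodE.
have := CP lam n' k idx' t' inj' lam0' t'0 tail bdd eps c eps0 cq cov.
have ln_gt0 j : 0 < ln j.+2%:R :> R by rewrite ln_gt0// ltr1n.
have sq0 j : 0 < Num.sqrt (ln j.+2%:R) :> R by rewrite sqrtr_gt0.
rewrite prodE' => /cancel_expn; move=> /(_ t'0) tC.
have {}tC : t' / Num.sqrt (ln n'.+2%:R) <= 2 * C * eps.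
  have : t' <= C * (Num.sqrt (ln n'.+2%:R) * eps) + t' / 2.
    by apply: tC; rewrite addr_ge0 ?mulr_ge0 ?invr_ge0// ltW.
  by rewrite ler_pdivrMr//; set s := Num.sqrt _; lra.
have tle : t / Num.sqrt (ln n.+2%:R) <= t' / Num.sqrt (ln n'.+2%:R).
  rewrite -(@ler_pXn2r _ 2)// ?nnegrE ?divr_ge0 ?(ltW t0) ?(ltW t'0) ?(ltW (sq0 _))//.
  by rewrite !expr_div_n !sqr_sqrtr ?(ltW (ln_gt0 _)).
rewrite -mulrA mulrC ler_pdivrMr ?mulr_gt0// [eps * _]mulrC.
apply: le_trans tC; apply: le_trans tle.
by rewrite ler_wpM2l ?(ltW t0)// Vfactor_infinite_p.
Qed.

End entropy_lower_bound.

(** * Dimensions of the spaces spanned by shells and balls *)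

Section ae_dimension.
Context {R : realType} {disp : measure_display} {T : measurableType disp}.
Variable mu : probability T R.

(** Expanding each basis in terms of the other, almost everywhere, gives matrices
    whose product is the identity by the independence of the first basis. *)
Lemma basis_size_le (V : set (T -> R)) (m n : nat) (b : 'I_m -> T -> R)
  (c : 'I_n -> T -> R) : is_basis mu V b -> is_basis mu V c -> (m <= n)%N.
Proof.
move=> [bV b_free b_span] [cV _ c_span].
have /choice[A AE] : forall i, exists a : 'I_n -> R,
    b i = (fun x => \sum_(j < n) a j * c j x) %[ae mu].
  by move=> i; exact: c_span.
have /choice[B BE] : forall j, exists a : 'I_m -> R,
    c j = (fun x => \sum_(i < m) a i * b i x) %[ae mu].
  by move=> j; exact: b_span.
apply: (@mulmx1_min _ m n (\matrix_(i, j) A i j) (\matrix_(j, i) B j i)).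
apply/matrixP => i k; rewrite !mxE; under eq_bigr do rewrite !mxE.
apply/eqP; rewrite -subr_eq0; apply/eqP.
pose D l := \sum_(j < n) A i j * B j l - (i == l)%:R.
suff h : (fun x => \sum_(l < m) D l * b l x) = cst 0 %[ae mu] by exact: (b_free D h k).
rewrite /D.
have {}BE : \forall x \ae mu, forall j, setT x -> c j x = \sum_(l < m) B j l * b l x.
  exact: filter_forall.
have {}AE := AE i; near=> x => _ /=.
have bx : b i x = \sum_(j < n) A i j * c j x by exact: (near AE x).
have cx j : c j x = \sum_(l < m) B j l * b l x by exact: (near BE x).
under eq_bigr do rewrite mulrBl.
rewrite sumrB [X in _ - X](bigD1 i)//= eqxx mul1r.
rewrite [X in _ - (_ + X)]big1 ?addr0; last first.
  by move=> l li; rewrite eq_sym (negbTE li) mul0r.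
apply/eqP; rewrite subr_eq0 bx; apply/eqP.
under eq_bigr do rewrite mulr_suml.
rewrite exchange_big/=; apply: eq_bigr => j _.
by rewrite cx mulr_sumr; apply: eq_bigr => l _; rewrite mulrA.
Unshelve. all: by end_near.
Qed.

Lemma ae_dim_basis (V : set (T -> R)) (n : nat) (b : 'I_n -> T -> R) :
  is_basis mu V b -> ae_dim mu V = n.
Proof.
move=> bV; apply: xget_unique; first by exists b.
move=> m [c cV]; apply/eqP.
by rewrite eqn_leq !(basis_size_le cV bV, basis_size_le bV cV).
Qed.

End ae_dimension.

Section spans_of_frequencies.
Context {R : realType} {d : nat} {disp : measure_display} {T : measurableType disp}.
Variable mu : probability T R.
Variable phi : multi_index d -> T -> R.
Hypothesis phi2 : forall m, phi m \in Lfun mu 2%:E.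
Hypothesis phi_on : forall m m', \int[mu]_x (phi m x * phi m' x) = (m == m')%:R.

(** Integrate the combination against [phi (idx i)]. *)
Lemma ae_free (n : nat) (idx : 'I_n -> multi_index d) (a : 'I_n -> R) :
  injective idx ->
  (fun x => \sum_(i < n) a i * phi (idx i) x) = cst 0 %[ae mu] ->
  forall i, a i = 0.
Proof.
move=> inj a0 i.
have iphi m m' : mu.-integrable setT (EFin \o (fun x => phi m x * phi m' x)).
  by apply/Lfun1_integrable; exact: Lfun2_mul_Lfun1.
have isum : forall l, mu.-integrable setT
    (EFin \o (fun x => a l * (phi (idx l) x * phi (idx i) x))).
  by move=> l; exact: (integrableZl measurableT (a l) (iphi (idx l) (idx i))).
have : \int[mu]_x (\sum_l a l * (phi (idx l) x * phi (idx i) x)) = a i.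
  rewrite Rintegral_sum//.
  rewrite (bigD1 i)//= big1 ?addr0; last first.
    by move=> l li; rewrite RintegralZl// phi_on (inj_eq inj) (negbTE li) mulr0.
  by rewrite RintegralZl// phi_on eqxx mulr1.
move=> <-; rewrite /Rintegral (@ae_eq_integral _ _ _ mu setT (cst 0%E)) ?integral0//.
- apply/measurable_EFinP; apply: measurable_sum => l.
  by apply/measurable_EFinP; exact: measurable_int (isum l).
- move: a0; apply: filterS => x /(_ I) /= h _.
  by under eq_bigr do rewrite mulrA; rewrite -mulr_suml h mul0r.
Qed.

Lemma ae_dim_span (V : set (T -> R)) (s : seq (multi_index d)) : uniq s ->
  (forall k, k \in s -> V (phi k)) ->
  (forall f, V f -> exists a : multi_index d -> R,
    f = (fun x => \sum_(k <- s) a k * phi k x)) ->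
  ae_dim mu V = size s.
Proof.
move=> us sV Vs; apply: (@ae_dim_basis _ _ _ mu V _ (fun i => phi (tnth (in_tuple s) i))).
split.
- by move=> i; apply: sV; exact: mem_tnth.
- move=> a; apply: ae_free => i j.
  by move/tuple_uniqP : (us : uniq (in_tuple s)); exact.
- move=> f /Vs[a ->]; exists (fun i => a (tnth (in_tuple s) i)).
  by apply: nearW => x _; rewrite big_tnth.
Qed.

End spans_of_frequencies.

Section shells.
Context (R : realType) (d : nat).
Local Notation norm := (@euclidean_norm R d).

Lemma coordinate_le_norm (k : multi_index d) j : (k j)%:R <= norm k.
Proof.
rewrite /euclidean_norm -[leLHS]ger0_norm// -sqrtr_sqr ler_sqrt.
  by rewrite (bigD1 j)//= lerDl sumr_ge0// => i _; rewrite sqr_ge0.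
by rewrite sumr_ge0// => i _; rewrite sqr_ge0.
Qed.

(** The coordinates of a multi-index are at most its norm, so that the shell is a
    subset of a finite box. *)
Definition shell_seq (l : nat) : seq (multi_index d) :=
  [seq k <- undup [seq [ffun j => g j : nat] | g : {ffun 'I_d -> 'I_l.+1}]
    | `[< index_shell R l k >]].

Lemma shell_seq_uniq l : uniq (shell_seq l).
Proof. by rewrite filter_uniq ?undup_uniq. Qed.

Lemma mem_shell_seq l k : k \in shell_seq l <-> index_shell R l k.
Proof.
rewrite mem_filter; split=> [/andP[/asboolP]|kl] //.
apply/andP; split; first exact/asboolP.
rewrite mem_undup; apply/mapP; exists [ffun j => inord (k j)].
  by rewrite mem_enum.
apply/ffunP => j; rewrite !ffunE inordK// ltnS -(ler_nat R).
by apply: le_trans (coordinate_le_norm k j) _; case: kl.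
Qed.

(** The ball as the disjoint union of its shells. *)
Fixpoint ball_seq (N : nat) : seq (multi_index d) :=
  if N is N'.+1 then ball_seq N' ++ shell_seq N'.+1 else shell_seq 0.

Lemma mem_shell_norm l k : k \in shell_seq l -> norm k <= l%:R.
Proof. by move=> /mem_shell_seq[]. Qed.

Lemma mem_ball_norm N k : k \in ball_seq N -> norm k <= N%:R.
Proof.
elim: N => [|N IH]/=; first exact: mem_shell_norm.
rewrite mem_cat => /orP[/IH|]; last exact: mem_shell_norm.
by move=> /le_trans; apply; rewrite ler_nat.
Qed.

Lemma mem_shell_ball N k : k \in ball_seq N -> k \notin shell_seq N.+1.
Proof.
move=> /mem_ball_norm kN; apply/negP => /mem_shell_seq[_]; apply.
by rewrite /index_ball/= intS addrAC subrr add0r.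
Qed.

Lemma ball_seq_uniq N : uniq (ball_seq N).
Proof.
elim: N => [|N IH]/=; first exact: shell_seq_uniq.
rewrite cat_uniq IH shell_seq_uniq andbT/=; apply/hasPn => k kl.
by apply: contraTN kl => /mem_shell_ball.
Qed.

Lemma mem_ball_seq N k :
  k \in ball_seq N <-> exists2 l, (l <= N)%N & k \in shell_seq l.
Proof.
elim: N => [|N IH]/=.
  by split=> [k0|[[]//]]; exists 0%N.
rewrite mem_cat; split=> [/orP[/IH[l lN kl]|kN]|[l lN kl]].
- by exists l => //; exact: leqW.
- by exists N.+1.
- move: lN; rewrite leq_eqVlt => /predU1P[<-|lN]; first by rewrite kl orbT.
  by apply/orP; left; apply/IH; exists l.
Qed.

Lemma size_ball_seq N : size (ball_seq N) = (\sum_(l < N.+1) size (shell_seq l))%N.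
Proof.
elim: N => [|N IH]; first by rewrite big_ord_recr big_ord0.
by rewrite big_ord_recr/= size_cat IH.
Qed.

(** The ball contains [0] and a unit vector. *)
Lemma size_ball_seq_ge2 N : (0 < d)%N -> (0 < N)%N -> (2 <= size (ball_seq N))%N.
Proof.
move=> d0; case: N => // N _; elim: N => [|N IH]; last first.
  by rewrite [ball_seq _]/= size_cat (leq_trans IH)// leq_addr.
rewrite [ball_seq _]/= size_cat -[2%N]/(1 + 1)%N leq_add//.
  rewrite -has_predT; apply/hasP; exists [ffun=> 0%N] => //; apply/mem_shell_seq.
  rewrite /index_shell /index_ball /euclidean_norm/=.
  rewrite big1 ?sqrtr0; last by move=> j _; rewrite ffunE expr0n.
  by split => //=; rewrite sub0r mulrN1z; apply/negP; rewrite -ltNge ltrN10.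
rewrite -has_predT; apply/hasP.
exists [ffun j => (j == Ordinal d0) : nat] => //; apply/mem_shell_seq.
rewrite /index_shell /index_ball /euclidean_norm/=.
rewrite (bigD1 (Ordinal d0))//= big1 ?addr0; last first.
  by move=> j j0; rewrite ffunE (negbTE j0) expr0n.
rewrite ffunE eqxx expr1n sqrtr1; split => //=.
by rewrite subrr; apply/negP; rewrite -ltNge ltr01.
Qed.

(** As [k] in the shell of [l] has norm at most [l], monotonicity gives
    [|lambda l| <= |lambda (norm k)|]. *)
Lemma prod_ball_seq_ge (lambda : R -> R) N :
  (forall s t : R, 0 <= s -> s <= t -> `|lambda t| <= `|lambda s|) ->
  \prod_(l < N.+1) `|lambda l%:R| ^+ size (shell_seq l) <=
  \prod_(k <- ball_seq N) `|lambda (norm k)|.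
Proof.
move=> mono.
have shell_le l : `|lambda l%:R| ^+ size (shell_seq l) <=
    \prod_(k <- shell_seq l) `|lambda (norm k)|.
  rewrite -[leLHS]mulr1 -iter_mulr -count_predT -(big_const_seq 1 *%R).
  rewrite big_seq [leRHS]big_seq; apply: ler_prod => k /mem_shell_norm kl.
  by rewrite normr_ge0 mono// sqrtr_ge0.
elim: N => [|N IH]; first by rewrite big_ord_recr big_ord0/= mul1r.
rewrite big_ord_recr/= big_cat/=; apply: ler_pM => //.
by apply: prodr_ge0 => l _; rewrite exprn_ge0.
Qed.

End shells.

Section dimensions.
Context {R : realType} {d : nat} {disp : measure_display} {T : measurableType disp}.
Variable mu : probability T R.
Variable phi : multi_index d -> T -> R.
Hypothesis phi2 : forall m, phi m \in Lfun mu 2%:E.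
Hypothesis phi_on : forall m m', \int[mu]_x (phi m x * phi m' x) = (m == m')%:R.

Lemma combination_on_seq (s : seq (multi_index d)) (r : seq (multi_index d))
  (a : multi_index d -> R) : uniq s -> {subset r <= s} ->
  exists b : multi_index d -> R,
    (fun x => \sum_(k <- r) a k * phi k x) = (fun x => \sum_(k <- s) b k * phi k x).
Proof.
move=> us; elim: r => [_|k r IH rs].
  exists (fun=> 0); apply/funext => x; rewrite big_nil big1// => k _.
  by rewrite mul0r.
have [b bE] := IH (fun j jr => rs j (mem_behead (s := k :: r) jr)).
exists (fun j => b j + (j == k)%:R * a k); apply/funext => x.
rewrite big_cons; have := congr1 (@^~ x) bE => /= ->.
under [RHS]eq_bigr do rewrite mulrDl; rewrite big_split/= addrC; congr (_ + _).
rewrite (bigD1_seq k)//=; last by apply: rs; rewrite mem_head.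
rewrite eqxx mul1r big1 ?addr0// => j jk.
by rewrite (negbTE jk) !mul0r.
Qed.

Lemma Hspace_combination l f : Hspace phi l f ->
  exists b : multi_index d -> R,
    f = (fun x => \sum_(k <- shell_seq R d l) b k * phi k x).
Proof.
move=> [s [a [sl ->]]]; apply: combination_on_seq; first exact: shell_seq_uniq.
by move=> k /sl/mem_shell_seq.
Qed.

Lemma mem_Hspace l k : k \in shell_seq R d l -> Hspace phi l (phi k).
Proof.
move=> kl; exists [:: k], (fun=> 1); split.
  by move=> j; rewrite inE => /eqP ->; apply/mem_shell_seq.
by apply/funext => x; rewrite big_seq1 mul1r.
Qed.

Lemma ae_dim_Hspace l : ae_dim mu (Hspace phi l) = size (shell_seq R d l).
Proof.
apply: (ae_dim_span phi2 phi_on (shell_seq_uniq R d l)).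
  by move=> k; exact: mem_Hspace.
exact: Hspace_combination.
Qed.

Lemma sum_Hspace_combination N (h : nat -> T -> R) :
  (forall l, (l <= N)%N -> Hspace phi l (h l)) ->
  exists b : multi_index d -> R,
    (fun x => \sum_(l < N.+1) h l x) =
    (fun x => \sum_(k <- ball_seq R d N) b k * phi k x).
Proof.
elim: N => [|N IH] hH.
  have [b bE] := Hspace_combination (hH 0%N (leqnn _)); exists b.
  by apply/funext => x; rewrite big_ord_recr big_ord0/= add0r bE.
have [b bE] := IH (fun l lN => hH l (leqW lN)).
have [c cE] := Hspace_combination (hH N.+1 (leqnn _)).
exists (fun k => if k \in ball_seq R d N then b k else c k); apply/funext => x.
rewrite big_ord_recr/= big_cat/=; congr (_ + _).
  have := congr1 (@^~ x) bE => /= ->.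
  by rewrite big_seq [RHS]big_seq; apply: eq_bigr => k ->.
rewrite cE big_seq [RHS]big_seq; apply: eq_bigr => k kl.
by rewrite ifN//; apply: contraTN kl; exact: mem_shell_ball.
Qed.

Lemma ae_dim_Tspace N : ae_dim mu (Tspace phi N) = size (ball_seq R d N).
Proof.
apply: (ae_dim_span phi2 phi_on (ball_seq_uniq R d N)).
  move=> k /mem_ball_seq[l lN kl].
  exists (fun l' => if l' == l :> nat then phi k else fun=> 0); split.
    move=> l'; case: eqP => [->|_]; first exact: mem_Hspace.
    exists [::], (fun=> 0); split => //.
    by apply/funext => x; rewrite big_nil.
  apply/funext => x; rewrite (bigD1 (inord l))//= inordK// eqxx.
  rewrite big1 ?addr0// => l' ll'; case: eqP => // e; move: ll'.
  by rewrite -e inord_val eqxx.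
move=> f [h [hH ->]].
have [|b bE] := @sum_Hspace_combination N (fun l => h (inord l)).
  by move=> l lN; have := hH (inord l); rewrite inordK.
exists b; rewrite -bE; apply/funext => x.
by apply: eq_bigr => l _; rewrite inord_val.
Qed.

End dimensions.

(** * Almost everywhere bounded orthonormal systems *)

Section change_of_representatives.
Context {R : realType} {d : nat} {disp : measure_display} {T : measurableType disp}.
Variable mu : probability T R.
Variables phi psi : multi_index d -> T -> R.
Hypothesis mphi : forall m, measurable_fun setT (phi m).
Hypothesis mpsi : forall m, measurable_fun setT (psi m).
Hypothesis phi_psi : forall m, phi m = psi m %[ae mu].

Lemma fourier_ae_eq f m : measurable_fun setT f ->
  fourier mu phi f m = fourier mu psi f m.
Proof.
move=> mf; rewrite /fourier /Rintegral; congr fine.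
apply: ae_eq_integral => //.
- by apply/measurable_EFinP; exact: measurable_funM.
- by apply/measurable_EFinP; exact: measurable_funM.
- by apply: filterS (phi_psi m) => x /(_ I) /= -> _.
Qed.

Lemma orthonormal_ae_eq m m' :
  \int[mu]_x (phi m x * phi m' x) = \int[mu]_x (psi m x * psi m' x).
Proof.
have -> : \int[mu]_x (phi m x * phi m' x) = fourier mu phi (phi m) m' by [].
rewrite fourier_ae_eq// /fourier.
under eq_Rintegral do rewrite mulrC; under [RHS]eq_Rintegral do rewrite mulrC.
exact: fourier_ae_eq.
Qed.

Lemma multiplier_value_ae_eq lam q f g : measurable_fun setT f ->
  multiplier_value mu phi lam q f g <-> multiplier_value mu psi lam q f g.
Proof.
move=> mf; split=> -[gq gval]; split => // m; have mg := Lfun_measurable gq.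
  by rewrite -!fourier_ae_eq.
by rewrite !fourier_ae_eq.
Qed.

(** Only the Fourier coefficients enter, and they do not depend on the
    representatives of the [phi m]. *)
Lemma multiplier_entropy_ae_eq lam p q k :
  multiplier_entropy mu phi lam p q k = multiplier_entropy mu psi lam p q k.
Proof.
have ballE : multiplier_ball mu phi lam p q = multiplier_ball mu psi lam p q.
  apply/seteqP; split=> g [f fp fg]; exists f => //; move: fg;
    by apply multiplier_value_ae_eq; exact: Lfun_measurable fp.1.
rewrite /multiplier_entropy ballE; congr (if _ then _ else _).
apply: asbool_equiv_eq; rewrite /multiplier_bounded ballE.
split=> -[h s]; split => // f fp; have [g fg] := h f fp; exists g; move: fg;
  by apply multiplier_value_ae_eq; exact: Lfun_measurable fp.
Qed.

End change_of_representatives.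

Lemma truncate_ae_eq {R : realType} {disp : measure_display}
  {T : measurableType disp} (mu : probability T R) (f : T -> R) (K : R) :
  ('N[mu]_(+oo%E)[EFin \o f] <= K%:E)%E ->
  f = (fun x => truncate K (f x)) %[ae mu].
Proof.
rewrite LnormyE => fK.
apply: filterS (ess_sup_ge mu (abse \o (EFin \o f))) => x /= fx _.
have := le_trans fx fK; rewrite lee_fin => /ler_normlP[h1 h2].
by rewrite /truncate min_r// max_r// lerNl.
Qed.

Lemma exprn_powR_inv {R : realType} (x : R) (n : nat) : 0 <= x -> (0 < n)%N ->
  (x ^+ n) `^ n%:R^-1 = x.
Proof.
move=> x0 n0; rewrite -powR_mulrn// -powRrM mulfV ?pnatr_eq0 -?lt0n//.
by rewrite powRr1.
Qed.

Lemma powR_inv_exprn {R : realType} (x : R) (n : nat) : 0 <= x -> (0 < n)%N ->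
  (x `^ n%:R^-1) ^+ n = x.
Proof.
move=> x0 n0; rewrite -powR_mulrn ?powR_ge0// -powRrM mulVf ?pnatr_eq0 -?lt0n//.
by rewrite powRr1.
Qed.

Theorem theorem4p3 (R : realType) (d : nat) (d_gt0 : (0 < d)%N)
  (disp : 'I_d -> measure_display) (T : forall j, measurableType (disp j))
  (nu : forall j, probability (T j) R)
  (mu : probability (product_space T) R)
  (mu_prod : is_product_measure nu mu)
  (phi : multi_index d -> product_space T -> R)
  (phi_cons : complete_orthonormal mu phi)
  (K : R) (K_gt0 : 0 < K)
  (phi_bounded : forall m, ('N[mu]_(+oo%E)[EFin \o phi m] <= K%:E)%E)
  (p q : \bar R) (p_ge1 : (1 <= p)%E) (q_ge1 : (1 <= q)%E) :
  exists C : R, 0 < C /\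
    forall lambda : R -> R,
      (forall s t : R, 0 <= s -> s <= t -> `|lambda t| <= `|lambda s|) ->
      let lam := fun k : multi_index d => lambda (euclidean_norm R k) in
      forall N k : nat, (0 < N)%N -> (0 < k)%N ->
        let dl := fun l : nat => ae_dim mu (Hspace phi l) in
        let n := ae_dim mu (Tspace phi N) in
        [/\ n = (\sum_(l < N.+1) dl l)%N,
            ((C * 2 `^ (- (k%:R / n%:R))
                * (\prod_(l < N.+1) `|lambda l%:R| ^+ dl l) `^ (n%:R^-1)
                * Vfactor p q n)%:E
              <= multiplier_entropy mu phi lam p q k)%E
          & (k = n ->
              (C * `|lambda N%:R| * Vfactor p q n)%:E
                <= multiplier_entropy mu phi lam p q n)%E].
Proof.
have [phi2 phi_on phi_complete] := phi_cons.
(* Representatives that are bounded everywhere. *)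
pose psi m x := truncate K (phi m x).
have mphi m : measurable_fun setT (phi m) := Lfun_measurable (phi2 m).
have mpsi m : measurable_fun setT (psi m).
  by apply: measurable_maxr => //; exact: measurable_minr.
have psiK m x : `|psi m x| <= K by exact: norm_truncate_le (ltW K_gt0).
have phi_psi m : phi m = psi m %[ae mu] by exact: truncate_ae_eq.
have psi_on m m' : \int[mu]_x (psi m x * psi m' x) = (m == m')%:R.
  by rewrite -(orthonormal_ae_eq mphi mpsi phi_psi).
have psi_complete f : f \in Lfun mu 2%:E ->
    (forall m, fourier mu psi f m = 0) -> f = cst 0 %[ae mu].
  move=> f2 f0; apply: (phi_complete _ f2) => m.
  by rewrite (fourier_ae_eq mphi mpsi phi_psi)//; exact: Lfun_measurable f2.
have [C C0 CP] := entropy_lower_bound mpsi psiK psi_on psi_complete K_gt0 p_ge1 q_ge1.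
(* For k = n the factor 2 `^ (- 1) goes into the constant. *)
exists (C / 2); split; first by rewrite divr_gt0.
move=> lambda mono lam N k N0 k0 dl n.
have dlE l : dl l = size (shell_seq R d l) by exact: ae_dim_Hspace.
have nE : n = size (ball_seq R d N) by exact: ae_dim_Tspace.
have nsum : n = (\sum_(l < N.+1) dl l)%N.
  by rewrite nE size_ball_seq; apply: eq_bigr => l _; rewrite dlE.
have [n' n'E] : exists n', n = n'.+2.
  have := size_ball_seq_ge2 R d_gt0 N0; rewrite -nE.
  by case: (n) => [|[|n']]// _; exists n'.
have n0 : (0 < n)%N by rewrite n'E.
pose P := \prod_(l < N.+1) `|lambda l%:R| ^+ dl l.
have P0 : 0 <= P by apply: prodr_ge0 => l _; rewrite exprn_ge0.
pose Q := \prod_(m <- ball_seq R d N) `|lam m|.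
have PQ : P <= Q.
  rewrite /P; under eq_bigr do rewrite dlE.
  exact: prod_ball_seq_ge.
have V0 : 0 <= Vfactor p q n :> R by rewrite n'E Vfactor_ge0.
have main j : (0 < j)%N ->
    ((C * 2 `^ (- (j%:R / n%:R)) * P `^ n%:R^-1 * Vfactor p q n)%:E
      <= multiplier_entropy mu phi lam p q j)%E.
  move=> j0; have [P_eq0|Pneq0] := eqVneq P 0.
    rewrite P_eq0 powR0 ?invr_eq0 ?pnatr_eq0 -?lt0n// mulr0 mul0r.
    by apply: multiplier_entropy_ge => _ eps c /ltW.
  (* From here on no multiplier in the ball vanishes. *)
  have Q0 : 0 < Q by apply: lt_le_trans PQ; rewrite lt_def Pneq0.
  have sE : size (ball_seq R d N) = n'.+2 by rewrite -nE.
  pose idx (i : 'I_n'.+2) := nth [ffun=> 0%N] (ball_seq R d N) i.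
  have idx_inj : injective idx.
    move=> i i' /eqP; rewrite nth_uniq ?sE ?ball_seq_uniq//.
    by move=> /eqP /val_inj.
  have lam0 i : lam (idx i) != 0.
    have : Q != 0 by rewrite gt_eqF.
    rewrite prodf_seq_neq0 => /allP/(_ (idx i)); rewrite normr_eq0/=; apply.
    by rewrite mem_nth// sE.
  pose M : R := 2 * (2 ^ j.-1)%:R.
  have ME : M = 2 ^+ j by rewrite /M natrX -exprS prednK.
  have M0 : 0 < M by rewrite ME exprn_gt0.
  pose t := (Q / M) `^ n%:R^-1.
  have t0 : 0 < t by rewrite powR_gt0// divr_gt0.
  have prodE : \prod_i `|lam (idx i)| = M * t ^+ n'.+2.
    have -> : t ^+ n'.+2 = Q / M by rewrite -n'E powR_inv_exprn// divr_ge0// ltW.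
    rewrite mulrC divfK ?gt_eqF//.
    by rewrite /Q (big_nth [ffun=> 0%N]) big_mkord sE.
  have lamL m : `|lam m| <= `|lambda 0| by rewrite mono// sqrtr_ge0.
  have := CP lam _ n' j idx t lamL idx_inj lam0 t0 prodE.
  rewrite -(multiplier_entropy_ae_eq mphi mpsi phi_psi) -n'E; apply: le_trans.
  rewrite lee_fin ler_wpM2r// -mulrA ler_wpM2l ?(ltW C0)//.
  rewrite /t powRM ?invr_ge0 ?(ltW Q0) ?(ltW M0)// mulrC.
  have -> : M^-1 `^ n%:R^-1 = 2 `^ (- (j%:R / n%:R)).
    by rewrite ME -powR_mulrn// -powRN -powRrM mulNr.
  rewrite ler_wpM2r ?powR_ge0// ge0_ler_powR ?nnegrE ?invr_ge0//.
  exact: ltW.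
have PN : `|lambda N%:R| <= P `^ n%:R^-1.
  rewrite -[leLHS](exprn_powR_inv (normr_ge0 _) n0).
  rewrite ge0_ler_powR ?nnegrE ?invr_ge0 ?exprn_ge0// nsum -prodrXr.
  apply: ler_prod => l _; rewrite exprn_ge0//= lerXn2r ?nnegrE// mono//.
  by rewrite ler_nat -ltnS.
split => //.
  apply: le_trans (main k k0); rewrite lee_fin ler_wpM2r//.
  rewrite ler_wpM2r ?powR_ge0// ler_wpM2r ?powR_ge0//.
  by rewrite ler_pdivrMr// ler_peMr ?(ltW C0)// ler1n.
move=> _; apply: le_trans (main n n0); rewrite lee_fin ler_wpM2r//.
by rewrite divff ?pnatr_eq0 -?lt0n// powR_inv1// ler_wpM2l// divr_ge0// ltW.
Qed.
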